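(* Let $k\in\mathbb N$, $\nu>0$ and $f\in\mathcal B_k^{2+\nu}$ with domain $I=[0,1)$ such that $\int_{I}\frac{D^2f(x)}{Df(x)}dx=0$. Then there are constants $C>0$ and $0<\lambda<1$ such that for every $n\ge 0$ and every $\alpha\in\mathcal A$, $$d_{C^2}\big(\mathcal Z_{I_\alpha^n}(R^n(f)),\mathrm{Id}\big)\le C\lambda^{\sqrt n}.$$
   Context: Let $\mathcal A$ be a finite alphabet with $d\ge 2$ elements and $I$ a bounded interval. A generalized interval exchange map (g.i.e.m.) is a bijection $f:I\to I$ together with a partition $\{I_\alpha\}_{\alpha\in\mathcal A}$ of $I$ into nonempty intervals of the form $[a,b)$ such that each $f|_{I_\alpha}$ is an orientation-preserving homeomorphism onto an interval. For intervals $J,U$ write $J<U$ if their interiors are disjoint and $x<y$ for all $x\in J$, $y\in U$. The combinatorial data of $f$ are the bijections $\pi_0,\pi_1:\mathcal A\to\{1,\dots,d\}$ with $I_\alpha<I_\beta\iff\pi_0(\alpha)<\pi_0(\beta)$ and $f(I_\alpha)<f(I_\beta)\iff\pi_1(\alpha)<\pi_1(\beta)$; they are assumed irreducible: $\pi_1\circ\pi_0^{-1}(\{1,\dots,j\})\neq\{1,\dots,j\}$ for $1\le j<d$. Rauzy–Veech renormalization: let $\alpha(\varepsilon)=\pi_\varepsilon^{-1}(d)$, $\varepsilon\in\{0,1\}$. If $|I_{\alpha(0)}|>|f(I_{\alpha(1)})|$, $f$ has type 0, winner $\alpha(0)$, loser $\alpha(1)$, and $I^1=I\setminus f(I_{\alpha(1)})$,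 $I^1_\alpha=I_\alpha$ for $\alpha\ne\alpha(0)$, $I^1_{\alpha(0)}=I_{\alpha(0)}\setminus f(I_{\alpha(1)})$. If $|I_{\alpha(0)}|<|f(I_{\alpha(1)})|$, $f$ has type 1, winner $\alpha(1)$, loser $\alpha(0)$, and $I^1=I\setminus I_{\alpha(0)}$, $I^1_\alpha=I_\alpha$ for $\alpha\ne\alpha(0),\alpha(1)$, $I^1_{\alpha(1)}=f^{-1}(f(I_{\alpha(1)})\setminus I_{\alpha(0)})$, $I^1_{\alpha(0)}=I_{\alpha(1)}\setminus I^1_{\alpha(1)}$. The renormalization $R(f):I^1\to I^1$ is the first return map of $f$ to $I^1$, regarded as a g.i.e.m. with partition $\{I^1_\alpha\}$. $f$ is infinitely renormalizable if $R^n(f)$ is defined for all $n$. Write $f_n=R^n(f)$ ($f_0=f$), $I^n$ its domain ($I^0=I$), $\{I^n_\alpha\}$ its partition, $\varepsilon_n$ its type, $\alpha_n(\varepsilon_n)$ and $\alpha_n(1-\varepsilon_n)$ its winner and loser. $f$ has $k$-bounded combinatorics if it is infinitely renormalizable and for each $n$ and $\beta,\gamma\in\mathcal A$ there exist $n_1,p\ge 0$ with $|n-n_1|<k$, $|n-n_1-p|<k$, $\alpha_{n_1}(\varepsilon_{n_1})=\beta$, $\alpha_{n_1+p}(1-\varepsilon_{n_1+p})=\gamma$ and $\alpha_{n_1+i}(1-\varepsilon_{n_1+i})=\alpha_{n_1+i+1}(\varepsilon_{n_1+i+1})$ for $0\le i<p$. $f$ has no connection if $f^m(\partial I_\alpha)\ne\partial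 I_\beta$ for all $m\ge1$ and $\alpha,\beta$ with $\pi_0(\beta)\ne1$, where $\partial[a,b)=\{a\}$. $f$ has genus one if it has at most two discontinuities. $\mathcal B_k^{2+\nu}$ is the set of g.i.e.m. $f$ such that (i) each $f|_{I_\alpha}$ extends to $\overline{I_\alpha}$ as an orientation-preserving $C^{2+\nu}$ diffeomorphism onto its image; (ii) $f$ has $k$-bounded combinatorics; (iii) $f$ has genus one and no connection. The integral $\int_I\frac{D^2f}{Df}$ means $\sum_\alpha\int_{I_\alpha}\frac{D^2f}{Df}$. Zoom: for an interval $H$ and a diffeomorphism $g$ on $H$, $\mathcal Z_H(g)=A_1\circ g\circ A_2:[0,1]\to[0,1]$, where $A_2$ is the orientation-preserving affine map sending $[0,1]$ onto $H$ and $A_1$ the orientation-preserving affine map sending $g(H)$ onto $[0,1]$ (here $g=R^n(f)|_{\overline{I^n_\alpha}}$). $d_{C^2}(f,g)=\sum_{i=0}^2\sup_{x\in[0,1]}|D^if(x)-D^ig(x)|$. *)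

(* Defs.v *)
From Stdlib Require Import Reals Lra Lia List.
Import ListNotations.
Open Scope R_scope.

(* Alphabet A = {0, ..., d-1} (indices, compared with nat <);
   combinatorial data pi0, pi1 take values in {1, ..., d} as in the paper. *)

(* A generalized interval exchange map: domain [il, ir), partition intervals
   I_a = [lft a, rgt a) for a < d, the map fmap, and combinatorial data. *)
Record giem := mkGiem {
  il : R; ir : R;
  lft : nat -> R; rgt : nat -> R;
  fmap : R -> R;
  pi0 : nat -> nat; pi1 : nat -> nat }.

Definition in_I (g : giem) (x : R) : Prop := il g <= x < ir g.
Definition in_part (g : giem) (a : nat) (x : R) : Prop := lft g a <= x < rgt g a.

Definition cont_within (P : R -> Prop) (f : R -> R) (x : R) : Prop :=
  forall eps, 0 < eps -> exists delta, 0 < delta /\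
    forall y, P y -> Rabs (y - x) < delta -> Rabs (f y - f x) < eps.

Definition deriv_within (P : R -> Prop) (f : R -> R) (x l : R) : Prop :=
  forall eps, 0 < eps -> exists delta, 0 < delta /\
    forall y, P y -> y <> x -> Rabs (y - x) < delta ->
      Rabs ((f y - f x) / (y - x) - l) < eps.

Definition closed_int (a b : R) (x : R) : Prop := a <= x <= b.

Definition set_lt (J U : R -> Prop) : Prop := forall x y, J x -> U y -> x < y.

Definition image_part (g : giem) (a : nat) (y : R) : Prop :=
  exists x, in_part g a x /\ fmap g x = y.

Definition is_giem (d : nat) (g : giem) : Prop :=
  il g < ir g /\
  (forall a, (a < d)%nat -> il g <= lft g a /\ lft g a < rgt g a /\ rgt g a <= ir g) /\
  (forall x, in_I g x -> exists a, (a < d)%nat /\ in_part g a x) /\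
  (forall a b x, (a < d)%nat -> (b < d)%nat -> a <> b ->
      in_part g a x -> in_part g b x -> False) /\
  (forall x, in_I g x -> in_I g (fmap g x)) /\
  (forall x y, in_I g x -> in_I g y -> fmap g x = fmap g y -> x = y) /\
  (forall y, in_I g y -> exists x, in_I g x /\ fmap g x = y) /\
  (* each restriction is an orientation-preserving homeomorphism onto an interval *)
  (forall a, (a < d)%nat ->
     (forall x, in_part g a x -> cont_within (in_part g a) (fmap g) x) /\
     (forall x y, in_part g a x -> in_part g a y -> x < y -> fmap g x < fmap g y)) /\
  (forall a, (a < d)%nat -> (1 <= pi0 g a <= d)%nat /\ (1 <= pi1 g a <= d)%nat) /\
  (forall a b, (a < d)%nat -> (b < d)%nat -> pi0 g a = pi0 g b -> a = b) /\
  (forall a b, (a < d)%nat -> (b < d)%nat -> pi1 g a = pi1 g b -> a = b) /\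
  (forall a b, (a < d)%nat -> (b < d)%nat ->
     (set_lt (in_part g a) (in_part g b) <-> (pi0 g a < pi0 g b)%nat) /\
     (set_lt (image_part g a) (image_part g b) <-> (pi1 g a < pi1 g b)%nat)) /\
  (* irreducibility: pi1 o pi0^{-1} ({1..j}) <> {1..j} for 1 <= j < d *)
  (forall j, (1 <= j < d)%nat ->
     ~ (forall i, (exists a, (a < d)%nat /\ (pi0 g a <= j)%nat /\ pi1 g a = i)
                  <-> (1 <= i <= j)%nat)).

(* |f(I_a)| : the image is an interval starting at f(lft a); L is its length *)
Definition image_len (g : giem) (a : nat) (L : R) : Prop :=
  exists s, is_lub (image_part g a) s /\ L = s - fmap g (lft g a).

(* One Rauzy-Veech step: h = R(g), of type e (false = type 0, true = type 1). *)
Definition RV_step (d : nat) (g h : giem) (e : bool) : Prop :=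
  exists a0 a1 L, (a0 < d)%nat /\ (a1 < d)%nat /\
    pi0 g a0 = d /\ pi1 g a1 = d /\ image_len g a1 L /\
    (forall x, in_I h x -> exists m, (1 <= m)%nat /\
        in_I h (Nat.iter m (fmap g) x) /\
        (forall j, (1 <= j < m)%nat -> ~ in_I h (Nat.iter j (fmap g) x)) /\
        fmap h x = Nat.iter m (fmap g) x) /\
    (if e then
       rgt g a0 - lft g a0 < L /\
       (forall x, in_I h x <-> (in_I g x /\ ~ in_part g a0 x)) /\
       (forall a x, (a < d)%nat -> a <> a0 -> a <> a1 -> (in_part h a x <-> in_part g a x)) /\
       (forall x, in_part h a1 x <->
          (in_I g x /\ image_part g a1 (fmap g x) /\ ~ in_part g a0 (fmap g x))) /\
       (forall x, in_part h a0 x <-> (in_part g a1 x /\ ~ in_part h a1 x))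
     else
       rgt g a0 - lft g a0 > L /\
       (forall x, in_I h x <-> (in_I g x /\ ~ image_part g a1 x)) /\
       (forall a x, (a < d)%nat -> a <> a0 -> (in_part h a x <-> in_part g a x)) /\
       (forall x, in_part h a0 x <-> (in_part g a0 x /\ ~ image_part g a1 x))).

Definition winner (d : nat) (g : giem) (e : bool) (b : nat) : Prop :=
  (b < d)%nat /\ (if e then pi1 g b = d else pi0 g b = d).
Definition loser (d : nat) (g : giem) (e : bool) (b : nat) : Prop :=
  (b < d)%nat /\ (if e then pi0 g b = d else pi1 g b = d).

Definition k_bounded (d k : nat) (S : nat -> giem) (eps : nat -> bool) : Prop :=
  forall n b c, (b < d)%nat -> (c < d)%nat ->
    exists n1 p,
      (n < n1 + k)%nat /\ (n1 < n + k)%nat /\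
      (n < n1 + p + k)%nat /\ (n1 + p < n + k)%nat /\
      winner d (S n1) (eps n1) b /\
      loser d (S (n1 + p)%nat) (eps (n1 + p)%nat) c /\
      (forall i, (i < p)%nat -> exists a,
          loser d (S (n1 + i)%nat) (eps (n1 + i)%nat) a /\
          winner d (S (n1 + i + 1)%nat) (eps (n1 + i + 1)%nat) a).

Definition genus_one (g : giem) : Prop :=
  exists x1 x2, forall x, in_I g x -> ~ cont_within (in_I g) (fmap g) x ->
    x = x1 \/ x = x2.

Definition no_connection (d : nat) (g : giem) : Prop :=
  forall m a b, (1 <= m)%nat -> (a < d)%nat -> (b < d)%nat -> pi0 g b <> 1%nat ->
    Nat.iter m (fmap g) (lft g a) <> lft g b.

Definition C2nu_ext (l r : R) (f : R -> R) (nu : R) (G D1 D2 : R -> R) : Prop :=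
  (forall x, l <= x < r -> G x = f x) /\
  (forall x, l <= x <= r ->
     deriv_within (closed_int l r) G x (D1 x) /\
     deriv_within (closed_int l r) D1 x (D2 x) /\ 0 < D1 x) /\
  (exists H, forall x y, l <= x <= r -> l <= y <= r ->
     Rabs (D2 x - D2 y) <= H * Rpower (Rabs (x - y)) nu).

Definition zoom (l r : R) (G : R -> R) (x : R) : R :=
  (G (l + x * (r - l)) - G l) / (G r - G l).

(* d_{C^2}(Z, Id) <= B, where Z1, Z2 are the first two derivatives of Z on [0,1] *)
Definition dC2_id_le (Z Z1 Z2 : R -> R) (B : R) : Prop :=
  exists s0 s1 s2,
    is_lub (fun y => exists x, 0 <= x <= 1 /\ y = Rabs (Z x - x)) s0 /\
    is_lub (fun y => exists x, 0 <= x <= 1 /\ y = Rabs (Z1 x - 1)) s1 /\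
    is_lub (fun y => exists x, 0 <= x <= 1 /\ y = Rabs (Z2 x - 0)) s2 /\
    s0 + s1 + s2 <= B.

Definition Rsum_list (v : nat -> R) (d : nat) : R :=
  fold_right Rplus 0 (map v (seq 0 d)).

(* Main.v *)
Require Import Defs.
From Stdlib Require Import Reals List.
From Stdlib Require Import Lra Lia Wf_nat Ranalysis5 Classical.
From Coquelicot Require Import Coquelicot.
Import ListNotations.
Open Scope R_scope.

(** For a point [x] of a level-[n] interval with return time [r], put
    [W = sum_(i < r) Df^i(x)]; then the nonlinearity of [R^n f] at [x] is
    [psi * W], where [psi] is the average of [D^2 f / Df] over the orbit with
    weights [Df^i(x) / W], and [W] times the length of the interval is bounded.
    So it suffices to bound [psi], and since the total nonlinearity is
    zero, to bound its oscillation.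

    In genus one the slopes [Df_n] stay bounded. The top and bottom rows are A B C
    and C B A, and up to bounded error [ln Df_n] is [a] on A, [c] on C and [a + c] on
    B, because the jumps of [ln Df_n] at the marked points are invariant. The pair
    [(a, c)] evolves by shears, while [a] and [c] cannot both be very positive or
    both very negative as [f_n] is onto; running the shears backwards expands such
    pairs, so [(a, c)] is bounded. Bounded geometry follows.

    Given levels [n] and [m = n + j K], [psi_m] at two points of the same interval
    averages [psi_n] over orbits that are exponentially close in [j], with
    comparable weights, and every orbit of one more window visits every interval.
    Hence [osc psi_(m + K) <= (1 - c) osc psi_n + C mu^j]. Letting [j] grow by one
    at each step, [i] steps use about [K i^2 / 2] levels: this is where
    [lambda^(sqrt n)] comes from. *)

(** Distances are measured by [Td], the total length of the orbit pieces between two points, and not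
    by their separation. [Td] is additive when orbits are concatenated, and since the orbit pieces
    of all level-[n] intervals tile the domain it never exceeds [Ttot]; so the log-slope oscillates
    by at most [V = M * Ttot] on each interval, at every level. This says nothing about slopes on
    different intervals: that comparison is the real obstacle, and the place where genus one enters.

    The modulus of continuity of [psi n] with respect to [Td n] is uniform in [n] but does not
    improve with [n], and at each level the [d] intervals share the same total [Ttot], so they do
    not all become small. A contraction with a small error must therefore wait until the deeper
    intervals are small as seen from level [n], and must wait longer as the oscillation that the
    error has to match gets smaller. This is why [j] cannot be kept fixed. *)

Lemma Rabs_le_bounds x a : Rabs x <= a -> - a <= x <= a.
Proof. intros H. pose proof (Rle_abs x). pose proof (Rle_abs (- x)) as H'. rewrite Rabs_Ropp in H'. lra. Qed.

Ltac unabs H := apply Rabs_le_bounds in H.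

Ltac nat_cases := repeat match goal with
  | |- context [Nat.leb ?a ?b] => destruct (Nat.leb_spec a b)
  | |- context [Nat.eqb ?a ?b] => destruct (Nat.eqb_spec a b)
  | H : context [Nat.leb ?a ?b] |- _ => destruct (Nat.leb_spec a b)
  end.

(** * Finite sums over the alphabet *)

Fixpoint rsum (v : nat -> R) (n : nat) : R :=
  match n with O => 0 | S m => rsum v m + v m end.

Lemma rsum_ext v w n : (forall b, (b < n)%nat -> v b = w b) -> rsum v n = rsum w n.
Proof.
induction n as [|n IH]; simpl; intros H; auto.
rewrite IH, H; auto; intros; apply H; lia.
Qed.

Lemma rsum_le v w n : (forall b, (b < n)%nat -> v b <= w b) -> rsum v n <= rsum w n.
Proof.
induction n as [|n IH]; simpl; intros H; [lra|].
apply Rplus_le_compat; [apply IH; intros; apply H|apply H]; lia.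
Qed.

Lemma rsum_const c n : rsum (fun _ => c) n = INR n * c.
Proof. induction n as [|n IH]; [simpl; ring|]. rewrite S_INR. simpl rsum. rewrite IH. ring. Qed.

Lemma rsum_minus v w n : rsum (fun b => v b - w b) n = rsum v n - rsum w n.
Proof. induction n as [|n IH]; simpl; [ring|]. rewrite IH; ring. Qed.

Lemma rsum_delta i s n : (i < n)%nat -> rsum (fun b => if Nat.eqb b i then s else 0) n = s.
Proof.
intros Hi.
assert (Z : forall m, (m <= i)%nat -> rsum (fun b => if Nat.eqb b i then s else 0) m = 0).
{ induction m as [|m IH]; simpl; intros Hm; auto.
  rewrite IH by lia. destruct (Nat.eqb_spec m i); [lia|ring]. }
induction n as [|n IH]; [lia|]. simpl.
destruct (Nat.eqb_spec n i) as [->|Hn]; [rewrite Z by lia; ring|].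
rewrite IH by lia; ring.
Qed.

Lemma rsum_term_le v n i : (forall b, (b < n)%nat -> 0 <= v b) -> (i < n)%nat -> v i <= rsum v n.
Proof.
intros H Hi. rewrite <- (rsum_delta i (v i) n Hi). apply rsum_le. intros b Hb.
destruct (Nat.eqb_spec b i) as [->|]; [lra|auto].
Qed.

Lemma rsum_two_le v n i j : (forall b, (b < n)%nat -> 0 <= v b) ->
  (i < n)%nat -> (j < n)%nat -> i <> j -> v i + v j <= rsum v n.
Proof.
intros H Hi Hj Hij.
assert (E : rsum (fun b => v b - (if Nat.eqb b i then v i else 0)) n = rsum v n - v i).
{ rewrite rsum_minus, rsum_delta; auto. }
pose proof (rsum_term_le (fun b => v b - (if Nat.eqb b i then v i else 0)) n j) as Hp.
rewrite E in Hp. simpl in Hp. destruct (Nat.eqb_spec j i); [lia|].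
assert (v j - 0 <= rsum v n - v i); [|lra].
apply Hp; auto. intros b Hb. destruct (Nat.eqb_spec b i) as [->|]; [lra|].
specialize (H b Hb); lra.
Qed.

(** A renormalization step touches two letters only; conservation of a sum then reduces to these two
    terms. *)
Lemma rsum_two_changed v w n i j : (i < n)%nat -> (j < n)%nat -> i <> j ->
  (forall b, (b < n)%nat -> b <> i -> b <> j -> v b = w b) ->
  v i + v j = w i + w j -> rsum v n = rsum w n.
Proof.
intros Hi Hj Hij H E.
assert (A : rsum (fun b => (v b - w b) - (if Nat.eqb b i then v i - w i else 0)) n
  = rsum (fun b => if Nat.eqb b j then v j - w j else 0) n).
{ apply rsum_ext. intros b Hb. destruct (Nat.eqb_spec b i) as [Ei|Ei];
  destruct (Nat.eqb_spec b j) as [Ej|Ej]; try (subst b; lia); try (subst b; lra).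
  rewrite H; auto; lra. }
rewrite (rsum_minus (fun b => v b - w b)), rsum_minus, !rsum_delta in A by auto. lra.
Qed.

(** * Mean values, exponentials and finite injections *)

Lemma mean_value f f' a b : a <= b ->
  (forall c, a <= c <= b -> derivable_pt_lim f c (f' c)) ->
  exists c, a <= c <= b /\ f b - f a = f' c * (b - a).
Proof.
intros [Hab|Hab] H.
- destruct (MVT_cor2 f f' a b Hab H) as [c [E Hc]]. exists c; split; [lra|exact E].
- subst b. exists a; split; [lra|ring].
Qed.

Lemma derivable_lim_ext f g x l : (forall y, f y = g y) ->
  derivable_pt_lim f x l -> derivable_pt_lim g x l.
Proof.
intros E H eps He. destruct (H eps He) as [delta Hd]. exists delta. intros h h0 hd.
rewrite <- !E. auto.
Qed.

Lemma exp_le_compat x y : x <= y -> exp x <= exp y.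
Proof. intros [H|H]; [left; apply exp_increasing; auto|subst; lra]. Qed.

Lemma exp_ge_1 x : 0 <= x -> 1 <= exp x.
Proof. intros H. rewrite <- exp_0. apply exp_le_compat; auto. Qed.

Lemma exp_ratio x y V : 0 < x -> 0 < y -> ln x - ln y <= V -> x <= exp V * y.
Proof.
intros Hx Hy H. apply Rle_trans with (exp (V + ln y)).
- rewrite <- (exp_ln x Hx) at 1. apply exp_le_compat; lra.
- rewrite exp_plus, exp_ln by auto. lra.
Qed.

Lemma injective_surjective (f : nat -> nat) n :
  (forall a, (a < n)%nat -> (f a < n)%nat) ->
  (forall a b, (a < n)%nat -> (b < n)%nat -> f a = f b -> a = b) ->
  forall j, (j < n)%nat -> exists a, (a < n)%nat /\ f a = j.
Proof.
intros Hf Hi j Hj.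
assert (H : incl (seq 0 n) (map f (seq 0 n))).
{ apply NoDup_length_incl.
  - assert (A : forall l, NoDup l -> (forall a, List.In a l -> (a < n)%nat) -> NoDup (map f l)).
    { induction l as [|x l IH]; intros H1 H2; simpl; constructor; inversion H1; subst.
      - intros H. apply in_map_iff in H. destruct H as [y [E Hy]].
        apply Hi in E; [subst; auto|apply H2; right; auto|apply H2; left; auto].
      - apply IH; auto. intros a Ha; apply H2; right; auto. }
    apply A; [apply seq_NoDup|]. intros a Ha. apply in_seq in Ha. lia.
  - rewrite length_map. auto.
  - intros y Hy. apply in_map_iff in Hy. destruct Hy as [x [<- Hx]].
    apply in_seq in Hx. apply in_seq. split; [lia|]. apply Hf. lia. }
specialize (H j ltac:(apply in_seq; lia)). apply in_map_iff in H.
destruct H as [a [E Ha]]. apply in_seq in Ha. exists a. split; [lia|auto].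
Qed.

(* If [(X, Y)] lies in the positive quadrant at time [e] up to [D], then running
   the shears backwards keeps it there and expands it. *)
Lemma shear_backwards (X Y : nat -> R) (la lc : nat -> bool) (D : R) (e : nat) :
  0 <= D ->
  (forall n, Rabs (X (S n) - X n + (if la n then Y n else 0)) <= D) ->
  (forall n, Rabs (Y (S n) - Y n + (if lc n then X n else 0)) <= D) ->
  (forall n, andb (la n) (lc n) = false) ->
  - D <= X e -> - D <= Y e ->
  forall s t, (t + s = e)%nat ->
    X e + D - D * 3 ^ S s <= X t /\ Y e + D - D * 3 ^ S s <= Y t /\
    ((exists m, (t <= m < e)%nat /\ la m = true) ->
       (X e + D) + (Y e + D) - D * 3 ^ S s <= X t) /\
    ((exists m, (t <= m < e)%nat /\ lc m = true) ->
       (X e + D) + (Y e + D) - D * 3 ^ S s <= Y t).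
Proof.
intros HD HX HY Hx Xe Ye. induction s as [|s IH]; intros t Ht.
- assert (t = e) by lia. subst t. simpl.
  repeat split; try lra; intros [m [Hm _]]; lia.
- destruct (IH (S t)) as [I1 [I2 [I3 I4]]]; [lia|].
  specialize (HX t). specialize (HY t). specialize (Hx t).
  unabs HX. unabs HY.
  (* A shear adds up the accumulated errors of both coordinates and at most [2 * D] more; since
     [3 * D <= B], tripling [B] absorbs all of it. *)
  assert (P : 3 <= 3 ^ S s) by (simpl; pose proof (pow_R1_Rle 3 s ltac:(lra)); lra).
  set (B := D * 3 ^ S s) in *.
  replace (D * 3 ^ S (S s)) with (3 * B) by (unfold B; simpl; ring).
  assert (HB : 3 * D <= B) by (unfold B; rewrite (Rmult_comm 3); apply Rmult_le_compat_l; auto).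
  assert (Split : forall l : nat -> bool, (exists m, (t <= m < e)%nat /\ l m = true) ->
     l t = false -> exists m, (S t <= m < e)%nat /\ l m = true).
  { intros l [m [Hm E]] E'. exists m. split; auto. assert (m <> t) by congruence. lia. }
  destruct (la t) eqn:Ea, (lc t) eqn:Ec; try discriminate; repeat split; try lra; intros H.
  + apply Split in H; auto. specialize (I4 H). lra.
  + apply Split in H; auto. specialize (I3 H). lra.
  + apply Split in H; auto. specialize (I3 H). lra.
  + apply Split in H; auto. specialize (I4 H). lra.
Qed.

(** At each time [(a, - c)] or [(- a, c)] lies in the positive quadrant up to [D]. In a window where
    each coordinate is sheared at least once, going backwards from its end doubles [|a| + |c|] up to
    a constant. Read forwards, the norm at [n + K] is at most half the norm at [n] plus a
    constant. *)
Lemma shear_bounded (a c : nat -> R) (la lc : nat -> bool) (D : R) (K : nat) :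
  0 <= D -> (1 <= K)%nat ->
  (forall n, Rabs (a (S n) - a n - (if la n then c n else 0)) <= D) ->
  (forall n, Rabs (c (S n) - c n - (if lc n then a n else 0)) <= D) ->
  (forall n, andb (la n) (lc n) = false) ->
  (forall n, exists m, (n <= m < n + K)%nat /\ la m = true) ->
  (forall n, exists m, (n <= m < n + K)%nat /\ lc m = true) ->
  (forall n, a n <= D \/ c n <= D) ->
  (forall n, - D <= a n \/ - D <= c n) ->
  exists B, forall n, Rabs (a n) <= B /\ Rabs (c n) <= B.
Proof.
intros HD HK Ha Hc Hx Wa Wc Hp Hn.
set (E := 4 * D + 2 * (D * 3 ^ S K)).
set (u := fun n => Rabs (a n) + Rabs (c n)).
assert (HE : 0 <= E).
{ unfold E. assert (0 <= D * 3 ^ S K) by (apply Rmult_le_pos; [lra|apply pow_le; lra]). lra. }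
assert (Step : forall n, 2 * u (n + K)%nat <= u n + E).
{ intros n. destruct (Wa n) as [m1 [M1 L1]]. destruct (Wc n) as [m2 [M2 L2]]. set (e := (n + K)%nat) in *.
  assert (Q : exists s, (s = 1 \/ s = -1) /\ - D <= s * a e /\ - D <= - s * c e).
  { destruct (Hp e), (Hn e);
    destruct (Rle_dec (c e) D), (Rle_dec (a e) D), (Rle_dec (- D) (c e)), (Rle_dec (- D) (a e));
    try lra; solve [exists 1; lra|exists (-1); lra]. }
  destruct Q as [s [Hs [Q1 Q2]]].
  destruct (shear_backwards (fun n => s * a n) (fun n => - s * c n) la lc D e HD) with (s := K) (t := n)
    as [_ [_ [I1 I2]]]; auto.
  - intros m. specialize (Ha m). destruct (la m); unabs Ha; apply Rabs_le; destruct Hs as [-> | ->]; lra.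
  - intros m. specialize (Hc m). destruct (lc m); unabs Hc; apply Rabs_le; destruct Hs as [-> | ->]; lra.
  - specialize (I1 ltac:(exists m1; auto)). specialize (I2 ltac:(exists m2; auto)). simpl in I1, I2.
    assert (Hle : forall x, s * x <= Rabs x /\ (- s) * x <= Rabs x).
    { intros x. pose proof (Rle_abs x). pose proof (Rle_abs (- x)) as Z. rewrite Rabs_Ropp in Z.
      destruct Hs as [-> | ->]; lra. }
    unfold u, E. pose proof (proj1 (Hle (a n))). pose proof (proj2 (Hle (c n))).
    assert (Rabs (a e) <= s * a e + 2 * D) by (destruct Hs as [-> | ->]; apply Rabs_le; lra).
    assert (Rabs (c e) <= - s * c e + 2 * D) by (destruct Hs as [-> | ->]; apply Rabs_le; lra).
    simpl pow. lra. }
assert (Hu : forall n, 0 <= u n).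
{ intros n. unfold u. pose proof (Rabs_pos (a n)). pose proof (Rabs_pos (c n)). lra. }
set (B := E + rsum u K).
assert (HB : E <= B).
{ unfold B. pose proof (rsum_term_le u K 0 ltac:(auto) ltac:(lia)). specialize (Hu 0%nat). lra. }
assert (Main : forall n, u n <= B).
{ induction n as [n IH] using (well_founded_induction lt_wf).
  destruct (Nat.lt_ge_cases n K) as [Hlt|Hge].
  - unfold B. pose proof (rsum_term_le u K n ltac:(auto) Hlt). lra.
  - specialize (IH (n - K)%nat ltac:(lia)). specialize (Step (n - K)%nat).
    replace (n - K + K)%nat with n in Step by lia. lra. }
exists B. intros n. specialize (Main n). unfold u in Main.
pose proof (Rabs_pos (a n)). pose proof (Rabs_pos (c n)). lra.
Qed.

(** * Combinatorics of genus one *)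

Definition ranking (d : nat) (rk : nat -> nat) : Prop :=
  (forall a, (a < d)%nat -> (1 <= rk a <= d)%nat) /\
  (forall a b, (a < d)%nat -> (b < d)%nat -> rk a = rk b -> a = b).

Lemma ranking_surj d rk j : ranking d rk -> (1 <= j <= d)%nat ->
  exists a, (a < d)%nat /\ rk a = j.
Proof.
intros [H1 H2] Hj.
destruct (injective_surjective (fun a => rk a - 1)%nat d) with (j := (j - 1)%nat) as [a [Ha E]].
- intros a Ha. specialize (H1 a Ha). lia.
- intros a b Ha Hb E. apply H2; auto. pose proof (H1 a Ha). pose proof (H1 b Hb). lia.
- lia.
- exists a. split; auto. specialize (H1 a Ha). lia.
Qed.

(** Induction on the rank from below gives one inequality, induction from above the other. *)
Lemma ranking_unique d rk rk' : ranking d rk -> ranking d rk' ->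
  (forall a b, (a < d)%nat -> (b < d)%nat -> (rk a < rk b)%nat -> (rk' a < rk' b)%nat) ->
  forall a, (a < d)%nat -> rk' a = rk a.
Proof.
intros H H' Hm.
assert (A : forall j a, (a < d)%nat -> rk a = S j -> (S j <= rk' a)%nat).
{ induction j as [|j IH]; intros a Ha E.
  - destruct H' as [H' _]. specialize (H' a Ha). lia.
  - destruct (ranking_surj d rk (S j) H) as [b [Hb Eb]].
    { destruct H as [H _]. specialize (H a Ha). lia. }
    specialize (IH b Hb Eb). specialize (Hm b a Hb Ha). lia. }
assert (B : forall j a, (a < d)%nat -> (rk a + j = d)%nat -> (rk' a + j <= d)%nat).
{ induction j as [|j IH]; intros a Ha E.
  - destruct H' as [H' _]. specialize (H' a Ha). lia.
  - destruct (ranking_surj d rk (S (rk a)) H) as [b [Hb Eb]]; [lia|].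
    specialize (IH b Hb ltac:(lia)). specialize (Hm a b Ha Hb). lia. }
intros a Ha. pose proof (proj1 H a Ha) as R.
pose proof (A (rk a - 1)%nat a Ha ltac:(lia)). pose proof (B (d - rk a)%nat a Ha ltac:(lia)). lia.
Qed.

Definition letter_at (d : nat) (rk : nat -> nat) (j : nat) : nat :=
  hd 0%nat (filter (fun a => Nat.eqb (rk a) j) (seq 0 d)).

Lemma letter_at_spec d rk j : ranking d rk -> (1 <= j <= d)%nat ->
  (letter_at d rk j < d)%nat /\ rk (letter_at d rk j) = j.
Proof.
intros H Hj. destruct (ranking_surj d rk j H Hj) as [a [Ha E]]. unfold letter_at.
assert (Hin : List.In a (filter (fun a => Nat.eqb (rk a) j) (seq 0 d))).
{ apply filter_In. split; [apply in_seq; lia|apply Nat.eqb_eq; auto]. }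
destruct (filter _ _) as [|c l] eqn:El; [destruct Hin|]. simpl.
assert (Hc : List.In c (c :: l)) by (left; auto). rewrite <- El in Hc.
apply filter_In in Hc. destruct Hc as [Hc1 Hc2]. apply in_seq in Hc1. apply Nat.eqb_eq in Hc2.
split; [lia|auto].
Qed.

Lemma letter_at_unique d rk j a : ranking d rk -> (a < d)%nat -> rk a = j -> letter_at d rk j = a.
Proof.
intros H Ha E. pose proof (proj1 H a Ha).
destruct (letter_at_spec d rk j H ltac:(lia)) as [H1 H2]. apply (proj2 H); auto. congruence.
Qed.

(* Ranks after moving the last letter [z] right behind [w]. *)
Definition reinsert (rk : nat -> nat) (z w a : nat) : nat :=
  if Nat.eqb a z then (rk w + 1)%nat
  else if Nat.leb (rk a) (rk w) then rk a else (rk a + 1)%nat.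

Lemma reinsert_ranking d rk z w : ranking d rk -> (z < d)%nat -> (w < d)%nat ->
  rk z = d -> w <> z -> ranking d (reinsert rk z w).
Proof.
intros [H1 H2] Hz Hw Ez Hwz. unfold reinsert.
assert (Hlt : forall a, (a < d)%nat -> a <> z -> (1 <= rk a < d)%nat).
{ intros a Ha Hn. specialize (H1 a Ha). assert (rk a <> d); [|lia].
  intros E. apply Hn, H2; auto. lia. }
pose proof (Hlt w Hw Hwz).
split.
- intros a Ha. destruct (Nat.eqb_spec a z) as [->|Hn]; [lia|].
  specialize (Hlt a Ha Hn). nat_cases; lia.
- intros a b Ha Hb.
  destruct (Nat.eqb_spec a z) as [->|Hna]; destruct (Nat.eqb_spec b z) as [->|Hnb]; auto.
  + nat_cases; lia.
  + nat_cases; lia.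
  + intros E. apply H2; auto. nat_cases; lia.
Qed.

(** Ranks are read off from real positions: [v'] agrees with [v] except at [z], which now sits
    between [w] and everything behind [w]. It is applied to left ends for the top row and to their
    images for the bottom row. *)
Lemma reinsert_order d rk z w (v v' : nat -> R) rk' : ranking d rk -> ranking d rk' ->
  (z < d)%nat -> (w < d)%nat -> rk z = d -> w <> z ->
  (forall a b, (a < d)%nat -> (b < d)%nat -> (rk a < rk b)%nat -> v a < v b) ->
  (forall a b, (a < d)%nat -> (b < d)%nat -> v' a < v' b -> (rk' a < rk' b)%nat) ->
  (forall a, (a < d)%nat -> a <> z -> v' a = v a) ->
  v w < v' z ->
  (forall b, (b < d)%nat -> b <> z -> (rk w < rk b)%nat -> v' z < v b) ->
  forall a, (a < d)%nat -> rk' a = reinsert rk z w a.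
Proof.
intros H H' Hz Hw Ez Hwz Hv Hv' Hsame Hz1 Hz2. apply ranking_unique; auto.
{ apply reinsert_ranking; auto. }
intros a b Ha Hb. unfold reinsert. intros E. apply Hv'; auto.
destruct (Nat.eqb_spec a z) as [->|Hna]; destruct (Nat.eqb_spec b z) as [->|Hnb]; [lia| | |].
- rewrite (Hsame b) by auto. apply Hz2; auto. nat_cases; lia.
- rewrite (Hsame a) by auto. destruct (Nat.leb_spec (rk a) (rk w)); [|lia].
  destruct (Nat.eq_dec a w) as [->|Haw]; auto.
  apply Rlt_trans with (v w); auto. apply Hv; auto.
  assert (rk a <> rk w) by (intros E'; apply Haw; apply (proj2 H); auto). lia.
- rewrite !Hsame by auto. apply Hv; auto.
  nat_cases; lia.
Qed.

(* The bottom row is C B A when the top row is A B C, with A of length [p] and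
   A B of length [q]. *)
Definition blocks (d : nat) (r0 r1 : nat -> nat) (p q : nat) : Prop :=
  (1 <= p <= q)%nat /\ (q < d)%nat /\
  forall a, (a < d)%nat -> r1 a =
    if Nat.leb (r0 a) p then (r0 a + (d - p))%nat
    else if Nat.leb (r0 a) q then (r0 a - p + (d - q))%nat
    else (r0 a - q)%nat.

Lemma blocks_top d r0 r1 p q a : ranking d r0 -> blocks d r0 r1 p q -> (a < d)%nat ->
  r1 a = d -> r0 a = p.
Proof.
intros [H _] [B1 [B2 B3]] Ha E. specialize (B3 a Ha). specialize (H a Ha).
nat_cases; lia.
Qed.

Lemma blocks_bottom d r0 r1 p q a : ranking d r0 -> blocks d r0 r1 p q -> (a < d)%nat ->
  r1 a = 1%nat -> (r0 a = q + 1)%nat.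
Proof.
intros [H _] [B1 [B2 B3]] Ha E. specialize (B3 a Ha). specialize (H a Ha).
nat_cases; lia.
Qed.

(** The loser is the last letter of A; in the bottom row it lands right behind C, where it opens B.
    So A cedes a letter to B. If A consisted of this letter only, the blocks B and C remain and B is
    renamed A, so [p] becomes [q]. *)
Lemma blocks_type0 d r0 r1 p q a0 a1 r1' : ranking d r0 -> ranking d r1 ->
  blocks d r0 r1 p q -> (a0 < d)%nat -> (a1 < d)%nat -> r0 a0 = d -> r1 a1 = d ->
  (forall a, (a < d)%nat -> r1' a = reinsert r1 a1 a0 a) ->
  blocks d r0 r1' (if Nat.eqb p 1 then q else (p - 1)%nat) q.
Proof.
intros H0 H1 B Ha0 Ha1 E0 E1 HE.
pose proof (blocks_top d r0 r1 p q a1 H0 B Ha1 E1) as P1.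
destruct B as [B1 [B2 B3]].
assert (P0 : r1 a0 = (d - q)%nat).
{ rewrite B3, E0 by auto. destruct (Nat.leb_spec d p); [lia|]. nat_cases; lia. }
split; [destruct (Nat.eqb_spec p 1); lia|split; auto].
intros a Ha. rewrite HE by auto. unfold reinsert.
pose proof (B3 a Ha) as Ea. pose proof (proj1 H0 a Ha) as Ra.
destruct (Nat.eqb_spec a a1) as [->|Hn].
- rewrite P1, P0. destruct (Nat.eqb_spec p 1) as [Hp|Hp].
  + nat_cases; lia.
  + destruct (Nat.leb_spec p (p - 1)); [lia|]. nat_cases; lia.
- assert (r0 a <> p) by (intros e; apply Hn; apply (proj2 H0); auto; lia).
  rewrite P0. destruct (Nat.eqb_spec p 1) as [Hp|Hp].
  + destruct (Nat.leb_spec (r0 a) p); [lia|].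
    nat_cases; lia.
  + nat_cases; lia.
Qed.

(** The loser is the last letter of C; in the top row it lands right behind A, where it opens B. If
    it was all of C, then B is renamed C, so [q] becomes [p]. *)
Lemma blocks_type1 d r0 r1 p q a0 a1 r0' : ranking d r0 -> ranking d r1 ->
  blocks d r0 r1 p q -> (a0 < d)%nat -> (a1 < d)%nat -> r0 a0 = d -> r1 a1 = d ->
  (forall a, (a < d)%nat -> r0' a = reinsert r0 a0 a1 a) ->
  blocks d r0' r1 p (if Nat.eqb q (d - 1) then p else (q + 1)%nat).
Proof.
intros H0 H1 B Ha0 Ha1 E0 E1 HE.
pose proof (blocks_top d r0 r1 p q a1 H0 B Ha1 E1) as P1.
destruct B as [B1 [B2 B3]].
split; [destruct (Nat.eqb_spec q (d - 1)); lia|].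
split; [destruct (Nat.eqb_spec q (d - 1)); lia|].
intros a Ha. rewrite HE by auto. unfold reinsert. rewrite P1.
pose proof (B3 a Ha) as Ea. pose proof (proj1 H0 a Ha) as Ra.
destruct (Nat.eqb_spec a a0) as [->|Hn].
- rewrite E0 in *. destruct (Nat.leb_spec d p); [lia|]. destruct (Nat.leb_spec d q); [lia|].
  destruct (Nat.leb_spec (p + 1) p); [lia|].
  destruct (Nat.eqb_spec q (d - 1)).
  + nat_cases; lia.
  + nat_cases; lia.
- assert (r0 a <> d) by (intros e; apply Hn; apply (proj2 H0); auto; lia).
  destruct (Nat.leb_spec (r0 a) p).
  + nat_cases; lia.
  + destruct (Nat.leb_spec (r0 a + 1) p); [lia|].
    destruct (Nat.eqb_spec q (d - 1)); destruct (Nat.leb_spec (r0 a) q).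
    * nat_cases; lia.
    * lia.
    * nat_cases; lia.
    * nat_cases; lia.
Qed.

(* At most two positions [i] where consecutive top letters are not consecutive
   at the bottom. *)
Lemma blocks_exist d r0 r1 b1 b2 : (2 <= d)%nat -> ranking d r0 -> ranking d r1 ->
  (forall j, (1 <= j < d)%nat ->
     ~ (forall i, (exists a, (a < d)%nat /\ (r0 a <= j)%nat /\ r1 a = i) <-> (1 <= i <= j)%nat)) ->
  (forall a b, (a < d)%nat -> (b < d)%nat -> r0 b = (r0 a + 1)%nat ->
     r0 a <> b1 -> r0 a <> b2 -> r1 b = (r1 a + 1)%nat) ->
  exists p q, blocks d r0 r1 p q.
Proof.
intros Hd H0 H1 Hirr Hbr.
(* If no letter of top rank at most [j] had a larger bottom rank, these letters would be permuted,
   since an injection of [j] elements into themselves is onto, and irreducibility would fail. *)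
assert (Hirr' : forall j, (1 <= j < d)%nat -> exists a, (a < d)%nat /\ (r0 a <= j)%nat /\ (j < r1 a)%nat).
{ intros j Hj. destruct (existsb (fun a => andb (Nat.leb (r0 a) j) (Nat.ltb j (r1 a))) (seq 0 d)) eqn:E.
  - apply existsb_exists in E. destruct E as [a [Ia E]]. apply in_seq in Ia.
    apply Bool.andb_true_iff in E. destruct E as [E1 E2].
    apply Nat.leb_le in E1. apply Nat.ltb_lt in E2. exists a. lia.
  - exfalso. apply (Hirr j Hj). clear Hirr.
    assert (A : forall a, (a < d)%nat -> (r0 a <= j)%nat -> (r1 a <= j)%nat).
    { intros a Ha Hr. destruct (Nat.le_gt_cases (r1 a) j); auto. exfalso.
      assert (X : existsb (fun a => andb (Nat.leb (r0 a) j) (Nat.ltb j (r1 a))) (seq 0 d) = true).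
      { apply existsb_exists. exists a. split; [apply in_seq; lia|].
        apply Bool.andb_true_iff. split; [apply Nat.leb_le|apply Nat.ltb_lt]; lia. }
      congruence. }
    intros i. split.
    + intros [a [Ha [Hr <-]]]. specialize (A a Ha Hr). pose proof (proj1 H1 a Ha). lia.
    + intros Hi.
      assert (Lt : forall x, (x < j)%nat -> exists a, (a < d)%nat /\ r0 a = (x + 1)%nat).
      { intros x Hx. apply ranking_surj; auto. lia. }
      set (s := fun x => (r1 (letter_at d r0 (x + 1)) - 1)%nat).
      assert (Hs : forall x a, (a < d)%nat -> r0 a = (x + 1)%nat -> s x = (r1 a - 1)%nat).
      { intros x a Ha Ea. unfold s. rewrite (letter_at_unique d r0 (x + 1) a); auto. }
      destruct (injective_surjective s j) with (j := (i - 1)%nat) as [x [Hx Ex]]; [| |lia|].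
      * intros x Hx. destruct (Lt x Hx) as [a [Ha Ea]]. rewrite (Hs x a Ha Ea).
        specialize (A a Ha ltac:(lia)). pose proof (proj1 H1 a Ha). lia.
      * intros x y Hx Hy. destruct (Lt x Hx) as [a [Ha Ea]]. destruct (Lt y Hy) as [b [Hb Eb]].
        rewrite (Hs x a Ha Ea), (Hs y b Hb Eb). intros E'.
        pose proof (proj1 H1 a Ha). pose proof (proj1 H1 b Hb).
        assert (a = b) by (apply (proj2 H1); auto; lia). subst b. lia.
      * destruct (Lt x Hx) as [a [Ha Ea]]. rewrite (Hs x a Ha Ea) in Ex.
        pose proof (proj1 H1 a Ha). exists a. repeat split; auto; lia. }
assert (Hlin : forall lo c, (c < d)%nat -> r0 c = lo ->
  forall hi, (forall j, (lo <= j < hi)%nat -> j <> b1 /\ j <> b2) ->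
  forall a, (a < d)%nat -> (lo <= r0 a <= hi)%nat -> r1 a = (r1 c + (r0 a - lo))%nat).
{ intros lo c Hc Ec hi Hne.
  assert (A : forall j a, (a < d)%nat -> r0 a = (lo + j)%nat -> (r0 a <= hi)%nat -> r1 a = (r1 c + j)%nat).
  { induction j as [|j IH]; intros a Ha Ea Hh.
    - assert (a = c) by (apply (proj2 H0); auto; lia). subst a. lia.
    - destruct (ranking_surj d r0 (lo + j) H0) as [b [Hb Eb]].
      { pose proof (proj1 H0 c Hc). pose proof (proj1 H0 a Ha). lia. }
      specialize (IH b Hb Eb ltac:(lia)). destruct (Hne (lo + j)%nat ltac:(lia)).
      rewrite (Hbr b a) by (auto; lia). lia. }
  intros a Ha Hr. apply A; auto; lia. }
assert (Hclash : forall a b, (a < d)%nat -> (b < d)%nat -> r1 a = r1 b -> r0 a = r0 b).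
{ intros a b Ha Hb E. f_equal. apply (proj2 H1); auto. }
(* Pieces translated onto overlapping ranges would share a bottom rank; [y] is the smallest common
   one. *)
assert (Hdisj : forall l1 h1 v1 l2 h2 v2, (1 <= l1 <= h1)%nat -> (h1 < l2)%nat -> (l2 <= h2 <= d)%nat ->
  (forall a, (a < d)%nat -> (l1 <= r0 a <= h1)%nat -> (r1 a + l1 = v1 + r0 a)%nat) ->
  (forall a, (a < d)%nat -> (l2 <= r0 a <= h2)%nat -> (r1 a + l2 = v2 + r0 a)%nat) ->
  (v1 + h1 < v2 + l1 \/ v2 + h2 < v1 + l2)%nat).
{ intros l1 h1 v1 l2 h2 v2 K1 K2 K3 F1 F2.
  destruct (Nat.lt_ge_cases (v1 + h1) (v2 + l1)) as [|G1]; auto.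
  destruct (Nat.lt_ge_cases (v2 + h2) (v1 + l2)) as [|G2]; auto. exfalso.
  set (y := Nat.max v1 v2).
  destruct (ranking_surj d r0 (l1 + (y - v1)) H0 ltac:(lia)) as [a [Ha Ea]].
  destruct (ranking_surj d r0 (l2 + (y - v2)) H0 ltac:(lia)) as [b [Hb Eb]].
  specialize (Hclash a b Ha Hb). specialize (F1 a Ha ltac:(lia)). specialize (F2 b Hb ltac:(lia)). lia. }
assert (Hend : forall c, (c < d)%nat -> (1 <= r1 c <= d)%nat) by (apply H1).
assert (WLOG : forall b1 b2, (b1 <= b2)%nat ->
  (forall lo c, (c < d)%nat -> r0 c = lo ->
  forall hi, (forall j, (lo <= j < hi)%nat -> j <> b1 /\ j <> b2) ->
  forall a, (a < d)%nat -> (lo <= r0 a <= hi)%nat -> r1 a = (r1 c + (r0 a - lo))%nat) ->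
  exists p q, blocks d r0 r1 p q).
{ clear b1 b2 Hbr Hlin. intros b1 b2 Hb12 Hlin.
  (* A break at position 0, or at [d] and beyond, separates no two letters; truncation leaves at
     most two genuine cuts. *)
  set (e1 := Nat.min b1 d). set (e2 := Nat.min b2 d).
  assert (Piece : forall lo hi, (1 <= lo <= hi)%nat -> (hi <= d)%nat ->
    (forall j, (lo <= j < hi)%nat -> j <> b1 /\ j <> b2) ->
    exists v, (1 <= v)%nat /\ (v + hi <= d + lo)%nat /\
      forall a, (a < d)%nat -> (lo <= r0 a <= hi)%nat -> (r1 a + lo = v + r0 a)%nat).
  { intros lo hi Hl Hh Hne. destruct (ranking_surj d r0 lo H0 ltac:(lia)) as [c [Hc Ec]].
    destruct (ranking_surj d r0 hi H0 ltac:(lia)) as [c' [Hc' Ec']].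
    exists (r1 c). pose proof (Hlin lo c Hc Ec hi Hne) as F.
    pose proof (Hend c Hc). pose proof (Hend c' Hc'). pose proof (F c' Hc' ltac:(lia)).
    split; [lia|split; [lia|]]. intros x Hx Hr. specialize (F x Hx Hr). lia. }
  assert (Two : forall e, (1 <= e < d)%nat ->
     (forall j, (1 <= j < e)%nat -> j <> b1 /\ j <> b2) ->
     (forall j, (e + 1 <= j < d)%nat -> j <> b1 /\ j <> b2) -> exists p q, blocks d r0 r1 p q).
  { intros e He N1 N2.
    destruct (Piece 1%nat e ltac:(lia) ltac:(lia) N1) as [v [V1 [V2 V3]]].
    destruct (Piece (e + 1)%nat d ltac:(lia) ltac:(lia) N2) as [w [W1 [W2 W3]]].
    pose proof (Hdisj 1%nat e v (e + 1)%nat d w ltac:(lia) ltac:(lia) ltac:(lia) V3 W3) as D.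
    destruct (Hirr' e He) as [a [Ha [Ra Rb]]].
    pose proof (V3 a Ha ltac:(pose proof (proj1 H0 a Ha); lia)).
    exists e, e. split; [lia|split; [lia|]]. intros c Hc. pose proof (proj1 H0 c Hc).
    destruct (Nat.leb_spec (r0 c) e).
    - pose proof (V3 c Hc ltac:(lia)). lia.
    - destruct (Nat.leb_spec (r0 c) e); [lia|]. pose proof (W3 c Hc ltac:(lia)). lia. }
  assert (One : (forall j, (1 <= j < d)%nat -> j <> b1 /\ j <> b2) -> exists p q, blocks d r0 r1 p q).
  { intros N1. apply (Two 1%nat); [lia|intros; lia|]. intros j Hj. apply N1. lia. }
  destruct (Nat.eq_dec e1 0) as [Z1|Z1]; [|destruct (Nat.eq_dec e1 d) as [Z1'|Z1']].
  - destruct (Nat.eq_dec e2 0) as [Z2|Z2]; [|destruct (Nat.eq_dec e2 d) as [Z2'|Z2']].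
    + apply One. intros; lia.
    + apply One. intros; lia.
    + apply (Two e2); intros; lia.
  - apply One. intros; lia.
  - destruct (Nat.eq_dec e2 d) as [Z2'|Z2'].
    + apply (Two e1); intros; lia.
    + destruct (Nat.eq_dec e1 e2) as [Z3|Z3]; [apply (Two e1); intros; lia|].
      assert (Q : (1 <= b1 < b2)%nat /\ (b2 < d)%nat) by lia.
      clear Z1 Z1' Z2' Z3 e1 e2 Two One.
      destruct (Piece 1%nat b1 ltac:(lia) ltac:(lia) ltac:(intros; lia)) as [v [V1 [V2 V3]]].
      destruct (Piece (b1 + 1)%nat b2 ltac:(lia) ltac:(lia) ltac:(intros; lia)) as [w [W1 [W2 W3]]].
      destruct (Piece (b2 + 1)%nat d ltac:(lia) ltac:(lia) ltac:(intros; lia)) as [u [U1 [U2 U3]]].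
      pose proof (Hdisj 1%nat b1 v (b1 + 1)%nat b2 w ltac:(lia) ltac:(lia) ltac:(lia) V3 W3) as D1.
      pose proof (Hdisj 1%nat b1 v (b2 + 1)%nat d u ltac:(lia) ltac:(lia) ltac:(lia) V3 U3) as D2.
      pose proof (Hdisj (b1 + 1)%nat b2 w (b2 + 1)%nat d u ltac:(lia) ltac:(lia) ltac:(lia) W3 U3) as D3.
      destruct (Hirr' b1 ltac:(lia)) as [a [Ha [Ra Rb]]].
      pose proof (V3 a Ha ltac:(pose proof (proj1 H0 a Ha); lia)) as Fa.
      destruct (Hirr' b2 ltac:(lia)) as [b [Hb [Rc Rd]]].
      assert (Fb : (r0 b <= b1 /\ r1 b + 1 = v + r0 b \/ b1 < r0 b /\ r1 b + (b1 + 1) = w + r0 b)%nat).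
      { pose proof (proj1 H0 b Hb). destruct (Nat.le_gt_cases (r0 b) b1); [left|right]; split; auto;
        [apply V3|apply W3]; auto; lia. }
      (* Irreducibility at [b1] and [b2] moves the first and the last of the three pieces, which
         leaves the bottom orders 321, 231 and 312. The last two exchange two blocks only, cut at
         [b1] and at [b2]. *)
      assert (Cases : (u = 1 /\ w + b2 = 1 + d /\ v + b1 = 1 + d \/
                      w = 1 /\ u + b1 = 1 + b2 /\ v + b1 = 1 + d \/
                      u = 1 /\ v + b2 = 1 + d /\ w + b2 = 1 + d + b1)%nat).
      { pose proof (proj1 H0 a Ha). pose proof (proj1 H0 b Hb).
        clear - Q V1 V2 W1 W2 U1 U2 D1 D2 D3 Fa Fb Ra Rb Rc Rd H H1.
        destruct D1 as [D1|D1], D2 as [D2|D2], D3 as [D3|D3];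
        try (left; repeat split; lia); try (right; left; repeat split; lia);
        try (right; right; repeat split; lia); exfalso; destruct Fb; lia. }
      destruct Cases as [[C1 [C2 C3]]|[[C1 [C2 C3]]|[C1 [C2 C3]]]].
      * exists b1, b2. split; [lia|split; [lia|]]. intros c Hc. pose proof (proj1 H0 c Hc).
        destruct (Nat.leb_spec (r0 c) b1); [pose proof (V3 c Hc ltac:(lia)); lia|].
        destruct (Nat.leb_spec (r0 c) b2); [pose proof (W3 c Hc ltac:(lia))|pose proof (U3 c Hc ltac:(lia))]; lia.
      * exists b1, b1. split; [lia|split; [lia|]]. intros c Hc. pose proof (proj1 H0 c Hc).
        destruct (Nat.leb_spec (r0 c) b1); [pose proof (V3 c Hc ltac:(lia)); lia|].
        destruct (Nat.leb_spec (r0 c) b1); [lia|].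
        destruct (Nat.le_gt_cases (r0 c) b2); [pose proof (W3 c Hc ltac:(lia))|pose proof (U3 c Hc ltac:(lia))]; lia.
      * exists b2, b2. split; [lia|split; [lia|]]. intros c Hc. pose proof (proj1 H0 c Hc).
        destruct (Nat.leb_spec (r0 c) b2).
        { destruct (Nat.le_gt_cases (r0 c) b1); [pose proof (V3 c Hc ltac:(lia))|pose proof (W3 c Hc ltac:(lia))]; lia. }
        { pose proof (U3 c Hc ltac:(lia)). lia. } }
destruct (Nat.le_gt_cases b1 b2) as [Hle|Hgt].
- apply (WLOG b1 b2); auto.
- apply (WLOG b2 b1); [lia|]. intros lo c Hc Ec hi Hne. apply Hlin; auto.
  intros j Hj. specialize (Hne j Hj). tauto.
Qed.

(** * Cocycles over the renormalization *)

Section Renormalization.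

(* [L n b] and [U n b] are the end points of the level-[n] interval of [b],
   [g0], [g1], [g2] the branches of [f] and their derivatives, and [ty n = true]
   means type 1. Step [n] replaces the loser's map by [G n (sn n) o G n (fs n)], where [fs n]
   is the last letter of the bottom row and [sn n] the last of the top row: for
   both types the loser's new interval lies in the interval of [fs n]. *)
Context (d : nat) (L U : nat -> nat -> R) (fs sn : nat -> nat) (ty : nat -> bool)
  (g0 g1 g2 : nat -> R -> R).

Definition ls (n : nat) : nat := if ty n then sn n else fs n.

Fixpoint G (n b : nat) (x : R) : R :=
  match n with
  | O => g0 b x
  | S m => if Nat.eqb b (ls m) then G m (sn m) (G m (fs m) x) else G m b x
  end.

Fixpoint G1 (n b : nat) (x : R) : R :=
  match n with
  | O => g1 b x
  | S m => if Nat.eqb b (ls m) then G1 m (sn m) (G m (fs m) x) * G1 m (fs m) x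
           else G1 m b x
  end.

(* Birkhoff sums of [F] (resp. of [E], weighted by the derivative) over the
   orbits of the level-[n0] map until they return to level [m]. *)
Fixpoint coc (n0 : nat) (F : nat -> R -> R) (m b : nat) (x : R) : R :=
  match m with
  | O => F b x
  | S j => if andb (Nat.leb n0 j) (Nat.eqb b (ls j))
           then coc n0 F j (fs j) x + coc n0 F j (sn j) (G j (fs j) x)
           else coc n0 F j b x
  end.

Fixpoint wcoc (n0 : nat) (E : nat -> R -> R) (m b : nat) (x : R) : R :=
  match m with
  | O => E b x
  | S j => if andb (Nat.leb n0 j) (Nat.eqb b (ls j))
           then wcoc n0 E j (fs j) x + wcoc n0 E j (sn j) (G j (fs j) x) * G1 j (fs j) x
           else wcoc n0 E j b x
  end.

Definition dom (n b : nat) (x : R) : Prop := L n b <= x <= U n b.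

Context (d2 : (2 <= d)%nat)
  (Hfs : forall n, (fs n < d)%nat) (Hsn : forall n, (sn n < d)%nat)
  (Hne : forall n, fs n <> sn n)
  (HLU : forall n b, (b < d)%nat -> L n b < U n b)
  (Hst0 : forall n, ty n = false ->
     (forall b, (b < d)%nat -> L (S n) b = L n b) /\
     (forall b, (b < d)%nat -> b <> sn n -> U (S n) b = U n b) /\
     U (S n) (sn n) = G n (fs n) (L n (fs n)))
  (Hst1 : forall n, ty n = true ->
     (forall b, (b < d)%nat -> b <> fs n -> b <> sn n ->
        L (S n) b = L n b /\ U (S n) b = U n b) /\
     L (S n) (fs n) = L n (fs n) /\ U (S n) (fs n) = L (S n) (sn n) /\
     U (S n) (sn n) = U n (fs n) /\ G n (fs n) (L (S n) (sn n)) = L n (sn n))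
  (HGU : forall n, G n (fs n) (U n (fs n)) = U n (sn n))
  (Hg0 : forall b x, (b < d)%nat -> dom 0 b x -> derivable_pt_lim (g0 b) x (g1 b x))
  (Hg1 : forall b x, (b < d)%nat -> dom 0 b x -> derivable_pt_lim (g1 b) x (g2 b x))
  (Hpos : forall b x, (b < d)%nat -> dom 0 b x -> 0 < g1 b x).

Lemma ls_lt n : (ls n < d)%nat.
Proof. unfold ls; destruct (ty n); auto. Qed.

Lemma G_stay n b x : b <> ls n -> G (S n) b x = G n b x.
Proof. intros H. simpl. destruct (Nat.eqb_spec b (ls n)); [lia|auto]. Qed.

Lemma G_lose n x : G (S n) (ls n) x = G n (sn n) (G n (fs n) x).
Proof. simpl. rewrite Nat.eqb_refl. auto. Qed.

Lemma G1_stay n b x : b <> ls n -> G1 (S n) b x = G1 n b x.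
Proof. intros H. simpl. destruct (Nat.eqb_spec b (ls n)); [lia|auto]. Qed.

Lemma G1_lose n x :
  G1 (S n) (ls n) x = G1 n (sn n) (G n (fs n) x) * G1 n (fs n) x.
Proof. simpl. rewrite Nat.eqb_refl. auto. Qed.

Lemma coc_base n0 F b x : coc n0 F n0 b x = F b x.
Proof.
enough (H : forall m, (m <= n0)%nat -> coc n0 F m b x = F b x) by auto.
induction m as [|m IH]; simpl; intros Hm; auto.
destruct (Nat.leb_spec n0 m); [lia|]. simpl. apply IH; lia.
Qed.

Lemma coc_stay n0 F m b x : b <> ls m -> coc n0 F (S m) b x = coc n0 F m b x.
Proof.
intros H. simpl. destruct (Nat.eqb_spec b (ls m)); [lia|]. rewrite Bool.andb_false_r. auto.
Qed.

Lemma coc_lose n0 F m x : (n0 <= m)%nat -> coc n0 F (S m) (ls m) x =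
  coc n0 F m (fs m) x + coc n0 F m (sn m) (G m (fs m) x).
Proof.
intros H. simpl. rewrite Nat.eqb_refl. destruct (Nat.leb_spec n0 m); [auto|lia].
Qed.

Lemma wcoc_base n0 E b x : wcoc n0 E n0 b x = E b x.
Proof.
enough (H : forall m, (m <= n0)%nat -> wcoc n0 E m b x = E b x) by auto.
induction m as [|m IH]; simpl; intros Hm; auto.
destruct (Nat.leb_spec n0 m); [lia|]. simpl. apply IH; lia.
Qed.

Lemma wcoc_stay n0 E m b x : b <> ls m -> wcoc n0 E (S m) b x = wcoc n0 E m b x.
Proof.
intros H. simpl. destruct (Nat.eqb_spec b (ls m)); [lia|]. rewrite Bool.andb_false_r. auto.
Qed.

Lemma wcoc_lose n0 E m x : (n0 <= m)%nat -> wcoc n0 E (S m) (ls m) x =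
  wcoc n0 E m (fs m) x + wcoc n0 E m (sn m) (G m (fs m) x) * G1 m (fs m) x.
Proof.
intros H. simpl. rewrite Nat.eqb_refl. destruct (Nat.leb_spec n0 m); [auto|lia].
Qed.

Definition regular (n : nat) : Prop := forall b x, (b < d)%nat -> dom n b x ->
  derivable_pt_lim (G n b) x (G1 n b x) /\ 0 < G1 n b x.

Lemma L_dom n b : (b < d)%nat -> dom n b (L n b).
Proof. intros Hb. specialize (HLU n b Hb). unfold dom; lra. Qed.

Lemma U_dom n b : (b < d)%nat -> dom n b (U n b).
Proof. intros Hb. specialize (HLU n b Hb). unfold dom; lra. Qed.

Lemma regular_increasing n b x y : regular n -> (b < d)%nat -> dom n b x -> dom n b y ->
  x < y -> G n b x < G n b y.
Proof.
intros HR Hb Hx Hy Hxy.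
destruct (mean_value (G n b) (G1 n b) x y) as [c [Hc E]]; [lra| |].
- intros c Hc. apply HR; auto. unfold dom in *; lra.
- assert (0 < G1 n b c) by (apply HR; auto; unfold dom in *; lra).
  assert (0 < G1 n b c * (y - x)) by (apply Rmult_lt_0_compat; lra). lra.
Qed.

Lemma regular_le n b x y : regular n -> (b < d)%nat -> dom n b x -> dom n b y ->
  x <= y -> G n b x <= G n b y.
Proof.
intros HR Hb Hx Hy [H|H]; [left; eapply regular_increasing; eauto|subst; lra].
Qed.

Lemma dom_stay_aux n b x : regular n -> (b < d)%nat -> b <> ls n ->
  dom (S n) b x -> dom n b x.
Proof.
intros HR Hb Hl. unfold dom, ls in *. destruct (ty n) eqn:E.
- destruct (Hst1 n E) as [H1 [H2 [H3 [H4 H5]]]].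
  destruct (Nat.eq_dec b (fs n)) as [->|Hf].
  + specialize (HLU (S n) (sn n) (Hsn n)). rewrite H2, H3. rewrite H4 in HLU. lra.
  + destruct (H1 b) as [-> ->]; auto.
- destruct (Hst0 n E) as [H1 [H2 H3]]. rewrite H1 by auto.
  destruct (Nat.eq_dec b (sn n)) as [->|Hf].
  + rewrite H3. assert (G n (fs n) (L n (fs n)) < G n (fs n) (U n (fs n))).
    { apply regular_increasing; auto using L_dom, U_dom. }
    rewrite HGU in H. lra.
  + rewrite H2; auto.
Qed.

Lemma dom_first n x : dom (S n) (ls n) x -> dom n (fs n) x.
Proof.
unfold dom, ls in *. destruct (ty n) eqn:E.
- destruct (Hst1 n E) as [H1 [H2 [H3 [H4 H5]]]].
  pose proof (HLU (S n) (fs n) (Hfs n)) as H. rewrite H2, H3 in H. rewrite H4. lra.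
- destruct (Hst0 n E) as [H1 [H2 H3]]. rewrite H1, H2; auto.
Qed.

Lemma dom_second_aux n x : regular n -> dom (S n) (ls n) x -> dom n (sn n) (G n (fs n) x).
Proof.
intros HR Hx. pose proof (dom_first n x Hx) as Hx'.
assert (G n (fs n) x <= U n (sn n)).
{ rewrite <- HGU. apply regular_le; auto using U_dom. apply Hx'. }
split; auto.
unfold ls in Hx. destruct (ty n) eqn:E.
- destruct (Hst1 n E) as [H1 [H2 [H3 [H4 H5]]]]. rewrite <- H5.
  apply regular_le; auto; [|apply Hx].
  apply dom_first. unfold ls; rewrite E. apply L_dom; auto.
- destruct (Hst0 n E) as [H1 [H2 H3]].
  apply Rle_trans with (G n (fs n) (L n (fs n))).
  + rewrite <- H3. rewrite <- H1; auto. left. apply HLU; auto.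
  + apply regular_le; auto using L_dom. apply Hx'.
Qed.

(** That level [n + 1] domains lie in level [n] domains rests on monotonicity at level [n], so
    nesting and regularity go through one induction; this is why the lemmas ending in [_aux] assume
    [regular n]. *)
Lemma all_regular n : regular n.
Proof.
induction n as [|n IH].
- intros b x Hb Hx. split; [apply Hg0|apply Hpos]; auto.
- intros b x Hb Hx. destruct (Nat.eq_dec b (ls n)) as [->|Hl].
  + rewrite G1_lose. destruct (IH (fs n) x (Hfs n) (dom_first n x Hx)) as [D P].
    destruct (IH (sn n) _ (Hsn n) (dom_second_aux n x IH Hx)) as [D' P'].
    split; [|apply Rmult_lt_0_compat; auto].
    apply derivable_lim_ext with (fun y => G n (sn n) (G n (fs n) y)).
    { intros y. rewrite G_lose; auto. }
    apply (derivable_pt_lim_comp (G n (fs n)) (G n (sn n))); auto.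
  + rewrite G1_stay by auto.
    destruct (IH b x Hb (dom_stay_aux n b x IH Hb Hl Hx)) as [D P]. split; auto.
    apply derivable_lim_ext with (G n b); auto. intros y; rewrite G_stay; auto.
Qed.

Lemma G_der n b x : (b < d)%nat -> dom n b x -> derivable_pt_lim (G n b) x (G1 n b x).
Proof. intros; apply all_regular; auto. Qed.

Lemma G1_pos n b x : (b < d)%nat -> dom n b x -> 0 < G1 n b x.
Proof. intros; apply all_regular; auto. Qed.

Lemma G_le n b x y : (b < d)%nat -> dom n b x -> dom n b y -> x <= y -> G n b x <= G n b y.
Proof. apply regular_le, all_regular. Qed.

Lemma dom_stay n b x : (b < d)%nat -> b <> ls n -> dom (S n) b x -> dom n b x.
Proof. apply dom_stay_aux, all_regular. Qed.

Lemma dom_second n x : dom (S n) (ls n) x -> dom n (sn n) (G n (fs n) x).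
Proof. apply dom_second_aux, all_regular. Qed.

Lemma dom_between n b x y z : dom n b x -> dom n b z -> x <= y <= z -> dom n b y.
Proof. unfold dom; lra. Qed.

Lemma level_ind (n0 : nat) (P : nat -> nat -> R -> Prop) :
  (forall b x, (b < d)%nat -> dom n0 b x -> P n0 b x) ->
  (forall m b x, (n0 <= m)%nat -> (b < d)%nat -> b <> ls m -> dom (S m) b x ->
     P m b x -> P (S m) b x) ->
  (forall m x, (n0 <= m)%nat -> dom (S m) (ls m) x -> dom m (fs m) x ->
     dom m (sn m) (G m (fs m) x) ->
     P m (fs m) x -> P m (sn m) (G m (fs m) x) -> P (S m) (ls m) x) ->
  forall m b x, (n0 <= m)%nat -> (b < d)%nat -> dom m b x -> P m b x.
Proof.
intros H0 Hs Hl m b x Hm. revert b x. induction Hm as [|m Hm IH]; auto.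
intros b x Hb Hx. destruct (Nat.eq_dec b (ls m)) as [->|Hn].
- pose proof (dom_first m x Hx). pose proof (dom_second m x Hx). auto.
- pose proof (dom_stay m b x Hb Hn Hx). auto.
Qed.

(** The orbits of the level-[m] intervals cut the level-[n0] intervals into consecutive pieces, so
    the increments telescope. In one step only [fs m] and [sn m] change, and the new cut point
    counts once as a right end and once as a left end. This is used for [T], for the log-slope and
    for the visits to a single letter. *)
Lemma coc_conserved n0 F m : (n0 <= m)%nat ->
  rsum (fun b => coc n0 F m b (U m b) - coc n0 F m b (L m b)) d =
  rsum (fun b => F b (U n0 b) - F b (L n0 b)) d.
Proof.
induction 1 as [|m Hm IH].
- apply rsum_ext. intros b Hb. rewrite !coc_base; auto.
- rewrite <- IH. apply rsum_two_changed with (fs m) (sn m); auto.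
  + intros b Hb Hf Hs. assert (b <> ls m) by (unfold ls; destruct (ty m); auto).
    rewrite !coc_stay by auto. destruct (ty m) eqn:E.
    * destruct (Hst1 m E) as [H1 _]. destruct (H1 b) as [-> ->]; auto.
    * destruct (Hst0 m E) as [H1 [H2 _]]. rewrite H1, H2; auto.
  + specialize (Hne m). destruct (ty m) eqn:E.
    * destruct (Hst1 m E) as [H1 [H2 [H3 [H4 H5]]]].
      assert (El : ls m = sn m) by (unfold ls; rewrite E; auto).
      rewrite !(coc_stay _ _ _ (fs m)) by (rewrite El; auto).
      pose proof (fun x => coc_lose n0 F m x Hm) as Hl. rewrite El in Hl.
      rewrite !Hl, H2, H3, H4, H5, HGU. ring.
    * destruct (Hst0 m E) as [H1 [H2 H3]].
      assert (El : ls m = fs m) by (unfold ls; rewrite E; auto).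
      rewrite !(coc_stay _ _ _ (sn m)) by (rewrite El; auto).
      pose proof (fun x => coc_lose n0 F m x Hm) as Hl. rewrite El in Hl.
      rewrite !Hl, H3, H2, !H1, HGU by auto. ring.
Qed.

Lemma wcoc_linear n0 E E' c c' m b x :
  wcoc n0 (fun b x => c * E b x + c' * E' b x) m b x =
  c * wcoc n0 E m b x + c' * wcoc n0 E' m b x.
Proof.
revert b x. induction m as [|m IH]; intros b x; simpl; auto.
destruct (andb _ _); rewrite !IH; ring.
Qed.

Lemma wcoc_le n0 E E' m b x : (n0 <= m)%nat -> (b < d)%nat -> dom m b x ->
  (forall b x, (b < d)%nat -> dom n0 b x -> E b x <= E' b x) ->
  wcoc n0 E m b x <= wcoc n0 E' m b x.
Proof.
intros Hm Hb Hx HE. revert m b x Hm Hb Hx.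
apply (level_ind n0 (fun m b x => wcoc n0 E m b x <= wcoc n0 E' m b x)).
- intros. rewrite !wcoc_base; auto.
- intros. rewrite !wcoc_stay; auto.
- intros. rewrite !wcoc_lose by auto.
  apply Rplus_le_compat; auto. apply Rmult_le_compat_r; auto.
  left; apply G1_pos; auto.
Qed.

(** An orbit counted from level [n0] is grouped by its visits to level [n]. In this way an estimate
    at level [n] is averaged up to level [m]. *)
Lemma wcoc_split n n0 E m b x : (n0 <= n)%nat -> (n <= m)%nat ->
  wcoc n (wcoc n0 E n) m b x = wcoc n0 E m b x.
Proof.
intros H0 H. revert b x. induction H as [|m H IH]; intros b x.
- apply wcoc_base.
- destruct (Nat.eq_dec b (ls m)) as [->|Hn].
  + rewrite !wcoc_lose, !IH by lia. auto.
  + rewrite !wcoc_stay by auto. auto.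
Qed.

(** [T] adds up the positions of the orbit, so its increment over an interval is the total length of
    the orbit pieces, and its derivative is [W]. *)
Definition T (n b : nat) (x : R) : R := coc 0 (fun _ x => x) n b x.
Definition W (n b : nat) (x : R) : R := wcoc 0 (fun _ _ => 1) n b x.
Definition nonlin (n b : nat) (x : R) : R := wcoc 0 (fun b x => g2 b x / g1 b x) n b x.
Definition psi (n b : nat) (x : R) : R := nonlin n b x / W n b x.
Definition lnG1 (n b : nat) (x : R) : R := ln (G1 n b x).

Lemma coc_derivable n0 F E m b x : (n0 <= m)%nat -> (b < d)%nat -> dom m b x ->
  (forall b x, (b < d)%nat -> dom n0 b x -> derivable_pt_lim (F b) x (E b x)) ->
  derivable_pt_lim (coc n0 F m b) x (wcoc n0 E m b x).
Proof.
intros Hm Hb Hx HE. revert m b x Hm Hb Hx.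
apply (level_ind n0 (fun m b x => derivable_pt_lim (coc n0 F m b) x (wcoc n0 E m b x))).
- intros. rewrite wcoc_base.
  apply derivable_lim_ext with (F b); auto. intros; rewrite coc_base; auto.
- intros. rewrite wcoc_stay by auto.
  apply derivable_lim_ext with (coc n0 F m b); auto. intros; rewrite coc_stay; auto.
- intros. rewrite wcoc_lose by auto.
  apply derivable_lim_ext with
    (fun y => coc n0 F m (fs m) y + coc n0 F m (sn m) (G m (fs m) y)).
  { intros; rewrite coc_lose; auto. }
  apply (derivable_pt_lim_plus (coc n0 F m (fs m))); auto.
  apply (derivable_pt_lim_comp (G m (fs m)) (coc n0 F m (sn m))); auto.
  apply G_der; auto.
Qed.

Lemma lnG1_coc n b x : (b < d)%nat -> dom n b x ->
  lnG1 n b x = coc 0 (fun b x => ln (g1 b x)) n b x.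
Proof.
intros Hb Hx. assert (H : (0 <= n)%nat) by lia. revert n b x H Hb Hx.
apply (level_ind 0 (fun n b x => lnG1 n b x = coc 0 (fun b x => ln (g1 b x)) n b x)).
- reflexivity.
- intros. unfold lnG1 in *. rewrite G1_stay, coc_stay; auto.
- intros m x _ Hx H1 H2 E1 E2. unfold lnG1 in *. rewrite G1_lose, coc_lose, ln_mult by (auto using G1_pos; lia).
  rewrite E1, E2. ring.
Qed.

Lemma lnG1_lose n x : dom (S n) (ls n) x ->
  lnG1 (S n) (ls n) x = lnG1 n (fs n) x + lnG1 n (sn n) (G n (fs n) x).
Proof.
intros Hx. pose proof (dom_first n x Hx). pose proof (dom_second n x Hx).
unfold lnG1. rewrite G1_lose, ln_mult by auto using G1_pos. ring.
Qed.

Lemma lnG1_stay n b x : b <> ls n -> lnG1 (S n) b x = lnG1 n b x.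
Proof. intros; unfold lnG1; rewrite G1_stay; auto. Qed.

Lemma G1_der n b x : (b < d)%nat -> dom n b x ->
  derivable_pt_lim (G1 n b) x (nonlin n b x * G1 n b x).
Proof.
intros Hb Hx. assert (H : (0 <= n)%nat) by lia. revert n b x H Hb Hx. unfold nonlin.
apply (level_ind 0 (fun n b x => derivable_pt_lim (G1 n b) x
   (wcoc 0 (fun b x => g2 b x / g1 b x) n b x * G1 n b x))).
- intros b x Hb Hx. simpl. replace (g2 b x / g1 b x * g1 b x) with (g2 b x).
  + apply Hg1; auto.
  + field. apply Rgt_not_eq, Hpos; auto.
- intros. rewrite wcoc_stay, G1_stay by auto.
  apply derivable_lim_ext with (G1 m b); auto. intros; rewrite G1_stay; auto.
- intros m x _ Hx H1 H2 E1 E2. rewrite wcoc_lose, G1_lose by lia.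
  apply derivable_lim_ext with (fun y => G1 m (sn m) (G m (fs m) y) * G1 m (fs m) y).
  { intros; rewrite G1_lose; auto. }
  match goal with |- derivable_pt_lim _ _ ?l =>
    replace l with ((wcoc 0 (fun b x => g2 b x / g1 b x) m (sn m) (G m (fs m) x)
        * G1 m (sn m) (G m (fs m) x) * G1 m (fs m) x) * G1 m (fs m) x +
      G1 m (sn m) (G m (fs m) x) *
       (wcoc 0 (fun b x => g2 b x / g1 b x) m (fs m) x * G1 m (fs m) x)) by ring end.
  apply (derivable_pt_lim_mult (fun y => G1 m (sn m) (G m (fs m) y)) (G1 m (fs m))); auto.
  apply (derivable_pt_lim_comp (G m (fs m)) (G1 m (sn m))); auto using G_der.
Qed.

Lemma T_der n b x : (b < d)%nat -> dom n b x -> derivable_pt_lim (T n b) x (W n b x).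
Proof.
intros. apply coc_derivable; auto; [lia|]. intros. apply derivable_pt_lim_id.
Qed.

Lemma lnG1_der n b x : (b < d)%nat -> dom n b x -> derivable_pt_lim (lnG1 n b) x (nonlin n b x).
Proof.
intros Hb Hx. pose proof (G1_pos n b x Hb Hx) as P.
replace (nonlin n b x) with (/ G1 n b x * (nonlin n b x * G1 n b x)) by (field; lra).
apply (derivable_pt_lim_comp (G1 n b) ln); [apply G1_der|apply derivable_pt_lim_ln]; auto.
Qed.

Lemma W_ge_1 n b x : (b < d)%nat -> dom n b x -> 1 <= W n b x.
Proof.
intros Hb Hx. assert (H : (0 <= n)%nat) by lia. revert n b x H Hb Hx. unfold W.
apply (level_ind 0 (fun n b x => 1 <= wcoc 0 (fun _ _ => 1) n b x)).
- intros; rewrite wcoc_base; lra.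
- intros m b x _ Hb Hn Hx H. rewrite wcoc_stay; auto.
- intros m x _ Hx H1 H2 E1 E2. rewrite wcoc_lose by lia.
  pose proof (G1_pos m _ _ (Hfs m) H1).
  assert (0 <= wcoc 0 (fun _ _ => 1) m (sn m) (G m (fs m) x) * G1 m (fs m) x)
    by (apply Rmult_le_pos; lra). lra.
Qed.

Lemma T_lt n b x y : (b < d)%nat -> dom n b x -> dom n b y -> x < y -> T n b x < T n b y.
Proof.
intros Hb Hx Hy Hxy. destruct (mean_value (T n b) (W n b) x y) as [c [Hc E]]; [lra| |].
- intros c Hc. apply T_der; auto. exact (dom_between n b x c y Hx Hy Hc).
- assert (1 <= W n b c) by (apply W_ge_1; auto; exact (dom_between n b x c y Hx Hy Hc)).
  assert (0 < W n b c * (y - x)) by (apply Rmult_lt_0_compat; lra). lra.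
Qed.

Lemma T_le n b x y : (b < d)%nat -> dom n b x -> dom n b y -> x <= y -> T n b x <= T n b y.
Proof. intros Hb Hx Hy [H|H]; [left; apply T_lt; auto|subst; lra]. Qed.

Definition Td (n b : nat) (x y : R) : R := Rabs (T n b x - T n b y).

Lemma Td_nonneg n b x y : 0 <= Td n b x y.
Proof. apply Rabs_pos. Qed.

Lemma Td_sym n b x y : Td n b x y = Td n b y x.
Proof. apply Rabs_minus_sym. Qed.

Lemma Td_lose n x y : dom (S n) (ls n) x -> dom (S n) (ls n) y ->
  Td (S n) (ls n) x y = Td n (fs n) x y + Td n (sn n) (G n (fs n) x) (G n (fs n) y).
Proof.
assert (A : forall x y, dom (S n) (ls n) x -> dom (S n) (ls n) y -> x <= y ->
  Td (S n) (ls n) x y = Td n (fs n) x y + Td n (sn n) (G n (fs n) x) (G n (fs n) y)).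
{ clear x y. intros x y Hx Hy Hxy.
  pose proof (dom_first n x Hx). pose proof (dom_second n x Hx).
  pose proof (dom_first n y Hy). pose proof (dom_second n y Hy).
  unfold Td. unfold T at 1 2. rewrite !coc_lose by lia. fold (T n (fs n) x) (T n (fs n) y).
  fold (T n (sn n) (G n (fs n) x)) (T n (sn n) (G n (fs n) y)).
  assert (T n (fs n) x <= T n (fs n) y) by (apply T_le; auto).
  assert (T n (sn n) (G n (fs n) x) <= T n (sn n) (G n (fs n) y))
    by (apply T_le; auto; apply G_le; auto).
  rewrite !Rabs_left1 by lra. ring. }
intros Hx Hy. destruct (Rle_dec x y) as [H|H]; auto.
rewrite (Td_sym (S n)), (Td_sym n (fs n)), (Td_sym n (sn n)). apply A; auto; lra.
Qed.

Lemma Td_stay n b x y : b <> ls n -> Td (S n) b x y = Td n b x y.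
Proof. intros; unfold Td, T; rewrite !coc_stay; auto. Qed.

(** * Distortion bounds *)

Context (M : R) (HM1 : 1 <= M)
  (HM : forall b x, (b < d)%nat -> dom 0 b x -> Rabs (g2 b x / g1 b x) <= M).

Lemma nonlin_bound n b x : (b < d)%nat -> dom n b x -> Rabs (nonlin n b x) <= M * W n b x.
Proof.
intros Hb Hx. assert (H : (0 <= n)%nat) by lia.
assert (E : forall c, wcoc 0 (fun b x => c * 1 + 0 * 0) n b x = c * W n b x).
{ intros c. rewrite (wcoc_linear 0 (fun _ _ => 1) (fun _ _ => 0)). unfold W; ring. }
apply Rabs_le. split.
- replace (- (M * W n b x)) with (- M * W n b x) by ring. rewrite <- E.
  apply wcoc_le; auto. intros b' x' Hb' Hx'. specialize (HM b' x' Hb' Hx').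
  unabs HM. lra.
- rewrite <- E.
  apply wcoc_le; auto. intros b' x' Hb' Hx'. specialize (HM b' x' Hb' Hx').
  unabs HM. lra.
Qed.

(** Denjoy's argument: [nonlin] is at most [M * W] in absolute value and [W] is the derivative of
    [T], so [lnG1 - M * T] is nonincreasing and [lnG1 + M * T] nondecreasing. *)
Lemma lnG1_distortion n b x y : (b < d)%nat -> dom n b x -> dom n b y ->
  Rabs (lnG1 n b x - lnG1 n b y) <= M * Td n b x y.
Proof.
intros Hb.
assert (A : forall x y, dom n b x -> dom n b y -> x <= y ->
  Rabs (lnG1 n b x - lnG1 n b y) <= M * Td n b x y).
{ clear x y. intros x y Hx Hy Hxy. unfold Td.
  assert (Hc : forall c, x <= c <= y -> dom n b c) by (intros c Hc; exact (dom_between n b x c y Hx Hy Hc)).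
  rewrite (Rabs_left1 (T n b x - T n b y)) by (pose proof (T_le n b x y Hb Hx Hy Hxy); lra).
  destruct (mean_value (fun z => lnG1 n b z - M * T n b z)
     (fun z => nonlin n b z - M * W n b z) x y Hxy) as [c [Ic E]].
  { intros c Ic. apply (derivable_pt_lim_minus (lnG1 n b) (fun z => M * T n b z)).
    - apply lnG1_der; auto.
    - apply (derivable_pt_lim_scal (T n b)). apply T_der; auto. }
  destruct (mean_value (fun z => lnG1 n b z + M * T n b z)
     (fun z => nonlin n b z + M * W n b z) x y Hxy) as [c' [Ic' E']].
  { intros c' Ic'. apply (derivable_pt_lim_plus (lnG1 n b) (fun z => M * T n b z)).
    - apply lnG1_der; auto.
    - apply (derivable_pt_lim_scal (T n b)). apply T_der; auto. }
  pose proof (nonlin_bound n b c Hb (Hc c Ic)) as B. unabs B.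
  pose proof (nonlin_bound n b c' Hb (Hc c' Ic')) as B'. unabs B'.
  assert (0 <= (M * W n b c - nonlin n b c) * (y - x)) by (apply Rmult_le_pos; lra).
  assert (0 <= (nonlin n b c' + M * W n b c') * (y - x)) by (apply Rmult_le_pos; lra).
  apply Rabs_le. nra. }
intros Hx Hy. destruct (Rle_dec x y) as [H|H]; auto.
rewrite Rabs_minus_sym, Td_sym. apply A; auto; lra.
Qed.

Definition Ttot : R := rsum (fun b => U 0 b - L 0 b) d.

(** The increments of [T] over the intervals of all letters are nonnegative and add up to [Ttot] at
    every level. *)
Lemma Td_le n b x y : (b < d)%nat -> dom n b x -> dom n b y -> Td n b x y <= Ttot.
Proof.
intros Hb Hx Hy.
assert (T n b (U n b) - T n b (L n b) <= Ttot).
{ unfold Ttot. rewrite <- (coc_conserved 0 (fun _ x => x) n) by lia.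
  apply (rsum_term_le (fun b => T n b (U n b) - T n b (L n b))); auto.
  intros b' Hb'. pose proof (T_lt n b' _ _ Hb' (L_dom n b' Hb') (U_dom n b' Hb') (HLU n b' Hb')). lra. }
pose proof (T_le n b _ _ Hb (L_dom n b Hb) Hx (proj1 Hx)).
pose proof (T_le n b _ _ Hb (L_dom n b Hb) Hy (proj1 Hy)).
pose proof (T_le n b _ _ Hb Hx (U_dom n b Hb) (proj2 Hx)).
pose proof (T_le n b _ _ Hb Hy (U_dom n b Hb) (proj2 Hy)).
unfold Td. apply Rabs_le. lra.
Qed.

Definition V : R := M * Ttot.

Lemma Ttot_nonneg : 0 <= Ttot.
Proof.
apply Rle_trans with (Td 0 (fs 0) (L 0 (fs 0)) (L 0 (fs 0))); [apply Td_nonneg|].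
apply Td_le; auto using L_dom.
Qed.

Lemma V_nonneg : 0 <= V.
Proof. apply Rmult_le_pos; [lra|apply Ttot_nonneg]. Qed.

Lemma MTd_le_V n b x y : (b < d)%nat -> dom n b x -> dom n b y -> M * Td n b x y <= V.
Proof. intros. apply Rmult_le_compat_l; [lra|apply Td_le; auto]. Qed.

Lemma lnG1_osc n b x y : (b < d)%nat -> dom n b x -> dom n b y ->
  Rabs (lnG1 n b x - lnG1 n b y) <= V.
Proof.
intros. eapply Rle_trans; [apply lnG1_distortion|apply MTd_le_V]; auto.
Qed.

(* [br n m b a g g']: the map [g], with derivative [g'], is an iterate of the
   level-[n] map sending the level-[m] interval of [b] into the level-[n]
   interval of [a], with fewer iterations than the return time to level [m]. *)
Inductive br (n : nat) : nat -> nat -> nat -> (R -> R) -> (R -> R) -> Prop :=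
| br_id a : (a < d)%nat -> br n n a a (fun x => x) (fun _ => 1)
| br_keep m b a g g' : b <> ls m -> br n m b a g g' -> br n (S m) b a g g'
| br_first m a g g' : br n m (fs m) a g g' -> br n (S m) (ls m) a g g'
| br_second m a g g' : br n m (sn m) a g g' ->
    br n (S m) (ls m) a (fun x => g (G m (fs m) x))
      (fun x => g' (G m (fs m) x) * G1 m (fs m) x).

Lemma br_level {n m b a g g'} : br n m b a g g' -> (n <= m)%nat /\ (b < d)%nat /\ (a < d)%nat.
Proof. induction 1; intuition (auto using ls_lt; lia). Qed.

Lemma br_dom {n m b a g g' x} : br n m b a g g' -> dom m b x -> dom n a (g x).
Proof.
intros H. revert x. induction H as [a Ha|m b a g g' Hb H IH|m a g g' H IH|m a g g' H IH];
  intros x Hx; auto.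
- apply IH. apply dom_stay; auto. apply (br_level H).
- apply IH. apply dom_first; auto.
- apply IH. apply dom_second; auto.
Qed.

Lemma br_der {n m b a g g' x} : br n m b a g g' -> dom m b x ->
  derivable_pt_lim g x (g' x) /\ 0 < g' x.
Proof.
intros H. revert x. induction H as [a Ha|m b a g g' Hb H IH|m a g g' H IH|m a g g' H IH];
  intros x Hx.
- split; [apply derivable_pt_lim_id|lra].
- apply IH. apply dom_stay; auto. apply (br_level H).
- apply IH. apply dom_first; auto.
- destruct (IH _ (dom_second m x Hx)) as [D P]. pose proof (dom_first m x Hx) as H1. split.
  + apply (derivable_pt_lim_comp (G m (fs m)) g); auto using G_der.
  + apply Rmult_lt_0_compat; auto using G1_pos.
Qed.

Lemma br_le {n m b a g g' x y} : br n m b a g g' -> dom m b x -> dom m b y ->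
  x <= y -> g x <= g y.
Proof.
intros H Hx Hy Hxy. destruct (mean_value g g' x y Hxy) as [c [Hc E]].
- intros c Hc. apply (br_der H), (dom_between m b x c y Hx Hy Hc).
- assert (0 < g' c) by (apply (br_der H), (dom_between m b x c y Hx Hy Hc)).
  assert (0 <= g' c * (y - x)) by (apply Rmult_le_pos; lra). lra.
Qed.

Lemma br_ln_distortion {n m b a g g' x y} : br n m b a g g' -> dom m b x -> dom m b y ->
  ln (g' x) - ln (g' y) <= M * Td m b x y.
Proof.
intros H. revert x y.
induction H as [a Ha|m b a g g' Hb H IH|m a g g' H IH|m a g g' H IH]; intros x y Hx Hy.
- pose proof (Td_nonneg n a x y). assert (0 <= M * Td n a x y) by (apply Rmult_le_pos; lra). lra.
- rewrite Td_stay by auto. apply br_level in H. apply IH; apply dom_stay; tauto.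
- rewrite Td_lose by auto. pose proof (IH x y (dom_first m x Hx) (dom_first m y Hy)).
  assert (0 <= M * Td m (sn m) (G m (fs m) x) (G m (fs m) y))
    by (apply Rmult_le_pos; [lra|apply Td_nonneg]). lra.
- rewrite Td_lose by auto.
  pose proof (dom_first m x Hx) as Hx1. pose proof (dom_first m y Hy) as Hy1.
  pose proof (dom_second m x Hx) as Hx2. pose proof (dom_second m y Hy) as Hy2.
  pose proof (proj2 (br_der H Hx2)). pose proof (proj2 (br_der H Hy2)).
  rewrite !ln_mult by auto using G1_pos. specialize (IH _ _ Hx2 Hy2).
  pose proof (lnG1_distortion m (fs m) x y (Hfs m) Hx1 Hy1) as D.
  unabs D. unfold lnG1 in D. lra.
Qed.

Lemma br_Td {n m b a g g' x y} : br n m b a g g' -> dom m b x -> dom m b y ->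
  Td n a (g x) (g y) <= Td m b x y.
Proof.
intros H. revert x y.
induction H as [a Ha|m b a g g' Hb H IH|m a g g' H IH|m a g g' H IH]; intros x y Hx Hy.
- lra.
- rewrite (Td_stay m) by auto. apply br_level in H. apply IH; apply dom_stay; tauto.
- rewrite Td_lose by auto. pose proof (IH x y (dom_first m x Hx) (dom_first m y Hy)).
  pose proof (Td_nonneg m (sn m) (G m (fs m) x) (G m (fs m) y)). lra.
- rewrite Td_lose by auto. pose proof (IH _ _ (dom_second m x Hx) (dom_second m y Hy)).
  pose proof (Td_nonneg m (fs m) x y). lra.
Qed.

Lemma br_comp n l m c b a g g' h h' : br n l b a g g' -> br l m c b h h' ->
  exists f f', br n m c a f f' /\
    (forall x, f x = g (h x)) /\ (forall x, f' x = g' (h x) * h' x).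
Proof.
intros Hg H. induction H as [b Hb|m c b h h' Hc H IH|m b h h' H IH|m b h h' H IH];
  [|destruct (IH Hg) as [f [f' [B [E E']]]]..].
- exists g, g'. repeat split; auto. intros; ring.
- exists f, f'. repeat split; auto using br_keep.
- exists f, f'. repeat split; auto using br_first.
- exists (fun x => f (G m (fs m) x)), (fun x => f' (G m (fs m) x) * G1 m (fs m) x).
  repeat split; auto using br_second. intros x. rewrite E'. ring.
Qed.

Lemma br_decomp n l m c a f f' : br n m c a f f' -> (n <= l)%nat -> (l <= m)%nat ->
  exists b g g' h h', br n l b a g g' /\ br l m c b h h' /\
    (forall x, f x = g (h x)) /\ (forall x, f' x = g' (h x) * h' x).
Proof.
intros H Hn. induction H as [a Ha|m c a f f' Hc H IH|m a f f' H IH|m a f f' H IH]; intros Hl.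
- assert (l = n) by lia. subst l.
  exists a, (fun x => x), (fun _ => 1), (fun x => x), (fun _ => 1).
  repeat split; auto using br_id. intros; ring.
- destruct (Nat.eq_dec l (S m)) as [->|Hlm].
  + assert (B : br n (S m) c a f f') by (apply br_keep; auto).
    exists c, f, f', (fun x => x), (fun _ => 1).
    repeat split; auto; [|intros; ring]. apply br_id, (br_level B).
  + destruct IH as [b [g [g' [h [h' [B [B' [E E']]]]]]]]; [lia|].
    exists b, g, g', h, h'. auto using br_keep.
- destruct (Nat.eq_dec l (S m)) as [->|Hlm].
  + assert (B : br n (S m) (ls m) a f f') by (apply br_first; auto).
    exists (ls m), f, f', (fun x => x), (fun _ => 1).
    repeat split; auto; [|intros; ring]. apply br_id, (br_level B).
  + destruct IH as [b [g [g' [h [h' [B [B' [E E']]]]]]]]; [lia|].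
    exists b, g, g', h, h'. auto using br_first.
- destruct (Nat.eq_dec l (S m)) as [->|Hlm].
  + pose proof (br_second n m a f f' H) as B.
    eexists (ls m), _, _, (fun x => x), (fun _ => 1).
    split; [exact B|split; [apply br_id, (br_level B)|split; intros; cbv beta; ring]].
  + destruct IH as [b [g [g' [h [h' [B [B' [E E']]]]]]]]; [lia|].
    exists b, g, g', (fun x => h (G m (fs m) x)), (fun x => h' (G m (fs m) x) * G1 m (fs m) x).
    repeat split; auto using br_second. intros x. rewrite E'. ring.
Qed.

Lemma wcoc_nonneg n E m b x : (n <= m)%nat -> (b < d)%nat -> dom m b x ->
  (forall a u, (a < d)%nat -> dom n a u -> 0 <= E a u) -> 0 <= wcoc n E m b x.
Proof.
intros Hm Hb Hx HE.
replace 0 with (wcoc n (fun a u => 0 * E a u + 0 * E a u) m b x)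
  by (rewrite wcoc_linear; ring).
apply wcoc_le; auto. intros a u Ha Hu. specialize (HE a u Ha Hu). lra.
Qed.

Lemma br_wcoc n E m b a g g' x :
  (forall a u, (a < d)%nat -> dom n a u -> 0 <= E a u) ->
  br n m b a g g' -> dom m b x -> E a (g x) * g' x <= wcoc n E m b x.
Proof.
intros HE H. revert x.
induction H as [a Ha|m b a g g' Hb H IH|m a g g' H IH|m a g g' H IH]; intros x Hx;
  try (pose proof (br_level H) as [Hnm _];
       try (pose proof (dom_first m x Hx) as H1; pose proof (dom_second m x Hx) as H2;
            rewrite wcoc_lose by auto; pose proof (G1_pos m (fs m) x (Hfs m) H1))).
- rewrite wcoc_base; lra.
- rewrite wcoc_stay by auto. apply br_level in H. apply IH, dom_stay; tauto.
- specialize (IH x H1).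
  assert (0 <= wcoc n E m (sn m) (G m (fs m) x) * G1 m (fs m) x); [|lra].
  apply Rmult_le_pos; [apply wcoc_nonneg; auto|lra].
- specialize (IH _ H2). rewrite <- Rmult_assoc.
  assert (0 <= wcoc n E m (fs m) x) by (apply wcoc_nonneg; auto).
  assert (E a (g (G m (fs m) x)) * g' (G m (fs m) x) * G1 m (fs m) x <=
     wcoc n E m (sn m) (G m (fs m) x) * G1 m (fs m) x)
    by (apply Rmult_le_compat_r; lra). lra.
Qed.

Lemma coc_le n F m b x y : (n <= m)%nat -> (b < d)%nat -> dom m b x -> dom m b y -> x <= y ->
  (forall a u v, (a < d)%nat -> dom n a u -> dom n a v -> u <= v -> F a u <= F a v) ->
  coc n F m b x <= coc n F m b y.
Proof.
intros Hm Hb Hx Hy Hxy HF. revert b x y Hb Hx Hy Hxy. induction Hm as [|m Hm IH]; intros.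
- rewrite !coc_base; auto.
- destruct (Nat.eq_dec b (ls m)) as [->|Hn].
  + rewrite !coc_lose by auto. apply dom_first in Hx as Hx1. apply dom_first in Hy as Hy1.
    apply Rplus_le_compat; apply IH; auto using dom_second. apply G_le; auto.
  + rewrite !coc_stay by auto. apply IH; auto using dom_stay.
Qed.

Lemma br_coc n F m b a g g' x y :
  (forall a u v, (a < d)%nat -> dom n a u -> dom n a v -> u <= v -> F a u <= F a v) ->
  br n m b a g g' -> dom m b x -> dom m b y -> x <= y ->
  F a (g y) - F a (g x) <= coc n F m b y - coc n F m b x.
Proof.
intros HF H. revert x y.
induction H as [a Ha|m b a g g' Hb H IH|m a g g' H IH|m a g g' H IH]; intros x y Hx Hy Hxy;
  try (pose proof (br_level H) as [Hnm _];
       try (pose proof (dom_first m x Hx) as Hx1; pose proof (dom_second m x Hx) as Hx2;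
            pose proof (dom_first m y Hy) as Hy1; pose proof (dom_second m y Hy) as Hy2;
            rewrite !coc_lose by auto)).
- rewrite !coc_base; lra.
- rewrite !coc_stay by auto. apply br_level in H. apply IH; auto; apply dom_stay; tauto.
- specialize (IH x y Hx1 Hy1 Hxy).
  pose proof (coc_le n F m (sn m) _ _ Hnm (Hsn m) Hx2 Hy2 (G_le m _ x y (Hfs m) Hx1 Hy1 Hxy) HF).
  lra.
- specialize (IH _ _ Hx2 Hy2 (G_le m _ x y (Hfs m) Hx1 Hy1 Hxy)).
  pose proof (coc_le n F m (fs m) x y Hnm (Hfs m) Hx1 Hy1 Hxy HF). lra.
Qed.

(** The loser is [fs m] or [sn m], and its new orbit passes through the old intervals of both. *)
Lemma br_self n m b : (n <= m)%nat -> (b < d)%nat -> exists g g', br n m b b g g'.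
Proof.
intros Hm Hb. induction Hm as [|m Hm [g [g' B]]].
- exists (fun x => x), (fun _ => 1). apply br_id; auto.
- destruct (Nat.eq_dec b (ls m)) as [E|E]; [|exists g, g'; apply br_keep; auto].
  assert (C : b = fs m \/ b = sn m) by (rewrite E; unfold ls; destruct (ty m); auto).
  destruct C as [C|C]; rewrite C in B.
  + exists g, g'. rewrite E at 1. apply br_first. rewrite C. auto.
  + eexists _, _. rewrite E at 1. apply br_second. rewrite C. exact B.
Qed.

Definition ws (n : nat) : nat := if ty n then fs n else sn n.

(** In type 1 the loser's new interval lies inside that of the winner [fs n]; in type 0 the map
    [G n (fs n)] sends it into that of the winner [sn n]. *)
Lemma br_winner n : exists g g', br n (S n) (ls n) (ws n) g g'.
Proof.
unfold ws. destruct (ty n); eexists _, _; [apply br_first|apply br_second]; apply br_id; auto.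
Qed.

(* The factor [exp (M * Td)] absorbs the distortion of the weights. *)
Lemma wcoc_compare n E F K m b x y : (n <= m)%nat -> (b < d)%nat ->
  dom m b x -> dom m b y -> 0 <= K ->
  (forall a u, (a < d)%nat -> dom n a u -> 0 <= E a u) ->
  (forall a g g', br n m b a g g' ->
     F a (g y) <= K * exp (M * Td n a (g x) (g y)) * E a (g x)) ->
  wcoc n F m b y <= K * exp (M * Td m b x y) * wcoc n E m b x.
Proof.
intros Hm Hb Hx Hy HK HE. revert b x y Hb Hx Hy. induction Hm as [|m Hm IH]; intros b x y Hb Hx Hy HF.
- rewrite !wcoc_base. apply (HF b (fun x => x) (fun _ => 1)). apply br_id; auto.
- destruct (Nat.eq_dec b (ls m)) as [->|Hn].
  + pose proof (dom_first m x Hx) as Hx1. pose proof (dom_second m x Hx) as Hx2.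
    pose proof (dom_first m y Hy) as Hy1. pose proof (dom_second m y Hy) as Hy2.
    rewrite !wcoc_lose, Td_lose by auto.
    assert (A1 : wcoc n F m (fs m) y <=
       K * exp (M * Td m (fs m) x y) * wcoc n E m (fs m) x).
    { apply IH; auto. intros a g g' B. apply (HF a g g'). apply br_first; auto. }
    assert (A2 : wcoc n F m (sn m) (G m (fs m) y) <=
       K * exp (M * Td m (sn m) (G m (fs m) x) (G m (fs m) y)) * wcoc n E m (sn m) (G m (fs m) x)).
    { apply IH; auto. intros a g g' B.
      apply (HF a (fun x => g (G m (fs m) x)) (fun x => g' (G m (fs m) x) * G1 m (fs m) x)).
      apply br_second; auto. }
    assert (A3 : G1 m (fs m) y <= exp (M * Td m (fs m) x y) * G1 m (fs m) x).
    { apply exp_ratio; auto using G1_pos.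
      pose proof (lnG1_distortion m (fs m) x y (Hfs m) Hx1 Hy1) as D.
      unabs D. unfold lnG1 in D. lra. }
    rewrite (Rmult_plus_distr_l M), exp_plus.
    set (p := exp (M * Td m (fs m) x y)) in *.
    set (q := exp (M * Td m (sn m) (G m (fs m) x) (G m (fs m) y))) in *.
    assert (Hq : 1 <= q) by (apply exp_ge_1, Rmult_le_pos; [lra|apply Td_nonneg]).
    assert (Hp : 0 < p) by apply exp_pos.
    pose proof (G1_pos m (fs m) y (Hfs m) Hy1).
    pose proof (G1_pos m (fs m) x (Hfs m) Hx1).
    assert (E1 : 0 <= wcoc n E m (fs m) x) by (apply wcoc_nonneg; auto).
    assert (E2 : 0 <= wcoc n E m (sn m) (G m (fs m) x)) by (apply wcoc_nonneg; auto).
    apply Rle_trans with (K * p * q * wcoc n E m (fs m) x +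
      K * q * wcoc n E m (sn m) (G m (fs m) x) * (p * G1 m (fs m) x)); [|right; ring].
    apply Rplus_le_compat.
    * eapply Rle_trans; [exact A1|]. apply Rmult_le_compat_r; auto.
      assert (0 <= K * p * (q - 1)) by (apply Rmult_le_pos; [apply Rmult_le_pos|]; lra). lra.
    * eapply Rle_trans; [apply Rmult_le_compat_r; [lra|exact A2]|].
      apply Rmult_le_compat_l; auto. apply Rmult_le_pos; auto. apply Rmult_le_pos; lra.
  + rewrite !wcoc_stay, Td_stay by auto. apply IH; auto using dom_stay.
    intros a g g' B. apply (HF a g g'). apply br_keep; auto.
Qed.

Lemma W_distortion n b x y : (b < d)%nat -> dom n b x -> dom n b y ->
  W n b y <= exp (M * Td n b x y) * W n b x.
Proof.
intros Hb Hx Hy. rewrite <- (Rmult_1_l (exp _)). unfold W.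
apply wcoc_compare; auto; [lia|lra|intros; lra|].
intros a g g' B. rewrite Rmult_1_l, Rmult_1_r.
apply exp_ge_1, Rmult_le_pos; [lra|apply Td_nonneg].
Qed.

Lemma psi_W n b x : (b < d)%nat -> dom n b x -> psi n b x * W n b x = nonlin n b x.
Proof.
intros Hb Hx. unfold psi. pose proof (W_ge_1 n b x Hb Hx). field. lra.
Qed.

Lemma psi_bound n b x : (b < d)%nat -> dom n b x -> - M <= psi n b x <= M.
Proof.
intros Hb Hx. pose proof (W_ge_1 n b x Hb Hx) as HW.
pose proof (nonlin_bound n b x Hb Hx) as HN. unabs HN.
rewrite <- psi_W in HN by auto. split; apply (Rmult_le_reg_r (W n b x)); lra.
Qed.

(** * Continuity of the averaged nonlinearity *)

Context (Hc nu : R) (HHc : 0 <= Hc) (Hnu : 0 < nu)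
  (Hmod : forall b x y t, (b < d)%nat -> dom 0 b x -> dom 0 b y -> Rabs (x - y) <= t -> 0 < t ->
     g2 b y / g1 b y - g2 b x / g1 b x <= Hc * Rpower t nu).

Lemma exp_minus_1_le z : 0 <= z -> exp z - 1 <= z * exp z.
Proof.
intros Hz. pose proof (exp_ineq1_le (- z)) as H.
assert (E : exp z * exp (- z) = 1) by (rewrite <- exp_plus, Rplus_opp_r; apply exp_0).
pose proof (exp_pos z). nra.
Qed.

(* The nonlinearity is shifted by [2 M] to make it positive, so that ratios can be compared. *)
Lemma psi_modulus n b x y t : (b < d)%nat -> dom n b x -> dom n b y ->
  0 < t -> Td n b x y <= t ->
  psi n b y - psi n b x <= 3 * M * exp (2 * V) * (2 * M + Hc) * (t + Rpower t nu).
Proof.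
intros Hb Hx Hy Ht HT.
set (r := Rpower t nu). assert (Hr : 0 < r) by apply exp_pos.
(* The shifted nonlinearity is at least [M], so an increment of [Hc * r] is at most the fraction
   [Hc * r / M] of it. *)
set (K := 1 + Hc * r / M).
assert (HK0 : 0 <= Hc * r / M).
{ unfold Rdiv. apply Rmult_le_pos; [apply Rmult_le_pos; lra|].
  left; apply Rinv_0_lt_compat; lra. }
assert (HKM : Hc * r / M * M = Hc * r) by (field; lra).
assert (P : wcoc 0 (fun b x => 1 * (g2 b x / g1 b x) + 2 * M * 1) n b y <=
  K * exp (M * Td n b x y) * wcoc 0 (fun b x => 1 * (g2 b x / g1 b x) + 2 * M * 1) n b x).
{ apply wcoc_compare; auto; [lia|unfold K; lra| |].
  - intros a u Ha Hu. specialize (HM a u Ha Hu). unabs HM. lra.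
  - intros a g g' B. pose proof (br_level B) as [_ [_ Ha]].
    pose proof (br_dom B Hx) as Hgx. pose proof (br_dom B Hy) as Hgy.
    pose proof (br_Td B Hx Hy) as HB.
    pose proof (Hmod a (g x) (g y) t Ha Hgx Hgy) as Hm. unfold Td in HB at 1. simpl in HB.
    pose proof (HM a (g x) Ha Hgx) as B1. unabs B1.
    assert (1 <= exp (M * Td 0 a (g x) (g y)))
      by (apply exp_ge_1, Rmult_le_pos; [lra|apply Td_nonneg]).
    fold r in Hm. unfold T in HB. simpl in HB.
    assert (Hm' := Hm ltac:(lra) Ht).
    set (e := exp _) in *. set (f := g2 a (g x) / g1 a (g x)) in *.
    assert (S1 : g2 a (g y) / g1 a (g y) + 2 * M <= K * (f + 2 * M)).
    { unfold K. assert (0 <= Hc * r / M * (f + M)) by (apply Rmult_le_pos; lra). lra. }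
    assert (0 <= K * (f + 2 * M) * (e - 1)); [|lra].
    apply Rmult_le_pos; [apply Rmult_le_pos|]; unfold K; lra. }
rewrite !(wcoc_linear 0 (fun b x => g2 b x / g1 b x) (fun _ _ => 1)) in P.
fold (nonlin n b x) (nonlin n b y) (W n b x) (W n b y) in P.
rewrite <- !psi_W in P by auto.
pose proof (W_distortion n b y x Hb Hy Hx) as D. rewrite Td_sym in D.
pose proof (W_ge_1 n b x Hb Hx). pose proof (W_ge_1 n b y Hb Hy).
pose proof (psi_bound n b x Hb Hx).
assert (Hz : 0 <= M * Td n b x y <= V).
{ split; [apply Rmult_le_pos; [lra|apply Td_nonneg]|apply MTd_le_V; auto]. }
assert (Hzt : M * Td n b x y <= M * t) by (apply Rmult_le_compat_l; lra).
set (z := M * Td n b x y) in *.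
(* One factor [exp z] comes from the weighted numerators, the other from the total weights [W] by
   which they are divided. *)
assert (Q : psi n b y + 2 * M <= K * exp (2 * z) * (psi n b x + 2 * M)).
{ apply (Rmult_le_reg_r (W n b y)); [lra|].
  replace (exp (2 * z)) with (exp z * exp z) by (rewrite <- exp_plus; f_equal; ring).
  assert (K * exp z * (psi n b x + 2 * M) * W n b x <=
          K * exp z * (psi n b x + 2 * M) * (exp z * W n b y)).
  { apply Rmult_le_compat_l; auto. pose proof (exp_pos z).
    apply Rmult_le_pos; [apply Rmult_le_pos|]; unfold K; lra. }
  lra. }
assert (E1 : exp (2 * z) <= exp (2 * V)) by (apply exp_le_compat; lra).
assert (E2 : exp (2 * z) - 1 <= 2 * (M * t) * exp (2 * V)).
{ eapply Rle_trans; [apply exp_minus_1_le; lra|].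
  apply Rmult_le_compat; try lra. left; apply exp_pos. }
assert (E3 : K * exp (2 * z) - 1 <= exp (2 * V) * (2 * M + Hc) * (t + r)).
{ unfold K. pose proof (exp_pos (2 * z)). pose proof (exp_pos (2 * V)) as HeV.
  assert (Hc * r / M * exp (2 * z) <= Hc * r * exp (2 * V)).
  { apply Rmult_le_compat; try lra.
    assert (0 <= Hc * r / M * (M - 1)) by (apply Rmult_le_pos; lra). lra. }
  assert (0 <= exp (2 * V) * (2 * M * r + Hc * t)); [|lra].
  apply Rmult_le_pos; [lra|]. apply Rplus_le_le_0_compat; apply Rmult_le_pos; lra. }
assert (E4 : 0 <= K * exp (2 * z) - 1).
{ assert (1 <= exp (2 * z)) by (apply exp_ge_1; lra). unfold K.
  assert (0 <= Hc * r / M * exp (2 * z)) by (apply Rmult_le_pos; lra). lra. }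
apply Rle_trans with ((K * exp (2 * z) - 1) * (psi n b x + 2 * M)); [lra|].
apply Rle_trans with ((K * exp (2 * z) - 1) * (3 * M)).
- apply Rmult_le_compat_l; lra.
- replace (3 * M * exp (2 * V) * (2 * M + Hc) * (t + r)) with
    (exp (2 * V) * (2 * M + Hc) * (t + r) * (3 * M)) by ring.
  apply Rmult_le_compat_r; lra.
Qed.

(** * Bounded slopes in genus one *)

Section Combinatorics.

(* [pos n b] is the rank of [b] in the top row at level [n]. The top row splits
   into blocks A (ranks up to [pp n]), B (up to [qq n]) and C, and the bottom row
   reads C B A; B may be empty. *)
Context (pos : nat -> nat -> nat) (pp qq : nat -> nat)
  (Hrk : forall n, ranking d (pos n))
  (Hpq : forall n, (1 <= pp n <= qq n)%nat /\ (qq n < d)%nat)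
  (Hpfs : forall n, pos n (fs n) = pp n) (Hpsn : forall n, pos n (sn n) = d)
  (Hp0 : forall n, ty n = false ->
     (forall b, (b < d)%nat -> pos (S n) b = pos n b) /\
     qq (S n) = qq n /\ pp (S n) = if Nat.eqb (pp n) 1 then qq n else (pp n - 1)%nat)
  (Hp1 : forall n, ty n = true ->
     (forall b, (b < d)%nat -> pos (S n) b =
        if Nat.eqb b (sn n) then (pp n + 1)%nat
        else if Nat.leb (pos n b) (pp n) then pos n b else (pos n b + 1)%nat) /\
     pp (S n) = pp n /\ qq (S n) = if Nat.eqb (qq n) (d - 1) then pp n else (qq n + 1)%nat).

Let Hpr n b : (b < d)%nat -> (1 <= pos n b <= d)%nat.
Proof. apply Hrk. Qed.

Let Hpi n a b : (a < d)%nat -> (b < d)%nat -> pos n a = pos n b -> a = b.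
Proof. apply Hrk. Qed.

(** A loser is reinserted behind rank [pp n], which is at least 1, hence never in front of the first
    letter. *)
Lemma first_letter : exists f, (f < d)%nat /\ forall n, pos n f = 1%nat.
Proof.
destruct (ranking_surj d (pos 0%nat) 1 (Hrk 0%nat)) as [f [Hf E]]; [lia|]. exists f. split; auto.
induction n as [|n IH]; auto. destruct (ty n) eqn:Et.
- destruct (Hp1 n Et) as [H1 _]. rewrite H1 by auto.
  destruct (Nat.eqb_spec f (sn n)) as [->|].
  + rewrite Hpsn in IH. lia.
  + rewrite IH. destruct (Nat.leb_spec 1 (pp n)); auto. specialize (Hpq n). lia.
- destruct (Hp0 n Et) as [H1 _]. rewrite H1; auto.
Qed.

(** This letter opens block C, which opens the bottom row. It leaves C only when it is all of C; it
    then opens B, and B is renamed C. *)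
Lemma bottom_first_letter : exists c, (c < d)%nat /\ forall n, pos n c = (qq n + 1)%nat.
Proof.
destruct (ranking_surj d (pos 0%nat) (qq 0 + 1) (Hrk 0%nat)) as [c [Hc1 E]]; [specialize (Hpq 0); lia|]. exists c. split; auto.
induction n as [|n IH]; auto. specialize (Hpq n). destruct (ty n) eqn:Et.
- destruct (Hp1 n Et) as [H1 [H2 H3]]. rewrite H1, H3 by auto.
  destruct (Nat.eqb_spec c (sn n)) as [->|Hn].
  + rewrite Hpsn in IH. destruct (Nat.eqb_spec (qq n) (d - 1)); lia.
  + destruct (Nat.eqb_spec (qq n) (d - 1)).
    * exfalso. apply Hn. apply (Hpi n); auto. rewrite Hpsn. lia.
    * rewrite IH. destruct (Nat.leb_spec (qq n + 1) (pp n)); lia.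
- destruct (Hp0 n Et) as [H1 [H2 H3]]. rewrite H1, H2; auto.
Qed.

(** * Invariant jumps of the log-slope *)

Section Slopes.
Context (f : nat) (Hf : (f < d)%nat) (Hpf : forall n, pos n f = 1%nat).

(* Jump of [ln Df] at the point separating adjacent letters [a] and [b]. At a
   discontinuity the one-sided orbits are continued by [sn] (from the left) or by
   the first letter [f] (from the right) until they meet again, which makes all jumps invariant. *)
Definition jump (n a b : nat) : R :=
  lnG1 n b (L n b) - lnG1 n a (U n a)
  - (if Nat.eqb (pos n a) (pp n) then lnG1 n (sn n) (U n (sn n)) else 0)
  + (if Nat.eqb (pos n a) (qq n) then lnG1 n f (L n f) else 0).

Lemma pos_lt_neq_sn n a : (pos n a < d)%nat -> a <> sn n.
Proof. intros H E. subst a. rewrite Hpsn in H. lia. Qed.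

Lemma pos_neq n a b : pos n a <> pos n b -> a <> b.
Proof. congruence. Qed.

(** The loser [fs n], last letter of A, gains the log-slope of [sn n] at both of its ends. Since the
    end of A moves one letter to the left, the continuation term behind [fs n] disappears and one
    appears in front of it, and both changes cancel. If A is this letter alone, the cancellation at
    its left end takes place at the end of B, through the term of [f]. *)
Lemma jump_step0 n a b : ty n = false -> (a < d)%nat -> (b < d)%nat ->
  pos (S n) b = (pos (S n) a + 1)%nat ->
  pos n b = (pos n a + 1)%nat /\ jump (S n) a b = jump n a b.
Proof.
intros Et Ha Hb E. destruct (Hst0 n Et) as [HL [HU HUs]]. destruct (Hp0 n Et) as [P1 [P2 P3]].
assert (El : ls n = fs n) by (unfold ls; rewrite Et; auto).
rewrite !P1 in E by auto. split; auto.
pose proof (Hpr n b Hb) as Rb. pose proof (Hpq n) as Rpq.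
assert (Esn : sn (S n) = sn n).
{ apply (Hpi (S n)); auto. rewrite Hpsn, P1, Hpsn; auto. }
assert (Hasn : a <> sn n) by (apply pos_lt_neq_sn; lia).
assert (Hlose : forall x, dom (S n) (fs n) x ->
  lnG1 (S n) (fs n) x = lnG1 n (fs n) x + lnG1 n (sn n) (G n (fs n) x)).
{ pose proof (lnG1_lose n) as Hl. rewrite El in Hl. exact Hl. }
assert (Hstay : forall c x, c <> fs n -> lnG1 (S n) c x = lnG1 n c x).
{ intros c x H. apply lnG1_stay. rewrite El; auto. }
unfold jump. rewrite Esn, P2, !P1, !HL, (HU a) by auto.
rewrite (Hstay (sn n)), HUs by auto.
set (X := lnG1 n (sn n) (G n (fs n) (L n (fs n)))).
set (Y := lnG1 n (sn n) (U n (sn n))).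
assert (HfsL : lnG1 (S n) (fs n) (L n (fs n)) = lnG1 n (fs n) (L n (fs n)) + X).
{ apply Hlose. rewrite <- HL by auto. apply L_dom; auto. }
assert (HfsU : lnG1 (S n) (fs n) (U n (fs n)) = lnG1 n (fs n) (U n (fs n)) + Y).
{ unfold Y. rewrite <- HGU. apply Hlose. rewrite <- HU by auto. apply U_dom; auto. }
assert (EL : forall c, (c < d)%nat -> lnG1 (S n) c (L n c) = lnG1 n c (L n c) + if Nat.eqb (pos n c) (pp n) then X else 0).
{ intros c Hc1. destruct (Nat.eqb_spec (pos n c) (pp n)) as [e|e].
  - assert (c = fs n) by (apply (Hpi n); auto; rewrite Hpfs; auto). subst c. auto.
  - rewrite Hstay; [ring|]. apply (pos_neq n). rewrite Hpfs. auto. }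
assert (EU : lnG1 (S n) a (U n a) = lnG1 n a (U n a) + if Nat.eqb (pos n a) (pp n) then Y else 0).
{ destruct (Nat.eqb_spec (pos n a) (pp n)) as [e|e].
  - assert (a = fs n) by (apply (Hpi n); auto; rewrite Hpfs; auto). subst a. auto.
  - rewrite Hstay; [ring|]. apply (pos_neq n). rewrite Hpfs. auto. }
rewrite EU, (EL b), (EL f), P3, Hpf, E by auto.
pose proof (Hpr n a Ha).
destruct (Nat.eqb_spec (pp n) 1); nat_cases; try lia; ring.
Qed.

(** The map of [fs n] sends the new cut point to the old left end of [sn n], so its jump is the old
    jump in front of [sn n]. The reinserted [sn n] and its right neighbour inherit the old jump
    behind [fs n]. All other pairs keep theirs. *)
Lemma jump_step1 n a b : ty n = true -> (a < d)%nat -> (b < d)%nat ->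
  pos (S n) b = (pos (S n) a + 1)%nat ->
  exists a' b', (a' < d)%nat /\ (b' < d)%nat /\
    pos n b' = (pos n a' + 1)%nat /\ jump (S n) a b = jump n a' b'.
Proof.
intros Et Ha Hb E. destruct (Hst1 n Et) as [HLU' [HLf [HUf [HUs HGt]]]].
destruct (Hp1 n Et) as [P1 [P2 P3]].
assert (El : ls n = sn n) by (unfold ls; rewrite Et; auto).
pose proof (Hpq n) as Rpq.
set (t := L (S n) (sn n)) in *.
assert (Hlose : forall x, dom (S n) (sn n) x ->
  lnG1 (S n) (sn n) x = lnG1 n (fs n) x + lnG1 n (sn n) (G n (fs n) x)).
{ pose proof (lnG1_lose n) as Hl. rewrite El in Hl. exact Hl. }
assert (Hstay : forall c x, c <> sn n -> lnG1 (S n) c x = lnG1 n c x).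
{ intros c x H. apply lnG1_stay. rewrite El; auto. }
assert (HLc : forall c, (c < d)%nat -> c <> sn n -> L (S n) c = L n c).
{ intros c Hc1 H. destruct (Nat.eq_dec c (fs n)) as [->|]; [auto|apply HLU'; auto]. }
assert (HUc : forall c, (c < d)%nat -> c <> sn n -> c <> fs n -> U (S n) c = U n c).
{ intros c Hc1 H H'. apply HLU'; auto. }
assert (HsL : lnG1 (S n) (sn n) t = lnG1 n (fs n) t + lnG1 n (sn n) (L n (sn n))).
{ rewrite <- HGt. apply Hlose. apply L_dom; auto. }
assert (HsU : lnG1 (S n) (sn n) (U n (fs n)) = lnG1 n (fs n) (U n (fs n)) + lnG1 n (sn n) (U n (sn n))).
{ rewrite <- HGU. apply Hlose. rewrite <- HUs. apply U_dom; auto. }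
assert (Psn : pos (S n) (sn n) = (pp n + 1)%nat) by (rewrite P1, Nat.eqb_refl; auto).
assert (Plow : forall c, (c < d)%nat -> (pos n c <= pp n)%nat -> pos (S n) c = pos n c).
{ intros c Hc1 H. rewrite P1 by auto. destruct (Nat.eqb_spec c (sn n)) as [->|].
  - rewrite Hpsn in H. lia.
  - destruct (Nat.leb_spec (pos n c) (pp n)); lia. }
assert (Phigh : forall c, (c < d)%nat -> (pp n < pos n c)%nat -> c <> sn n -> pos (S n) c = (pos n c + 1)%nat).
{ intros c Hc1 H H'. rewrite P1 by auto. destruct (Nat.eqb_spec c (sn n)); [lia|].
  destruct (Nat.leb_spec (pos n c) (pp n)); lia. }
assert (Pinv : forall c, (c < d)%nat -> c = sn n \/ (c <> sn n /\ (pos n c <= pp n)%nat /\ pos (S n) c = pos n c)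
   \/ (c <> sn n /\ (pp n < pos n c < d)%nat /\ pos (S n) c = (pos n c + 1)%nat)).
{ intros c Hc1. destruct (Nat.eq_dec c (sn n)) as [->|H]; auto. right.
  destruct (Nat.le_gt_cases (pos n c) (pp n)); [left|right]; auto.
  repeat split; auto. pose proof (Hpr n c Hc1).
  assert (pos n c <> d); [|lia]. intros e. apply H. apply (Hpi n); auto. rewrite Hpsn; auto. }
assert (Hfsn : f <> sn n) by (apply pos_lt_neq_sn; rewrite Hpf; lia).
assert (Elf : lnG1 (S n) f (L (S n) f) = lnG1 n f (L n f)) by (rewrite Hstay, HLc; auto).
unfold jump at 1. rewrite Elf, P2, P3. clear Elf.
destruct (Pinv a Ha) as [->|[[Na [Ra Ea]]|[Na [Ra Ea]]]];
destruct (Pinv b Hb) as [->|[[Nb [Rb Eb]]|[Nb [Rb Eb]]]]; try lia.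
- exists (fs n), b. rewrite Psn, Eb in E. repeat split; auto; [rewrite Hpfs; lia|].
  unfold jump. rewrite Hpfs, Nat.eqb_refl, Psn, HUs, HsU, Hstay, HLc by auto.
  destruct (Nat.eqb_spec (pp n + 1) (pp n)); [lia|].
  destruct (Nat.eqb_spec (qq n) (d - 1)); nat_cases; try lia; ring.
- assert (a = fs n) by (apply (Hpi n); auto; rewrite Hpfs; lia). subst a.
  destruct (ranking_surj d (pos n) (d - 1) (Hrk n)) as [a' [Ha' Ea']]; [lia|].
  exists a', (sn n). repeat split; auto; [rewrite Hpsn; lia|].
  unfold jump. fold t. rewrite Ea, Hpfs, Nat.eqb_refl, HUf, HsL, Hstay, Ea' by auto.
  (* The new last letter is [a'], unless [a'] is [fs n]: then [sn n] is reinserted at the same last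
     place. *)
  assert (X : lnG1 (S n) (sn (S n)) (U (S n) (sn (S n))) = lnG1 n a' (U n a') +
     if Nat.eqb (d - 1) (pp n) then lnG1 n (sn n) (U n (sn n)) else 0).
  { destruct (Nat.eqb_spec (d - 1) (pp n)) as [e|e].
    - assert (a' = fs n) by (apply (Hpi n); auto; rewrite Hpfs; lia). subst a'.
      assert (Es : sn (S n) = sn n) by (apply (Hpi (S n)); auto; rewrite Hpsn, Psn; lia).
      rewrite Es, HUs, HsU. auto.
    - assert (a' <> sn n) by (apply pos_lt_neq_sn; lia).
      assert (a' <> fs n) by (apply (pos_neq n); rewrite Hpfs; lia).
      assert (Es : sn (S n) = a').
      { apply (Hpi (S n)); auto. rewrite Hpsn, Phigh; auto; lia. }
      rewrite Es, HUc, Hstay by auto. ring. }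
  rewrite X.
  destruct (Nat.eqb_spec (qq n) (d - 1)); nat_cases; try lia; ring.
- exists a, b. rewrite Ea, Eb in E. repeat split; auto.
  assert (a <> fs n) by (apply (pos_neq n); rewrite Hpfs; lia).
  unfold jump. rewrite Ea, !Hstay, HLc, HUc by auto.
  destruct (Nat.eqb_spec (qq n) (d - 1)); nat_cases; try lia; ring.
- exists a, b. rewrite Ea, Eb in E. repeat split; auto; [lia|].
  assert (a <> fs n) by (apply (pos_neq n); rewrite Hpfs; lia).
  unfold jump. rewrite Ea, !Hstay, HLc, HUc by auto.
  destruct (Nat.eqb_spec (qq n) (d - 1)); nat_cases; try lia; ring.
Qed.

Lemma jump_bounded : exists J, 0 <= J /\ forall n a b, (a < d)%nat -> (b < d)%nat ->
  pos n b = (pos n a + 1)%nat -> Rabs (jump n a b) <= J.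
Proof.
set (J := rsum (fun a => rsum (fun b => Rabs (jump 0 a b)) d) d).
assert (P : forall a, 0 <= rsum (fun b => Rabs (jump 0 a b)) d).
{ intros a. pose proof (rsum_le (fun _ => 0) (fun b => Rabs (jump 0 a b)) d) as H.
  rewrite rsum_const, Rmult_0_r in H. apply H. intros; apply Rabs_pos. }
exists J. split.
- pose proof (rsum_term_le (fun a => rsum (fun b => Rabs (jump 0 a b)) d) d f) as H.
  eapply Rle_trans; [|apply H; auto]. apply P.
- induction n as [|n IH]; intros a b Ha Hb E.
  + apply Rle_trans with (rsum (fun b => Rabs (jump 0 a b)) d).
    * apply (rsum_term_le (fun b => Rabs (jump 0 a b))); auto. intros; apply Rabs_pos.
    * apply (rsum_term_le (fun a => rsum (fun b => Rabs (jump 0 a b)) d)); auto.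
  + destruct (ty n) eqn:Et.
    * destruct (jump_step1 n a b Et Ha Hb E) as [a' [b' [Ha' [Hb' [E' ->]]]]]. auto.
    * destruct (jump_step0 n a b Et Ha Hb E) as [E' ->]. auto.
Qed.

Context (g : nat) (Hg : (g < d)%nat) (Hpg : forall n, pos n g = (qq n + 1)%nat).

(** Inside a block, neighbours differ by a jump and an oscillation, at most [J + V]. If B is
    nonempty, the jump across the end of A contains in addition the log-slope of [sn n], a letter of
    C; so on B the log-slope is the sum of those on A and C. *)
Lemma block_slopes : exists D, 0 <= D /\ forall n b x, (b < d)%nat -> dom n b x ->
  Rabs (lnG1 n b x
    - (if Nat.leb (pos n b) (qq n) then lnG1 n f (L n f) else 0)
    - (if Nat.leb (pos n b) (pp n) then 0 else lnG1 n g (L n g))) <= D.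
Proof.
destruct jump_bounded as [J [HJ0 HJ]]. pose proof V_nonneg as HV.
set (Z := J + V).
assert (chain : forall n lo hi c X, (pos n c = lo) -> (c < d)%nat ->
  (forall j, (lo <= j < hi)%nat -> j <> pp n /\ j <> qq n) -> (hi <= d)%nat ->
  Rabs (lnG1 n c (L n c) - X) <= 2 * INR d * Z + 3 * Z ->
  forall b, (b < d)%nat -> (lo <= pos n b <= hi)%nat ->
  Rabs (lnG1 n b (L n b) - X) <= Rabs (lnG1 n c (L n c) - X) + INR d * Z).
{ intros n lo hi c X Hcp Hc1 Hne' Hhi HX.
  assert (A : forall j b, (b < d)%nat -> (lo + j <= hi)%nat -> pos n b = (lo + j)%nat ->
    Rabs (lnG1 n b (L n b) - X) <= Rabs (lnG1 n c (L n c) - X) + INR j * Z).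
  { induction j as [|j IH]; intros b Hb Hj Eb.
    - assert (b = c) by (apply (Hpi n); auto; lia). subst b. simpl. lra.
    - destruct (ranking_surj d (pos n) (lo + j) (Hrk n)) as [a [Ha Ea]].
      { pose proof (Hpr n c Hc1). lia. }
      specialize (IH a Ha ltac:(lia) Ea). specialize (HJ n a b Ha Hb ltac:(lia)).
      destruct (Hne' (lo + j)%nat ltac:(lia)) as [N1 N2].
      unfold jump in HJ. rewrite Ea in HJ.
      destruct (Nat.eqb_spec (lo + j) (pp n)); [lia|]. destruct (Nat.eqb_spec (lo + j) (qq n)); [lia|].
      pose proof (lnG1_osc n a _ _ Ha (U_dom n a Ha) (L_dom n a Ha)) as O.
      rewrite S_INR. unfold Z in *.
      unabs HJ. unabs O. unabs IH.
      apply Rabs_le. lra. }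
  intros b Hb Hpb. eapply Rle_trans; [apply (A (pos n b - lo)%nat b); auto; lia|].
  apply Rplus_le_compat_l, Rmult_le_compat_r; [unfold Z; lra|]. apply le_INR.
  pose proof (Hpr n b Hb). lia. }
assert (Hd0 : 0 <= INR d) by apply pos_INR.
assert (HZ : 0 <= Z) by (unfold Z; lra).
assert (HdZ : 0 <= INR d * Z) by (apply Rmult_le_pos; auto).
assert (bA : forall n b, (b < d)%nat -> (pos n b <= pp n)%nat ->
  Rabs (lnG1 n b (L n b) - lnG1 n f (L n f)) <= INR d * Z).
{ intros n b Hb Hp. pose proof (Hpq n). pose proof (Hpr n b Hb).
  pose proof (chain n 1%nat (pp n) f (lnG1 n f (L n f)) (Hpf n) Hf) as Q.
  replace (lnG1 n f (L n f) - lnG1 n f (L n f)) with 0 in Q by ring. rewrite Rabs_R0 in Q.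
  rewrite <- (Rplus_0_l (INR d * Z)).
  apply Q; auto; try (intros; lia); lra. }
assert (bC : forall n b, (b < d)%nat -> (qq n < pos n b)%nat ->
  Rabs (lnG1 n b (L n b) - lnG1 n g (L n g)) <= INR d * Z).
{ intros n b Hb Hp. pose proof (Hpq n). pose proof (Hpr n b Hb).
  pose proof (chain n (qq n + 1)%nat d g (lnG1 n g (L n g)) (Hpg n) Hg) as Q.
  replace (lnG1 n g (L n g) - lnG1 n g (L n g)) with 0 in Q by ring. rewrite Rabs_R0 in Q.
  rewrite <- (Rplus_0_l (INR d * Z)).
  apply Q; auto; try (intros; lia); lra. }
assert (bB : forall n b, (b < d)%nat -> (pp n < pos n b <= qq n)%nat ->
  Rabs (lnG1 n b (L n b) - (lnG1 n f (L n f) + lnG1 n g (L n g))) <= (2 * INR d * Z + 3 * Z) + INR d * Z).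
{ intros n b Hb Hp. pose proof (Hpq n). pose proof (Hpr n b Hb).
  destruct (ranking_surj d (pos n) (pp n + 1) (Hrk n)) as [c [Hc1 Ec]]; [lia|].
  assert (HX : Rabs (lnG1 n c (L n c) - (lnG1 n f (L n f) + lnG1 n g (L n g))) <= 2 * INR d * Z + 3 * Z).
  { specialize (HJ n (fs n) c (Hfs n) Hc1). rewrite Hpfs in HJ. specialize (HJ ltac:(lia)).
    unfold jump in HJ. rewrite Hpfs, Nat.eqb_refl in HJ.
    destruct (Nat.eqb_spec (pp n) (qq n)); [lia|].
    specialize (bA n (fs n) (Hfs n)). rewrite Hpfs in bA. specialize (bA ltac:(lia)).
    specialize (bC n (sn n) (Hsn n)). rewrite Hpsn in bC. specialize (bC ltac:(lia)).
    pose proof (lnG1_osc n (fs n) _ _ (Hfs n) (U_dom n _ (Hfs n)) (L_dom n _ (Hfs n))) as O1.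
    pose proof (lnG1_osc n (sn n) _ _ (Hsn n) (U_dom n _ (Hsn n)) (L_dom n _ (Hsn n))) as O2.
    unabs HJ. unabs O1. unabs O2.
    unabs bA. unabs bC. apply Rabs_le. unfold Z in *. lra. }
  eapply Rle_trans; [apply (chain n (pp n + 1)%nat (qq n) c) with (b := b); auto|]; try lia.
  lra. }
exists ((2 * INR d * Z + 3 * Z) + INR d * Z + V). split; [lra|].
intros n b x Hb Hx. pose proof (lnG1_osc n b x _ Hb Hx (L_dom n b Hb)) as O.
unabs O.
destruct (Nat.leb_spec (pos n b) (qq n)); destruct (Nat.leb_spec (pos n b) (pp n)).
- pose proof (bA n b Hb ltac:(lia)) as Q. unabs Q. apply Rabs_le. lra.
- pose proof (bB n b Hb ltac:(lia)) as Q. unabs Q. apply Rabs_le. lra.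
- specialize (Hpq n). lia.
- pose proof (bC n b Hb ltac:(lia)) as Q. unabs Q. apply Rabs_le. lra.
Qed.

Context (Kw : nat) (HKw : (1 <= Kw)%nat)
  (Hlose : forall n b, (b < d)%nat -> exists m, (n <= m < n + Kw)%nat /\ ls m = b)
  (Hmass : forall n, rsum (fun b => (G n b (U n b) - G n b (L n b)) - (U n b - L n b)) d = 0).

(** Intervals and images have the same total length, so the slopes can neither all exceed 1 nor all
    stay below 1. *)
Lemma slope_of_sign n s : (s = 1 \/ s = -1) ->
  (forall b x, (b < d)%nat -> dom n b x -> 0 < s * lnG1 n b x) -> False.
Proof.
intros Hs H.
assert (A : forall b, (b < d)%nat -> 0 < s * ((G n b (U n b) - G n b (L n b)) - (U n b - L n b))).
{ intros b Hb. pose proof (HLU n b Hb).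
  destruct (mean_value (G n b) (G1 n b) (L n b) (U n b)) as [c [Ic E]]; [lra| |].
  - intros c Ic. apply G_der; auto.
  - rewrite E. specialize (H b c Hb Ic). pose proof (G1_pos n b c Hb Ic) as P. unfold lnG1 in H.
    replace (s * (G1 n b c * (U n b - L n b) - (U n b - L n b))) with
      ((s * (G1 n b c - 1)) * (U n b - L n b)) by ring.
    apply Rmult_lt_0_compat; [|lra].
    destruct Hs as [-> | ->].
    + assert (1 < G1 n b c); [|lra]. apply ln_lt_inv; try lra. rewrite ln_1. lra.
    + assert (G1 n b c < 1); [|lra]. apply ln_lt_inv; try lra. rewrite ln_1. lra. }
assert (E : forall m, rsum (fun b => s * ((G n b (U n b) - G n b (L n b)) - (U n b - L n b))) m =
  s * rsum (fun b => (G n b (U n b) - G n b (L n b)) - (U n b - L n b)) m).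
{ induction m as [|m IH]; simpl; [ring|]. rewrite IH. ring. }
specialize (E d). rewrite Hmass, Rmult_0_r in E.
pose proof (rsum_term_le (fun b => s * ((G n b (U n b) - G n b (L n b)) - (U n b - L n b))) d f) as T1.
rewrite E in T1. specialize (A f Hf) as Af.
assert (T2 := T1 ltac:(intros b Hb; left; apply A; auto) Hf). simpl in T2. lra.
Qed.

Lemma slopes_bounded_aux : exists Om, 0 <= Om /\
  forall n b x, (b < d)%nat -> dom n b x -> Rabs (lnG1 n b x) <= Om.
Proof.
destruct block_slopes as [D [HD0 HD]]. pose proof V_nonneg as HV.
set (a := fun n => lnG1 n f (L n f)). set (c := fun n => lnG1 n g (L n g)).
assert (HA : forall n b x, (b < d)%nat -> dom n b x -> (pos n b <= pp n)%nat -> Rabs (lnG1 n b x - a n) <= D).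
{ intros n b x Hb Hx H. specialize (HD n b x Hb Hx). specialize (Hpq n).
  destruct (Nat.leb_spec (pos n b) (qq n)); [|lia]. destruct (Nat.leb_spec (pos n b) (pp n)); [|lia].
  rewrite Rminus_0_r in HD. exact HD. }
assert (HC : forall n b x, (b < d)%nat -> dom n b x -> (qq n < pos n b)%nat -> Rabs (lnG1 n b x - c n) <= D).
{ intros n b x Hb Hx H. specialize (HD n b x Hb Hx). specialize (Hpq n).
  destruct (Nat.leb_spec (pos n b) (qq n)); [lia|]. destruct (Nat.leb_spec (pos n b) (pp n)); [lia|].
  rewrite Rminus_0_r in HD. exact HD. }
assert (Hstay : forall n b, (b < d)%nat -> ls n <> b ->
  Rabs (lnG1 (S n) b (L (S n) b) - lnG1 n b (L n b)) <= V).
{ intros n b Hb Hn. rewrite lnG1_stay by auto. apply lnG1_osc; auto using L_dom.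
  apply dom_stay; auto. apply L_dom; auto. }
(* [f] can lose only as [fs n], and then gains the log-slope of a letter of C; [g] can lose only as
   [sn n], and then gains that of a letter of A. The bound [2 * D + V] covers these errors, and if
   [a n] and [c n] both exceed it in the same direction then every log-slope has that sign. *)
destruct (shear_bounded a c (fun n => Nat.eqb (ls n) f) (fun n => Nat.eqb (ls n) g) (2 * D + V) Kw)
  as [B HB]; auto; try lra.
- intros n. destruct (Nat.eqb_spec (ls n) f) as [e|e].
  + assert (Hx : dom (S n) (ls n) (L (S n) f)) by (rewrite e; apply L_dom; auto).
    assert (ef : fs n = f).
    { rewrite <- e. unfold ls. destruct (ty n) eqn:Et; auto. exfalso.
      unfold ls in e; rewrite Et in e. pose proof (Hpf n). rewrite <- e, Hpsn in H. lia. }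
    unfold a. rewrite <- e at 1. rewrite lnG1_lose by auto.
    pose proof (HC n (sn n) _ (Hsn n) (dom_second n _ Hx)) as Q.
    rewrite Hpsn in Q. specialize (Q ltac:(specialize (Hpq n); lia)).
    pose proof (lnG1_osc n (fs n) _ (L n f) (Hfs n) (dom_first n _ Hx)) as O.
    specialize (O ltac:(rewrite ef; apply L_dom; auto)). rewrite ef in *.
    unabs Q. unabs O. apply Rabs_le. lra.
  + specialize (Hstay n f Hf e). rewrite Rminus_0_r. unfold a. lra.
- intros n. destruct (Nat.eqb_spec (ls n) g) as [e|e].
  + assert (Hx : dom (S n) (ls n) (L (S n) g)) by (rewrite e; apply L_dom; auto).
    assert (eg : sn n = g).
    { rewrite <- e. unfold ls. destruct (ty n) eqn:Et; auto. exfalso.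
      unfold ls in e; rewrite Et in e. pose proof (Hpg n) as H. rewrite <- e, Hpfs in H.
      specialize (Hpq n). lia. }
    unfold c. rewrite <- e at 1. rewrite lnG1_lose by auto.
    pose proof (HA n (fs n) _ (Hfs n) (dom_first n _ Hx)) as Q.
    rewrite Hpfs in Q. specialize (Q ltac:(lia)).
    pose proof (lnG1_osc n (sn n) _ (L n g) (Hsn n) (dom_second n _ Hx)) as O.
    specialize (O ltac:(rewrite eg; apply L_dom; auto)). rewrite eg in *.
    unabs Q. unabs O. apply Rabs_le. lra.
  + specialize (Hstay n g Hg e). rewrite Rminus_0_r. unfold c. lra.
- intros n. destruct (Nat.eqb_spec (ls n) f); auto. destruct (Nat.eqb_spec (ls n) g); auto.
  exfalso. pose proof (Hpf n). pose proof (Hpg n). specialize (Hpq n).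
  assert (pos n f = pos n g) by congruence. lia.
- intros n. destruct (Hlose n f Hf) as [m [Hm e]]. exists m. rewrite e, Nat.eqb_refl. auto.
- intros n. destruct (Hlose n g Hg) as [m [Hm e]]. exists m. rewrite e, Nat.eqb_refl. auto.
- intros n. destruct (Rle_dec (a n) (2 * D + V)) as [|N1]; auto.
  destruct (Rle_dec (c n) (2 * D + V)) as [|N2]; auto. exfalso.
  apply (slope_of_sign n 1); auto. intros b x Hb Hx. specialize (HD n b x Hb Hx).
  fold (a n) (c n) in HD. unabs HD. specialize (Hpq n).
  destruct (Nat.leb_spec (pos n b) (qq n)); destruct (Nat.leb_spec (pos n b) (pp n)); lra || lia.
- intros n. destruct (Rle_dec (- (2 * D + V)) (a n)) as [|N1]; auto.
  destruct (Rle_dec (- (2 * D + V)) (c n)) as [|N2]; auto. exfalso.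
  apply (slope_of_sign n (-1)); auto. intros b x Hb Hx. specialize (HD n b x Hb Hx).
  fold (a n) (c n) in HD. unabs HD. specialize (Hpq n).
  destruct (Nat.leb_spec (pos n b) (qq n)); destruct (Nat.leb_spec (pos n b) (pp n)); lra || lia.
- assert (B0 : 0 <= B) by (destruct (HB 0%nat) as [H _]; pose proof (Rabs_pos (a 0%nat)); lra).
  exists (D + 2 * B). split; [lra|]. intros n b x Hb Hx. specialize (HD n b x Hb Hx).
  fold (a n) (c n) in HD. unabs HD. destruct (HB n) as [Ba Bc].
  unabs Ba. unabs Bc. apply Rabs_le.
  destruct (Nat.leb_spec (pos n b) (qq n)); destruct (Nat.leb_spec (pos n b) (pp n)); lra.
Qed.

End Slopes.

Context (Kw : nat) (HKw : (1 <= Kw)%nat)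
  (Hchain : forall n b c, (b < d)%nat -> (c < d)%nat -> exists n1 p,
     (n <= n1)%nat /\ (n1 + p < n + Kw)%nat /\ ws n1 = b /\ ls (n1 + p) = c /\
     forall i, (i < p)%nat -> ls (n1 + i) = ws (n1 + i + 1))
  (Hmass : forall n, rsum (fun b => (G n b (U n b) - G n b (L n b)) - (U n b - L n b)) d = 0).

Lemma slopes_bounded : exists Om, 0 <= Om /\
  forall n b x, (b < d)%nat -> dom n b x -> Rabs (lnG1 n b x) <= Om.
Proof.
destruct first_letter as [f [Hf Hpf]]. destruct bottom_first_letter as [g [Hg Hpg]].
apply (slopes_bounded_aux f Hf Hpf g Hg Hpg Kw); auto.
intros n b Hb. destruct (Hchain n b b Hb Hb) as [n1 [p [H1 [H2 [_ [H3 _]]]]]].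
exists (n1 + p)%nat. split; [lia|auto].
Qed.

(** Along a chain the loser of each step is the winner of the next, so the visits given by
    [br_winner] compose. [br_self] prolongs the result to both ends of the window. *)
Lemma every_visit n b a : (b < d)%nat -> (a < d)%nat -> exists g g', br n (n + Kw) b a g g'.
Proof.
intros Hb Ha. destruct (Hchain n a b Ha Hb) as [n1 [p [H1 [H2 [H3 [H4 H5]]]]]].
assert (C : forall i, (i <= p)%nat -> exists g g', br n (S (n1 + i)) (ls (n1 + i)) a g g').
{ induction i as [|i IH]; intros Hi.
  - rewrite Nat.add_0_r. destruct (br_winner n1) as [h [h' B]]. rewrite H3 in B.
    destruct (br_self n n1 a H1 Ha) as [g [g' B']].
    destruct (br_comp _ _ _ _ _ _ _ _ _ _ B' B) as [k [k' [B'' _]]]. eauto.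
  - destruct (IH ltac:(lia)) as [g [g' B']]. rewrite H5 in B' by lia.
    replace (S (n1 + i)) with (n1 + S i)%nat in B' by lia.
    replace (n1 + i + 1)%nat with (n1 + S i)%nat in B' by lia.
    destruct (br_winner (n1 + S i)) as [h [h' B]].
    destruct (br_comp _ _ _ _ _ _ _ _ _ _ B' B) as [k [k' [B'' _]]]. eauto. }
destruct (C p ltac:(lia)) as [g [g' B']]. rewrite H4 in B'.
destruct (br_self (S (n1 + p)) (n + Kw) b ltac:(lia) Hb) as [h [h' B]].
destruct (br_comp _ _ _ _ _ _ _ _ _ _ B' B) as [k [k' [B'' _]]]. eauto.
Qed.

End Combinatorics.

(** * Bounded geometry *)

Context (Om : R) (HOm0 : 0 <= Om)
  (HOm : forall n b x, (b < d)%nat -> dom n b x -> Rabs (lnG1 n b x) <= Om)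
  (K : nat) (HK : (1 <= K)%nat)
  (Hvis : forall n b a, (b < d)%nat -> (a < d)%nat -> exists g g', br n (n + K) b a g g').

Definition min_slope : R := exp (- Om).
(** One level adds to an orbit sum at most a second sum multiplied by a slope, which is at most
    [exp Om]. *)
Definition growth : R := 1 + exp Om.
Definition growth_d : R := growth ^ K * INR d.
Definition len (n b : nat) : R := U n b - L n b.

Lemma min_slope_pos : 0 < min_slope.
Proof. apply exp_pos. Qed.

Lemma min_slope_le_1 : min_slope <= 1.
Proof. rewrite <- exp_0. apply exp_le_compat; lra. Qed.

Lemma min_slope_K_pos : 0 < min_slope ^ K.
Proof. apply pow_lt, min_slope_pos. Qed.

Lemma min_slope_K_le_1 : min_slope ^ K <= 1.
Proof. rewrite <- (pow1 K). apply pow_incr. pose proof min_slope_pos; pose proof min_slope_le_1; lra. Qed.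

Lemma growth_ge_2 : 2 <= growth.
Proof. unfold growth. pose proof (exp_ge_1 Om HOm0). lra. Qed.

Lemma growth_K_ge_1 : 1 <= growth ^ K.
Proof. apply pow_R1_Rle. pose proof growth_ge_2; lra. Qed.

Lemma growth_d_ge_2 : 2 <= growth_d.
Proof.
unfold growth_d. assert (2 <= INR d) by (apply (le_INR 2); auto).
pose proof growth_K_ge_1. nra.
Qed.

Lemma G1_bounds n b x : (b < d)%nat -> dom n b x -> min_slope <= G1 n b x <= exp Om.
Proof.
intros Hb Hx. pose proof (HOm n b x Hb Hx) as H. unabs H. unfold lnG1 in H.
rewrite <- (exp_ln (G1 n b x)) by (apply G1_pos; auto).
split; apply exp_le_compat; lra.
Qed.

(** Each level contributes at most one slope, bounded below by [min_slope]; a level that contributes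
    none costs nothing since [min_slope <= 1]. *)
Lemma br_slope {n m b a g g' x} : br n m b a g g' -> dom m b x -> min_slope ^ m <= min_slope ^ n * g' x.
Proof.
intros H. revert x. pose proof min_slope_pos as S0. pose proof min_slope_le_1 as S1.
induction H as [a Ha|m b a g g' Hb H IH|m a g g' H IH|m a g g' H IH]; intros x Hx.
- lra.
- assert (Hx' : dom m b x) by (apply dom_stay; auto; apply (br_level H)).
  specialize (IH x Hx'). simpl. pose proof (pow_lt min_slope m S0). nra.
- specialize (IH x (dom_first m x Hx)). simpl. pose proof (pow_lt min_slope m S0). nra.
- specialize (IH _ (dom_second m x Hx)). simpl.
  destruct (G1_bounds m (fs m) x (Hfs m) (dom_first m x Hx)) as [B _].
  rewrite <- Rmult_assoc, Rmult_comm.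
  pose proof (pow_lt min_slope m S0). apply Rmult_le_compat; lra.
Qed.

Lemma br_window_slope {n b a g g' x} : br n (n + K) b a g g' -> dom (n + K) b x -> min_slope ^ K <= g' x.
Proof.
intros H Hx. pose proof (br_slope H Hx) as B. rewrite pow_add in B.
apply Rmult_le_reg_l in B; auto. apply pow_lt, min_slope_pos.
Qed.

Lemma wcoc_upper n E B m b x : (n <= m)%nat -> (b < d)%nat -> dom m b x -> 0 <= B ->
  (forall a u, (a < d)%nat -> dom n a u -> E a u <= B) ->
  wcoc n E m b x * growth ^ n <= B * growth ^ m.
Proof.
intros Hm Hb Hx HB HE. pose proof growth_ge_2 as Hq. revert m b x Hm Hb Hx.
apply (level_ind n (fun m b x => wcoc n E m b x * growth ^ n <= B * growth ^ m)).
- intros b x Hb Hx. rewrite wcoc_base. apply Rmult_le_compat_r; auto.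
  left; apply pow_lt; lra.
- intros m b x Hm Hb Hn Hx H. rewrite wcoc_stay by auto. simpl.
  assert (0 < growth ^ m) by (apply pow_lt; lra).
  assert (0 <= B * growth ^ m) by (apply Rmult_le_pos; lra). nra.
- intros m x Hm Hx H1 H2 E1 E2. rewrite wcoc_lose by auto.
  destruct (G1_bounds m (fs m) x (Hfs m) H1) as [P1 P2].
  pose proof (G1_pos m (fs m) x (Hfs m) H1) as P0.
  replace (B * growth ^ S m) with (B * growth ^ m + B * growth ^ m * exp Om) by (simpl; unfold growth at 3; ring).
  assert (0 < growth ^ m) by (apply pow_lt; lra).
  assert (0 <= B * growth ^ m) by (apply Rmult_le_pos; lra).
  assert (wcoc n E m (sn m) (G m (fs m) x) * growth ^ n * G1 m (fs m) x <= B * growth ^ m * exp Om).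
  { apply Rle_trans with (B * growth ^ m * G1 m (fs m) x).
    - apply Rmult_le_compat_r; lra.
    - apply Rmult_le_compat_l; lra. }
  lra.
Qed.

Lemma wcoc_window_upper n E B b x : (b < d)%nat -> dom (n + K) b x -> 0 <= B ->
  (forall a u, (a < d)%nat -> dom n a u -> E a u <= B) ->
  wcoc n E (n + K) b x <= B * growth ^ K.
Proof.
intros Hb Hx HB HE.
assert (H : wcoc n E (n + K) b x * growth ^ n <= B * growth ^ (n + K)) by (apply wcoc_upper; auto; lia).
rewrite pow_add in H. apply (Rmult_le_reg_r (growth ^ n)); [|lra].
apply pow_lt. pose proof growth_ge_2; lra.
Qed.

Lemma len_pos n b : (b < d)%nat -> 0 < len n b.
Proof. intros Hb. specialize (HLU n b Hb). unfold len; lra. Qed.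

Lemma br_image_len {n b a g g'} : br n (n + K) b a g g' ->
  min_slope ^ K * len (n + K) b <= g (U (n + K) b) - g (L (n + K) b) <= len n a.
Proof.
intros H. pose proof (br_level H) as [_ [Hb Ha]].
pose proof (br_dom H (L_dom _ _ Hb)) as HL.
pose proof (br_dom H (U_dom _ _ Hb)) as HU.
pose proof (len_pos (n + K) b Hb) as Hlen. unfold len in *.
split; [|unfold dom in *; lra].
destruct (mean_value g g' (L (n + K) b) (U (n + K) b)) as [c [Hc1 E]]; [lra| |].
- intros c Hc1. apply (br_der H Hc1).
- rewrite E. apply Rmult_le_compat_r; [lra|]. apply (br_window_slope H Hc1).
Qed.

(** Its cocycle adds the positions of the visits to [a] only, so conservation says that the visits
    of all letters fill the interval of [a] exactly. *)
Definition indicator_id (a b : nat) (x : R) : R := if Nat.eqb b a then x else 0.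

Lemma indicator_id_le a b u v : u <= v -> indicator_id a b u <= indicator_id a b v.
Proof. unfold indicator_id. destruct (Nat.eqb b a); lra. Qed.

Lemma indicator_conserved n m a : (n <= m)%nat -> (a < d)%nat ->
  rsum (fun b => coc n (indicator_id a) m b (U m b) - coc n (indicator_id a) m b (L m b)) d = len n a.
Proof.
intros Hm Ha. rewrite coc_conserved by auto.
rewrite <- (rsum_delta a (len n a) d Ha). apply rsum_ext. intros b Hb.
unfold indicator_id, len. destruct (Nat.eqb_spec b a) as [->|]; ring.
Qed.

Lemma len_le_sum n a : (a < d)%nat -> len n a <= growth ^ K * rsum (len (n + K)) d.
Proof.
intros Ha. rewrite <- (indicator_conserved n (n + K) a) by (auto; lia).
assert (E : forall m, growth ^ K * rsum (len (n + K)) m = rsum (fun b => growth ^ K * len (n + K) b) m).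
{ induction m as [|m IH]; simpl; [ring|]. rewrite <- IH; ring. }
rewrite E. apply rsum_le. intros b Hb. pose proof (len_pos (n + K) b Hb) as Hlen.
unfold len in *.
destruct (mean_value (coc n (indicator_id a) (n + K) b)
  (wcoc n (fun b _ => if Nat.eqb b a then 1 else 0) (n + K) b)
  (L (n + K) b) (U (n + K) b)) as [c [Hc1 Ec]]; [lra| |].
- intros c Hc1. apply coc_derivable; auto; [lia|].
  intros b' x _ _. unfold indicator_id. destruct (Nat.eqb b' a).
  + apply derivable_pt_lim_id.
  + apply derivable_pt_lim_const.
- rewrite Ec. apply Rmult_le_compat_r; [lra|].
  rewrite <- (Rmult_1_l (growth ^ K)). apply wcoc_window_upper; auto; [lra|].
  intros b' u _ _. destruct (Nat.eqb b' a); lra.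
Qed.

Lemma len_sum_le n (X : R) : (forall c, (c < d)%nat -> len (n + K) c <= X) ->
  forall a, (a < d)%nat -> len n a <= growth_d * X.
Proof.
intros H a Ha. eapply Rle_trans; [apply len_le_sum; auto|].
unfold growth_d. rewrite Rmult_assoc. apply Rmult_le_compat_l; [pose proof growth_K_ge_1; lra|].
rewrite <- rsum_const. apply rsum_le; auto.
Qed.

(** Each interval of level [n + K] is mapped into that of [b] with slope at least [min_slope ^ K],
    hence is short compared with it; and these intervals, expanded by a bounded amount, fill the
    interval of [a]. *)
Lemma len_comparable n a b : (a < d)%nat -> (b < d)%nat ->
  len n a <= growth_d / min_slope ^ K * len n b.
Proof.
intros Ha Hb. pose proof min_slope_K_pos.
replace (growth_d / min_slope ^ K * len n b) with (growth_d * (len n b / min_slope ^ K)) by (field; lra).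
apply (len_sum_le n); auto. intros c Hc1.
destruct (Hvis n c b Hc1 Hb) as [g [g' B]]. pose proof (br_image_len B).
apply (Rmult_le_reg_l (min_slope ^ K)); auto. field_simplify; lra.
Qed.

Lemma len_window n a b : (a < d)%nat -> (b < d)%nat ->
  len n a <= growth_d * (growth_d / min_slope ^ K) * len (n + K) b.
Proof.
intros Ha Hb. rewrite Rmult_assoc. apply (len_sum_le n); auto.
intros c Hc1. apply len_comparable; auto.
Qed.

(** This is [min_slope ^ K], the least slope of a visit, divided by the constant of [len_window]: a
    lower bound for the share that a single visit occupies. *)
Definition free_ratio : R := min_slope ^ K * min_slope ^ K / (growth_d * growth_d).

Lemma free_ratio_pos : 0 < free_ratio.
Proof.
unfold free_ratio. pose proof min_slope_K_pos. pose proof growth_d_ge_2.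
apply Rdiv_lt_0_compat; apply Rmult_lt_0_compat; lra.
Qed.

Lemma free_ratio_le : free_ratio <= / 2.
Proof.
unfold free_ratio. pose proof min_slope_K_pos. pose proof min_slope_K_le_1. pose proof growth_d_ge_2.
assert (0 < growth_d * growth_d) by (apply Rmult_lt_0_compat; lra).
apply (Rmult_le_reg_r (growth_d * growth_d)); auto.
replace (min_slope ^ K * min_slope ^ K / (growth_d * growth_d) * (growth_d * growth_d)) with (min_slope ^ K * min_slope ^ K) by (field; lra).
nra.
Qed.

(* Another letter also visits [b], and the images of distinct letters fill disjoint parts of it. *)
Lemma br_shrink n c b h h' : br n (n + K) c b h h' ->
  h (U (n + K) c) - h (L (n + K) c) <= (1 - free_ratio) * len n b.
Proof.
intros H. pose proof (br_level H) as [_ [Hc1 Hb]].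
assert (Hex : exists c', (c' < d)%nat /\ c' <> c).
{ destruct (Nat.eq_dec c 0); [exists 1%nat|exists 0%nat]; lia. }
destruct Hex as [c' [Hc' Hcc]].
destruct (Hvis n c' b Hc' Hb) as [h2 [h2' B]].
pose proof (br_image_len B) as [B1 _].
pose proof (len_window n b c' Hb Hc') as B2.
assert (Hn : (n <= n + K)%nat) by lia.
pose proof (indicator_conserved n (n + K) b Hn Hb) as E.
assert (I : forall a u v, (a < d)%nat -> dom n a u -> dom n a v -> u <= v ->
  indicator_id b a u <= indicator_id b a v) by (intros; apply indicator_id_le; auto).
pose proof (rsum_two_le (fun a => coc n (indicator_id b) (n + K) a (U (n + K) a)
   - coc n (indicator_id b) (n + K) a (L (n + K) a)) d c c') as S.
rewrite E in S.
assert (S' := S ltac:(intros a Ha; pose proof (len_pos (n + K) a Ha) as Hl; unfold len in Hl;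
   pose proof (coc_le n (indicator_id b) (n + K) a _ _ Hn Ha (L_dom _ _ Ha) (U_dom _ _ Ha) ltac:(lra) I); lra)
   Hc1 Hc' ltac:(auto)). simpl in S'.
pose proof (len_pos (n + K) c Hc1) as L1. pose proof (len_pos (n + K) c' Hc') as L2. unfold len in L1, L2.
pose proof (br_coc n (indicator_id b) _ _ _ _ _ _ _ I H (L_dom _ _ Hc1) (U_dom _ _ Hc1) ltac:(lra)) as D1.
pose proof (br_coc n (indicator_id b) _ _ _ _ _ _ _ I B (L_dom _ _ Hc') (U_dom _ _ Hc') ltac:(lra)) as D2.
unfold indicator_id at 1 2 in D1. unfold indicator_id at 1 2 in D2. rewrite Nat.eqb_refl in D1, D2.
assert (Hlast : free_ratio * len n b <= min_slope ^ K * len (n + K) c').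
{ pose proof free_ratio_pos. eapply Rle_trans; [apply Rmult_le_compat_l; [lra|exact B2]|].
  right. unfold free_ratio. pose proof min_slope_K_pos. pose proof growth_d_ge_2. field. lra. }
lra.
Qed.

(** The free share of length becomes a share of [T] at the cost of [exp (2 * V)], the distortion of
    the density of [T] along a branch. *)
Definition cell_ratio : R := 1 - free_ratio / exp (2 * V).

Lemma cell_ratio_bounds : 0 < cell_ratio < 1.
Proof.
unfold cell_ratio. pose proof free_ratio_pos. pose proof free_ratio_le.
pose proof V_nonneg. assert (E : 1 <= exp (2 * V)) by (apply exp_ge_1; lra).
assert (0 < free_ratio / exp (2 * V)) by (apply Rdiv_lt_0_compat; lra).
assert (free_ratio / exp (2 * V) <= free_ratio); [|lra].
apply (Rmult_le_reg_r (exp (2 * V))); [lra|]. field_simplify; [|lra]. nra.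
Qed.

Lemma br_T_density {n m b a g g' x y} : br n m b a g g' -> dom m b x -> dom m b y ->
  W n a (g x) * g' x <= exp (2 * V) * (W n a (g y) * g' y).
Proof.
intros H Hx Hy. pose proof (br_level H) as [_ [Hb Ha]].
pose proof (br_dom H Hx) as Hgx. pose proof (br_dom H Hy) as Hgy.
pose proof (proj2 (br_der H Hx)). pose proof (proj2 (br_der H Hy)).
pose proof (W_ge_1 n a _ Ha Hgx). pose proof (W_ge_1 n a _ Ha Hgy).
replace (exp (2 * V) * (W n a (g y) * g' y)) with ((exp V * W n a (g y)) * (exp V * g' y))
  by (replace (2 * V) with (V + V) by ring; rewrite exp_plus; ring).
apply Rmult_le_compat; try lra.
- eapply Rle_trans; [apply W_distortion with (x := g y); auto|].
  apply Rmult_le_compat_r; [lra|]. apply exp_le_compat, MTd_le_V; auto.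
- apply exp_ratio; auto. eapply Rle_trans; [apply (br_ln_distortion H Hx Hy)|].
  apply MTd_le_V; auto.
Qed.

(** The last window is split off. Its image misses a fixed share of the interval of level
    [n + j * K], on one side or on both, and bounded distortion turns this into a share of the
    [T]-size seen from level [n]. *)
Lemma br_T_decay n j : forall b a g g', br n (n + j * K) b a g g' ->
  T n a (g (U (n + j * K) b)) - T n a (g (L (n + j * K) b)) <= Ttot * cell_ratio ^ j.
Proof.
induction j as [|j IH]; intros c a f f' H.
- pose proof (br_level H) as [_ [Hb Ha]].
  rewrite pow_O, Rmult_1_r. eapply Rle_trans; [apply Rle_abs|]. apply Td_le; auto.
  + apply (br_dom H), U_dom; auto.
  + apply (br_dom H), L_dom; auto.
- replace (n + S j * K)%nat with (n + j * K + K)%nat in * by lia.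
  set (m := (n + j * K)%nat) in *.
  pose proof (br_level H) as [_ [Hc1 Ha]].
  destruct (br_decomp n m _ _ _ _ _ H) as [b [g [g' [h [h' [B1 [B2 [E _]]]]]]]]; [lia|lia|].
  rewrite !E. specialize (IH _ _ _ _ B1).
  pose proof (br_level B1) as [_ [Hb _]].
  pose proof (br_shrink _ _ _ _ _ B2) as S.
  pose proof (br_dom B2 (L_dom _ _ Hc1)) as Hu.
  pose proof (br_dom B2 (U_dom _ _ Hc1)) as Hv.
  assert (Huv : h (L (m + K) c) <= h (U (m + K) c)).
  { apply (br_le B2); auto using L_dom, U_dom. left; apply HLU; auto. }
  set (u := h (L (m + K) c)) in *. set (v := h (U (m + K) c)) in *.
  set (F := fun z => T n a (g z)). set (r := fun z => W n a (g z) * g' z).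
  assert (DF : forall z, dom m b z -> derivable_pt_lim F z (r z)).
  { intros z Hz. apply (derivable_pt_lim_comp g (T n a)).
    - apply (br_der B1 Hz).
    - apply T_der; auto. apply (br_dom B1 Hz). }
  assert (Pr : forall z, dom m b z -> 0 < r z).
  { intros z Hz. pose proof (W_ge_1 n a (g z) Ha (br_dom B1 Hz)).
    pose proof (proj2 (br_der B1 Hz)). apply Rmult_lt_0_compat; lra. }
  unfold dom in Hu, Hv.
  destruct (mean_value F r (L m b) u) as [z1 [I1 E1]]; [lra|intros; apply DF; unfold dom; lra|].
  destruct (mean_value F r v (U m b)) as [z2 [I2 E2]]; [lra|intros; apply DF; unfold dom; lra|].
  destruct (mean_value F r (L m b) (U m b)) as [z3 [I3 E3]]; [lra|intros; apply DF; unfold dom; lra|].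
  assert (J1 : dom m b z1) by (unfold dom; lra). assert (J2 : dom m b z2) by (unfold dom; lra).
  pose proof (br_T_density B1 I3 J1) as D1.
  pose proof (br_T_density B1 I3 J2) as D2.
  fold (r z1) (r z3) in D1. fold (r z2) (r z3) in D2.
  assert (P3 : 0 < r z3) by (apply Pr; auto).
  assert (A1 : r z3 * (u - L m b) <= exp (2 * V) * (F u - F (L m b))).
  { rewrite E1, <- Rmult_assoc. apply Rmult_le_compat_r; lra. }
  assert (A2 : r z3 * (U m b - v) <= exp (2 * V) * (F (U m b) - F v)).
  { rewrite E2, <- Rmult_assoc. apply Rmult_le_compat_r; lra. }
  assert (A3 : r z3 * (free_ratio * len m b) <= exp (2 * V) * ((F (U m b) - F (L m b)) - (F v - F u))).
  { apply Rle_trans with (r z3 * ((u - L m b) + (U m b - v))); [|lra].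
    apply Rmult_le_compat_l; [lra|]. unfold len in *. lra. }
  replace (r z3 * (free_ratio * len m b)) with (free_ratio * (F (U m b) - F (L m b))) in A3
    by (rewrite E3; unfold len; ring).
  assert (A4 : F v - F u <= cell_ratio * (F (U m b) - F (L m b))).
  { unfold cell_ratio. pose proof (exp_pos (2 * V)).
    apply (Rmult_le_reg_l (exp (2 * V))); auto. field_simplify; [|lra]. lra. }
  fold (F u) (F v). fold (F (U m b)) (F (L m b)) in IH. simpl.
  pose proof cell_ratio_bounds. apply Rle_trans with (cell_ratio * (Ttot * cell_ratio ^ j)); [|right; ring].
  eapply Rle_trans; [exact A4|]. apply Rmult_le_compat_l; lra.
Qed.

Lemma br_Td_decay n j b a g g' x y : br n (n + j * K) b a g g' ->
  dom (n + j * K) b x -> dom (n + j * K) b y -> Td n a (g x) (g y) <= (Ttot + 1) * cell_ratio ^ j.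
Proof.
intros H Hx Hy. pose proof (br_level H) as [_ [Hb Ha]].
pose proof (br_T_decay n j _ _ _ _ H) as D.
assert (A : forall z, dom (n + j * K) b z ->
  T n a (g (L (n + j * K) b)) <= T n a (g z) <= T n a (g (U (n + j * K) b))).
{ intros z Hz. pose proof (br_dom H Hz).
  pose proof (br_dom H (L_dom _ _ Hb)). pose proof (br_dom H (U_dom _ _ Hb)).
  split; apply T_le; auto; apply (br_le H); auto using L_dom, U_dom; apply Hz. }
pose proof (A x Hx). pose proof (A y Hy). pose proof cell_ratio_bounds.
assert (0 < cell_ratio ^ j) by (apply pow_lt; lra). unfold Td. apply Rabs_le. lra.
Qed.

Definition W_ratio : R := growth ^ K * exp V / min_slope ^ K.

(** Both weights are split at level [n - K]. The orbit of [y] visits every letter there with slope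
    at least [min_slope ^ K], while the orbit of [x] collects at most [growth ^ K] times the largest
    weight found there. *)
Lemma W_comparable n a b x y : (a < d)%nat -> (b < d)%nat -> dom n a x -> dom n b y ->
  W n a x <= W_ratio * W n b y.
Proof.
intros Ha Hb Hx Hy. pose proof min_slope_K_pos. pose proof min_slope_K_le_1. pose proof growth_K_ge_1.
pose proof (exp_ge_1 V V_nonneg). pose proof growth_ge_2.
pose proof (W_ge_1 n b y Hb Hy) as Wy.
destruct (Nat.le_gt_cases K n) as [Hn|Hn].
- replace n with (n - K + K)%nat in * by lia. set (m := (n - K)%nat) in *.
  assert (Eq : W_ratio * W (m + K) b y = exp V * W (m + K) b y / min_slope ^ K * growth ^ K)
    by (unfold W_ratio; field; lra).
  rewrite Eq. unfold W at 1. rewrite <- (wcoc_split m) by lia.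
  apply wcoc_window_upper; auto.
  + unfold Rdiv. apply Rmult_le_pos; [apply Rmult_le_pos; lra|]. left; apply Rinv_0_lt_compat; lra.
  + intros c u Hc1 Hu. destruct (Hvis m b c Hb Hc1) as [g [g' B]].
    pose proof (br_window_slope B Hy) as Sl.
    pose proof (br_dom B Hy) as Hg.
    assert (W m c (g y) * g' y <= W (m + K) b y).
    { unfold W at 2. rewrite <- (wcoc_split m) by lia. apply (br_wcoc m _ _ _ _ _ _ _); auto.
      intros a' u' Ha' Hu'. pose proof (W_ge_1 m a' u' Ha' Hu'). unfold W in *. lra. }
    assert (W m c u <= exp V * W m c (g y)).
    { eapply Rle_trans; [apply W_distortion with (x := g y); auto|].
      pose proof (W_ge_1 m c (g y) Hc1 Hg).
      apply Rmult_le_compat_r; [lra|]. apply exp_le_compat, MTd_le_V; auto. }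
    fold (W m c u). pose proof (W_ge_1 m c (g y) Hc1 Hg).
    apply (Rmult_le_reg_r (min_slope ^ K)); auto.
    replace (exp V * W (m + K) b y / min_slope ^ K * min_slope ^ K) with (exp V * W (m + K) b y) by (field; lra).
    apply Rle_trans with (exp V * W m c (g y) * min_slope ^ K).
    * apply Rmult_le_compat_r; lra.
    * rewrite Rmult_assoc. apply Rmult_le_compat_l; [lra|].
      apply Rle_trans with (W m c (g y) * g' y); auto. apply Rmult_le_compat_l; lra.
(* No full window precedes level [n], but then [W] is at most [growth ^ K] outright. *)
- assert (A : W n a x * growth ^ 0 <= 1 * growth ^ n).
  { apply wcoc_upper; auto; [lia|lra|intros; lra]. }
  assert (B : growth ^ n <= growth ^ K) by (apply Rle_pow; [lra|lia]).
  assert (C : growth ^ K <= W_ratio).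
  { unfold W_ratio. apply (Rmult_le_reg_r (min_slope ^ K)); auto.
    replace (growth ^ K * exp V / min_slope ^ K * min_slope ^ K) with (growth ^ K * exp V) by (field; lra).
    apply Rmult_le_compat_l; lra. }
  assert (0 <= W_ratio * (W n b y - 1)) by (apply Rmult_le_pos; lra).
  simpl in A. lra.
Qed.

(** The share of the total weight [W] that a visit to a prescribed letter carries at least. *)
Definition visit_prob : R := min_slope ^ K / (growth ^ K * W_ratio).

Lemma W_ratio_ge_1 : 1 <= W_ratio.
Proof.
unfold W_ratio. pose proof min_slope_K_pos. pose proof min_slope_K_le_1. pose proof growth_K_ge_1.
pose proof (exp_ge_1 V V_nonneg).
apply (Rmult_le_reg_r (min_slope ^ K)); auto.
replace (growth ^ K * exp V / min_slope ^ K * min_slope ^ K) with (growth ^ K * exp V) by (field; lra). nra.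
Qed.

Lemma visit_prob_bounds : 0 < visit_prob <= 1.
Proof.
unfold visit_prob. pose proof min_slope_K_pos. pose proof min_slope_K_le_1. pose proof growth_K_ge_1. pose proof W_ratio_ge_1.
assert (1 <= growth ^ K * W_ratio) by nra. split.
- apply Rdiv_lt_0_compat; lra.
- apply (Rmult_le_reg_r (growth ^ K * W_ratio)); [lra|].
  replace (min_slope ^ K / (growth ^ K * W_ratio) * (growth ^ K * W_ratio)) with (min_slope ^ K) by (field; lra). lra.
Qed.

Lemma visit_weight m c b g g' x : br m (m + K) c b g g' -> dom (m + K) c x ->
  visit_prob * W (m + K) c x <= W m b (g x) * g' x.
Proof.
intros B Hx. pose proof (br_level B) as [_ [Hc1 Hb]].
pose proof (br_window_slope B Hx) as Sl.
pose proof (br_dom B Hx) as Hg. pose proof (W_ge_1 m b (g x) Hb Hg).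
pose proof min_slope_K_pos. pose proof growth_K_ge_1. pose proof W_ratio_ge_1.
assert (A : W (m + K) c x <= W_ratio * W m b (g x) * growth ^ K).
{ unfold W at 1. rewrite <- (wcoc_split m) by lia. apply wcoc_window_upper; auto.
  - apply Rmult_le_pos; lra.
  - intros a u Ha Hu. apply W_comparable; auto. }
apply Rle_trans with (min_slope ^ K * W m b (g x)).
- unfold visit_prob. assert (0 < growth ^ K * W_ratio) by nra.
  apply (Rmult_le_reg_r (growth ^ K * W_ratio)); auto. field_simplify; [|lra].
  assert (W (m + K) c x * min_slope ^ K <= W_ratio * W m b (g x) * growth ^ K * min_slope ^ K) by (apply Rmult_le_compat_r; lra).
  lra.
- rewrite Rmult_comm. apply Rmult_le_compat_l; lra.
Qed.

(** * Decay of the oscillation of [psi] *)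

Definition osc_le (n : nat) (o : R) : Prop := forall a b u v, (a < d)%nat -> (b < d)%nat ->
  dom n a u -> dom n b v -> psi n a u - psi n b v <= o.

Lemma osc_sup n o : osc_le n o -> exists S, forall a u, (a < d)%nat -> dom n a u ->
  S - o <= psi n a u <= S.
Proof.
intros H.
destruct (completeness (fun y => exists a u, (a < d)%nat /\ dom n a u /\ y = psi n a u)) as [S [S1 S2]].
- exists M. intros y [a [u [Ha [Hu ->]]]]. apply psi_bound; auto.
- exists (psi n 0 (L n 0)), 0%nat, (L n 0). assert (0 < d)%nat by lia. auto using L_dom.
- exists S. intros a u Ha Hu. split; [|apply S1; exists a, u; auto].
  assert (S <= psi n a u + o); [|lra].
  apply S2. intros y [b [v [Hb [Hv ->]]]]. specialize (H b a v u Hb Ha Hv Hu). lra.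
Qed.

(* [s (S - psi n) W n], written linearly so that it propagates through [wcoc];
   the sign [s] serves upper and lower bounds of [psi] at once. *)
Definition gap (s S : R) (n b : nat) (x : R) : R := s * S * W n b x + - s * nonlin n b x.

Lemma gap_psi s S n b x : (b < d)%nat -> dom n b x ->
  gap s S n b x = s * (S - psi n b x) * W n b x.
Proof. intros Hb Hx. unfold gap. rewrite <- (psi_W n b x Hb Hx). ring. Qed.

Lemma gap_wcoc s S n m b x : (n <= m)%nat -> wcoc n (gap s S n) m b x = gap s S m b x.
Proof.
intros Hm. unfold gap. rewrite (wcoc_linear n (W n) (nonlin n)).
unfold W, nonlin. rewrite !wcoc_split by lia. auto.
Qed.

Lemma gap_nonneg s S n a u : (a < d)%nat -> dom n a u -> 0 <= s * (S - psi n a u) ->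
  0 <= gap s S n a u.
Proof.
intros Ha Hu H. rewrite gap_psi by auto. pose proof (W_ge_1 n a u Ha Hu). apply Rmult_le_pos; lra.
Qed.

Lemma psi_bound_later s S n m : (n <= m)%nat ->
  (forall a u, (a < d)%nat -> dom n a u -> 0 <= s * (S - psi n a u)) ->
  forall a u, (a < d)%nat -> dom m a u -> 0 <= s * (S - psi m a u).
Proof.
intros Hm H a u Ha Hu. pose proof (W_ge_1 m a u Ha Hu).
assert (0 <= s * (S - psi m a u) * W m a u).
{ rewrite <- gap_psi, <- (gap_wcoc s S n) by auto. apply wcoc_nonneg; auto.
  intros; apply gap_nonneg; auto. }
apply (Rmult_le_reg_r (W m a u)); lra.
Qed.

(** [S] is the supremum of [psi n]; [s = 1] encodes the bound from above by [S], and [s = -1] the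
    bound from below by [S - o]. Both survive averaging. *)
Lemma osc_later n m o : (n <= m)%nat -> osc_le n o -> exists S,
  forall s c, (s = 1 /\ c = S \/ s = -1 /\ c = S - o) ->
  (forall a u, (a < d)%nat -> dom n a u -> 0 <= s * (c - psi n a u)) /\
  (forall a u, (a < d)%nat -> dom m a u -> 0 <= s * (c - psi m a u)).
Proof.
intros Hm H. destruct (osc_sup n o H) as [S HS]. exists S. intros s c Hs.
assert (A : forall a u, (a < d)%nat -> dom n a u -> 0 <= s * (c - psi n a u)).
{ intros a u Ha Hu. specialize (HS a u Ha Hu). destruct Hs as [[-> ->]|[-> ->]]; lra. }
split; auto. apply (psi_bound_later s c n); auto.
Qed.

Lemma osc_mono n m o : (n <= m)%nat -> osc_le n o -> osc_le m o.
Proof.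
intros Hm H a b u v Ha Hb Hu Hv. destruct (osc_later n m o Hm H) as [S HS].
pose proof (proj2 (HS 1 S ltac:(auto)) a u Ha Hu).
pose proof (proj2 (HS (-1) (S - o) ltac:(auto)) b v Hb Hv). lra.
Qed.

Definition cell_modulus (j : nat) : R :=
  3 * M * exp (2 * V) * (2 * M + Hc) * ((Ttot + 1) * cell_ratio ^ j + Rpower ((Ttot + 1) * cell_ratio ^ j) nu).

(** The orbits of [x] and [y] run through the same level-[n] intervals, so close together that
    [psi n] varies by at most [cell_modulus j]. Once [S] is lowered by this amount on the side of
    [y], the two gaps compare term by term. The weights of the visits and the total weights cost a
    factor [exp V] each. *)
Lemma same_letter n j b x y S : (b < d)%nat ->
  dom (n + j * K) b x -> dom (n + j * K) b y ->
  (forall a u, (a < d)%nat -> dom n a u -> 0 <= 1 * (S - psi n a u)) ->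
  S - cell_modulus j - psi (n + j * K) b y <= exp (2 * V) * (S - psi (n + j * K) b x).
Proof.
intros Hb Hx Hy HS. set (m := (n + j * K)%nat) in *.
assert (Hm : (n <= m)%nat) by (unfold m; lia).
assert (A : wcoc n (gap 1 (S - cell_modulus j) n) m b y <=
  1 * exp (M * Td m b x y) * wcoc n (gap 1 S n) m b x).
{ apply wcoc_compare; auto; [lra| |].
  - intros; apply gap_nonneg; auto.
  - intros a g g' B. pose proof (br_level B) as [_ [_ Ha]].
    pose proof (br_dom B Hx) as Gx. pose proof (br_dom B Hy) as Gy.
    rewrite !gap_psi, !Rmult_1_l by auto.
    pose proof (W_distortion n a _ _ Ha Gx Gy). pose proof (W_ge_1 n a _ Ha Gy).
    specialize (HS a _ Ha Gx). pose proof cell_ratio_bounds. pose proof Ttot_nonneg.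
    assert (Q : psi n a (g x) - psi n a (g y) <= cell_modulus j).
    { unfold cell_modulus. apply psi_modulus; auto.
      - apply Rmult_lt_0_compat; [lra|apply pow_lt; lra].
      - apply (br_Td_decay n j b a g g' y x B); auto. }
    apply Rle_trans with ((S - psi n a (g x)) * W n a (g y)).
    + apply Rmult_le_compat_r; lra.
    + rewrite (Rmult_comm (exp _)), Rmult_assoc. apply Rmult_le_compat_l; lra. }
rewrite !gap_wcoc, !gap_psi, !Rmult_1_l in A by auto.
pose proof (W_distortion m b y x Hb Hy Hx) as D. rewrite Td_sym in D.
pose proof (W_ge_1 m b x Hb Hx). pose proof (W_ge_1 m b y Hb Hy).
pose proof (psi_bound_later 1 S n m Hm HS b x Hb Hx).
assert (E : exp (M * Td m b x y) <= exp V) by (apply exp_le_compat, MTd_le_V; auto).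
pose proof (exp_pos (M * Td m b x y)). set (e := exp (M * Td m b x y)) in *.
apply (Rmult_le_reg_r (W m b y)); [lra|].
eapply Rle_trans; [exact A|].
replace (2 * V) with (V + V) by ring. rewrite exp_plus.
replace (e * ((S - psi m b x) * W m b x)) with ((S - psi m b x) * (e * W m b x)) by ring.
replace (exp V * exp V * (S - psi m b x) * W m b y) with
  ((S - psi m b x) * (exp V * (exp V * W m b y))) by ring.
apply Rmult_le_compat_l; [lra|]. apply Rmult_le_compat; try lra.
eapply Rle_trans; [exact D|]. apply Rmult_le_compat_r; lra.
Qed.

Definition letter_ratio : R := / exp (2 * V).

Lemma letter_ratio_bounds : 0 < letter_ratio <= 1.
Proof.
unfold letter_ratio. pose proof V_nonneg. pose proof (exp_ge_1 (2 * V)) as E.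
split; [apply Rinv_0_lt_compat; lra|].
rewrite <- Rinv_1. apply Rinv_le_contravar; lra.
Qed.

Lemma cell_modulus_pos j : 0 < cell_modulus j.
Proof.
unfold cell_modulus. pose proof (exp_pos (2 * V)). pose proof cell_ratio_bounds. pose proof Ttot_nonneg.
assert (0 < (Ttot + 1) * cell_ratio ^ j) by (apply Rmult_lt_0_compat; [lra|apply pow_lt; lra]).
assert (0 < Rpower ((Ttot + 1) * cell_ratio ^ j) nu) by apply exp_pos.
repeat apply Rmult_lt_0_compat; lra.
Qed.

(** By [same_letter] the gap below [S] at [x] is at least a fixed fraction of the gap at [y], up to
    the modulus: [psi] cannot be near the top at [x] and near the bottom at [y]. *)
Lemma osc_letter n j o b x y : osc_le n o -> (b < d)%nat ->
  dom (n + j * K) b x -> dom (n + j * K) b y ->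
  psi (n + j * K) b x - psi (n + j * K) b y <= (1 - letter_ratio) * o + cell_modulus j.
Proof.
intros H Hb Hx Hy. set (m := (n + j * K)%nat) in *.
destruct (osc_later n m o ltac:(unfold m; lia) H) as [S HS].
pose proof (proj2 (HS (-1) (S - o) ltac:(auto)) b y Hb Hy) as Hlow.
pose proof (same_letter n j b x y S Hb Hx Hy (proj1 (HS 1 S ltac:(auto)))) as A.
fold m in A. pose proof letter_ratio_bounds. pose proof (cell_modulus_pos j).
assert (A' : letter_ratio * (S - cell_modulus j - psi m b y) <= S - psi m b x).
{ unfold letter_ratio. pose proof (exp_pos (2 * V)). apply (Rmult_le_reg_l (exp (2 * V))); auto.
  rewrite <- Rmult_assoc, Rinv_r by lra. lra. }
assert (0 <= (1 - letter_ratio) * (o - (S - psi m b y))) by (apply Rmult_le_pos; lra).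
assert (0 <= (1 - letter_ratio) * cell_modulus j) by (apply Rmult_le_pos; lra). lra.
Qed.

Lemma visit_gap s S m c b g g' x : br m (m + K) c b g g' -> dom (m + K) c x ->
  (forall a u, (a < d)%nat -> dom m a u -> 0 <= s * (S - psi m a u)) ->
  visit_prob * (s * (S - psi m b (g x))) <= s * (S - psi (m + K) c x).
Proof.
intros B Hx HS. pose proof (br_level B) as [_ [Hc1 Hb]]. pose proof (br_dom B Hx) as Hg.
pose proof (visit_weight _ _ _ _ _ _ B Hx). pose proof (W_ge_1 (m + K) c x Hc1 Hx).
assert (A : gap s S m b (g x) * g' x <= gap s S (m + K) c x).
{ rewrite <- (gap_wcoc s S m (m + K)) by lia. apply (br_wcoc m (gap s S m) _ _ _ _ _ _); auto.
  intros; apply gap_nonneg; auto. }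
rewrite !gap_psi in A by auto. specialize (HS b _ Hb Hg).
apply (Rmult_le_reg_r (W (m + K) c x)); [lra|]. eapply Rle_trans; [|exact A].
rewrite (Rmult_comm visit_prob), !(Rmult_assoc (s * _)). apply Rmult_le_compat_l; lra.
Qed.

(** Letter 0 serves as a common meeting place: both orbits spend there a share of at least
    [visit_prob] of their weight, and inside one letter [osc_letter] has already improved the
    oscillation. *)
Lemma osc_contract n j o : osc_le n o ->
  osc_le (n + j * K + K) ((1 - visit_prob * letter_ratio) * o + visit_prob * cell_modulus j).
Proof.
intros H a b u v Ha Hb Hu Hv. set (m := (n + j * K)%nat) in *.
destruct (osc_later n m o ltac:(unfold m; lia) H) as [S HS].
assert (D0 : (0 < d)%nat) by lia.
destruct (Hvis m a 0%nat Ha D0) as [g [g' B]]. destruct (Hvis m b 0%nat Hb D0) as [h [h' B']].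
pose proof (visit_gap 1 S m a 0 g g' u B Hu (proj2 (HS 1 S ltac:(auto)))) as X1.
pose proof (visit_gap (-1) (S - o) m b 0 h h' v B' Hv (proj2 (HS (-1) (S - o) ltac:(auto)))) as X2.
pose proof (osc_letter n j o 0 (g u) (h v) H D0 (br_dom B Hu) (br_dom B' Hv)) as X3.
fold m in X3. pose proof visit_prob_bounds as Hcw.
apply Rmult_le_compat_l with (r := visit_prob) in X3; [|lra]. lra.
Qed.

Lemma cell_modulus_decay : exists C r, 0 < C /\ 0 < r < 1 /\ forall j, cell_modulus j <= C * r ^ j.
Proof.
pose proof cell_ratio_bounds as Hmu. pose proof Ttot_nonneg. pose proof (exp_pos (2 * V)).
set (A := Ttot + 1). set (s := Rpower cell_ratio nu).
assert (Hs : 0 < s < 1).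
{ split; [apply exp_pos|]. unfold s, Rpower. rewrite <- exp_0. apply exp_increasing.
  assert (ln cell_ratio < 0) by (rewrite <- ln_1; apply ln_increasing; lra). nra. }
exists (3 * M * exp (2 * V) * (2 * M + Hc) * (A + Rpower A nu)), (Rmax cell_ratio s).
assert (0 < Rpower A nu) by apply exp_pos. assert (0 < A) by (unfold A; lra).
assert (HC : 0 < 3 * M * exp (2 * V) * (2 * M + Hc)) by (repeat apply Rmult_lt_0_compat; lra).
pose proof (Rmax_l cell_ratio s). pose proof (Rmax_r cell_ratio s).
split; [|split].
- apply Rmult_lt_0_compat; lra.
- split; [lra|]. apply Rmax_lub_lt; lra.
- intros j. unfold cell_modulus. fold A. rewrite (Rmult_assoc _ (A + Rpower A nu)).
  apply Rmult_le_compat_l; [lra|].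
  assert (Hj : 0 < cell_ratio ^ j) by (apply pow_lt; lra).
  assert (E : Rpower (A * cell_ratio ^ j) nu = Rpower A nu * s ^ j).
  { rewrite <- Rpower_mult_distr by auto. f_equal.
    rewrite <- Rpower_pow by lra. unfold s. rewrite <- Rpower_pow by apply exp_pos.
    rewrite !Rpower_mult. f_equal. ring. }
  rewrite E, Rmult_plus_distr_r. apply Rplus_le_compat; apply Rmult_le_compat_l; try lra;
  apply pow_incr; lra.
Qed.

(* Step [i] lets [i + 1] windows pass, so that the modulus term is already of
   the order of the oscillation; [K i^2] levels give a factor [rho^i]. *)
Lemma osc_quadratic : exists B rho, 0 < B /\ 0 < rho < 1 /\
  forall i, osc_le (K * (i * i)) (B * rho ^ i).
Proof.
destruct cell_modulus_decay as [C [r [HC [Hr Hmd]]]].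
pose proof visit_prob_bounds. pose proof letter_ratio_bounds.
assert (Hct : 0 < visit_prob * letter_ratio <= 1).
{ split; [apply Rmult_lt_0_compat; lra|]. nra. }
set (rho := Rmax r (1 - visit_prob * letter_ratio / 2)).
pose proof (Rmax_l r (1 - visit_prob * letter_ratio / 2)) as R1. pose proof (Rmax_r r (1 - visit_prob * letter_ratio / 2)) as R2.
fold rho in R1, R2.
assert (Hrho : 0 < rho < 1) by (split; [lra|]; unfold rho; apply Rmax_lub_lt; lra).
(* [2 * M] bounds the oscillation at level 0. The other term makes the modulus error at most half of
   the gain [visit_prob * letter_ratio], and [rho] retains the other half. *)
set (B := 2 * M + 2 * C / letter_ratio).
assert (HCt : 0 < 2 * C / letter_ratio) by (apply Rdiv_lt_0_compat; lra).
assert (HB : C <= letter_ratio / 2 * B).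
{ unfold B. assert (letter_ratio / 2 * (2 * C / letter_ratio) = C) by (field; lra).
  assert (0 <= letter_ratio / 2 * (2 * M)) by (apply Rmult_le_pos; lra). lra. }
assert (HBp : 0 < B) by (unfold B; lra).
exists B, rho. split; [auto|split; auto].
induction i as [|i IH].
- rewrite Nat.mul_0_l, Nat.mul_0_r, pow_O, Rmult_1_r. intros a b u v Ha Hb Hu Hv.
  pose proof (psi_bound 0 a u Ha Hu). pose proof (psi_bound 0 b v Hb Hv). unfold B. lra.
- apply osc_mono with (K * (i * i) + i * K + K)%nat; [nia|].
  intros a b u v Ha Hb Hu Hv.
  eapply Rle_trans; [apply (osc_contract _ i _ IH a b u v Ha Hb Hu Hv)|].
  assert (P : 0 < rho ^ i) by (apply pow_lt; lra).
  assert (Q : cell_modulus i <= C * rho ^ i).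
  { eapply Rle_trans; [apply Hmd|]. apply Rmult_le_compat_l; [lra|]. apply pow_incr; lra. }
  assert (Q2 : visit_prob * cell_modulus i <= visit_prob * (letter_ratio / 2 * B * rho ^ i)).
  { apply Rmult_le_compat_l; [lra|]. eapply Rle_trans; [exact Q|]. apply Rmult_le_compat_r; lra. }
  simpl. assert (0 <= (rho - (1 - visit_prob * letter_ratio / 2)) * (B * rho ^ i)); [|lra].
  apply Rmult_le_pos; [lra|]. apply Rmult_le_pos; lra.
Qed.

Lemma square_bracket n : exists i, (K * (i * i) <= n < K * (S i * S i))%nat.
Proof.
induction n as [|n [i Hi]].
- exists 0%nat. nia.
- destruct (Nat.eq_dec (S n) (K * (S i * S i))) as [E|E].
  + exists (S i). nia.
  + exists i. lia.
Qed.

Lemma osc_decay : exists C lam, 0 < C /\ 0 < lam < 1 /\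
  forall n, osc_le n (C * Rpower lam (sqrt (INR n))).
Proof.
destruct osc_quadratic as [B [rho [HB [Hrho H]]]].
assert (HK' : 1 <= INR K) by (apply (le_INR 1); auto).
assert (Hln : ln rho < 0) by (rewrite <- ln_1; apply ln_increasing; lra).
(* From [n < K * (i + 1)^2] follows [sqrt n <= K * (i + 1)], which gives the exponent [/ INR K]; the
   factor [/ rho] pays for passing from [i] to [i + 1]. *)
exists (B / rho), (Rpower rho (/ INR K)). split; [|split].
- apply Rdiv_lt_0_compat; lra.
- split; [apply exp_pos|]. unfold Rpower. rewrite <- exp_0. apply exp_increasing.
  assert (0 < / INR K) by (apply Rinv_0_lt_compat; lra). nra.
- intros n. destruct (square_bracket n) as [i [H1 H2]].
  apply (osc_mono _ _ _ H1). intros a b u v Ha Hb Hu Hv.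
  eapply Rle_trans; [apply (H i a b u v Ha Hb Hu Hv)|].
  replace (B * rho ^ i) with (B / rho * rho ^ S i) by (simpl; field; lra).
  apply Rmult_le_compat_l; [left; apply Rdiv_lt_0_compat; lra|].
  rewrite Rpower_mult, <- Rpower_pow by lra. unfold Rpower. apply exp_le_compat.
  assert (Sq : sqrt (INR n) <= INR K * INR (S i)).
  { rewrite <- (sqrt_square (INR K * INR (S i))) by (apply Rmult_le_pos; [lra|apply pos_INR]).
    apply sqrt_le_1_alt. rewrite <- !mult_INR. apply le_INR. nia. }
  assert (/ INR K * sqrt (INR n) <= INR (S i)).
  { apply (Rmult_le_reg_l (INR K)); [lra|]. rewrite <- Rmult_assoc, Rinv_r by lra. lra. }
  nra.
Qed.

(** * Vanishing mean nonlinearity *)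

Context (Hzero : rsum (fun b => ln (g1 b (U 0 b)) - ln (g1 b (L 0 b))) d = 0).

Lemma lnG1_sum_zero n : rsum (fun b => lnG1 n b (U n b) - lnG1 n b (L n b)) d = 0.
Proof.
rewrite <- Hzero. rewrite <- (coc_conserved 0 (fun b x => ln (g1 b x)) n) by lia.
apply rsum_ext. intros b Hb. rewrite !lnG1_coc; auto using L_dom, U_dom.
Qed.

(* The total variation of [ln G1] would not vanish if [psi n] had a constant sign. *)
Lemma psi_le_osc n o b x : osc_le n o -> (b < d)%nat -> dom n b x -> Rabs (psi n b x) <= o.
Proof.
intros H Hb Hx. pose proof (lnG1_sum_zero n) as Z.
assert (MV : forall a, (a < d)%nat -> exists c, dom n a c /\
  lnG1 n a (U n a) - lnG1 n a (L n a) = psi n a c * (W n a c * len n a)).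
{ intros a Ha. pose proof (len_pos n a Ha) as Hl. unfold len in *.
  destruct (mean_value (lnG1 n a) (nonlin n a) (L n a) (U n a)) as [c [Ic E]]; [lra| |].
  - intros c Ic. apply lnG1_der; auto.
  - exists c. split; [exact Ic|]. rewrite E, <- (psi_W n a c Ha Ic). ring. }
assert (Pc : forall a c, (a < d)%nat -> dom n a c -> 0 < W n a c * len n a).
{ intros a c Ha Ic. pose proof (W_ge_1 n a c Ha Ic). pose proof (len_pos n a Ha).
  apply Rmult_lt_0_compat; lra. }
apply Rabs_le. split.
- destruct (Rle_dec (- o) (psi n b x)) as [|Hn]; auto. exfalso.
  assert (A : forall a, (a < d)%nat -> 0 < - (lnG1 n a (U n a) - lnG1 n a (L n a))).
  { intros a Ha. destruct (MV a Ha) as [c [Ic ->]]. specialize (H a b c x Ha Hb Ic Hx).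
    specialize (Pc a c Ha Ic).
    assert (0 < (- psi n a c) * (W n a c * len n a)) by (apply Rmult_lt_0_compat; lra). lra. }
  pose proof (rsum_term_le (fun a => 0 - (lnG1 n a (U n a) - lnG1 n a (L n a))) d b) as S.
  rewrite (rsum_minus (fun _ => 0)), rsum_const, Z in S. specialize (A b Hb) as Ab.
  assert (S' := S ltac:(intros a Ha; specialize (A a Ha); lra) Hb). simpl in S'. lra.
- destruct (Rle_dec (psi n b x) o) as [|Hn]; auto. exfalso.
  assert (A : forall a, (a < d)%nat -> 0 < lnG1 n a (U n a) - lnG1 n a (L n a)).
  { intros a Ha. destruct (MV a Ha) as [c [Ic ->]]. specialize (H b a x c Hb Ha Hx Ic).
    specialize (Pc a c Ha Ic). apply Rmult_lt_0_compat; lra. }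
  pose proof (rsum_term_le (fun a => lnG1 n a (U n a) - lnG1 n a (L n a)) d b) as S.
  rewrite Z in S. specialize (A b Hb) as Ab.
  assert (S' := S ltac:(intros a Ha; specialize (A a Ha); lra) Hb). simpl in S'. lra.
Qed.

(** [W] times the length of the interval is, up to distortion [exp V], an increment of [T], hence at
    most [exp V * Ttot]; the decay comes from [psi]. Adding 1 to [Ttot] keeps the constant
    positive. *)
Lemma nonlinearity_decay : exists C lam, 0 < C /\ 0 < lam < 1 /\
  forall n b x, (b < d)%nat -> dom n b x ->
    Rabs (nonlin n b x) * (U n b - L n b) <= C * Rpower lam (sqrt (INR n)).
Proof.
destruct osc_decay as [C [lam [HC [Hl H]]]].
pose proof Ttot_nonneg. pose proof (exp_pos V).
exists (C * (exp V * (Ttot + 1))), lam. split; [|split; auto].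
{ repeat apply Rmult_lt_0_compat; lra. }
intros n b x Hb Hx. pose proof (psi_le_osc n _ b x (H n) Hb Hx) as P.
pose proof (W_ge_1 n b x Hb Hx) as Wx.
rewrite <- (psi_W n b x Hb Hx), Rabs_mult, (Rabs_right (W n b x)) by lra.
assert (HT : W n b x * (U n b - L n b) <= exp V * (Ttot + 1)).
{ pose proof (len_pos n b Hb) as Hlen. unfold len in Hlen.
  destruct (mean_value (T n b) (W n b) (L n b) (U n b)) as [c [Ic E]]; [lra| |].
  { intros c Ic. apply T_der; auto. }
  pose proof (Td_le n b _ _ Hb (U_dom n b Hb) (L_dom n b Hb)) as B. unfold Td in B.
  unabs B. rewrite E in B.
  assert (D : W n b x <= exp V * W n b c).
  { eapply Rle_trans; [apply W_distortion with (x := c); auto|].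
    pose proof (W_ge_1 n b c Hb Ic).
    apply Rmult_le_compat_r; [lra|]. apply exp_le_compat, MTd_le_V; auto. }
  apply Rle_trans with (exp V * W n b c * (U n b - L n b)).
  - apply Rmult_le_compat_r; lra.
  - rewrite Rmult_assoc. apply Rmult_le_compat_l; lra. }
set (e := Rpower lam (sqrt (INR n))) in *.
replace (C * (exp V * (Ttot + 1)) * e) with (C * e * (exp V * (Ttot + 1))) by ring.
rewrite Rmult_assoc. apply Rmult_le_compat; auto; [apply Rabs_pos|].
pose proof (len_pos n b Hb) as Hlen. unfold len in Hlen. apply Rmult_le_pos; lra.
Qed.

End Renormalization.

(** * One Rauzy-Veech step *)

Section Tiling.
Context (d : nat) (l r : nat -> R) (rk : nat -> nat) (i0 i1 : R)
  (Hin : forall a, (a < d)%nat -> i0 <= l a /\ l a < r a /\ r a <= i1)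
  (Hcov : forall x, i0 <= x < i1 -> exists a, (a < d)%nat /\ l a <= x < r a)
  (Hrk : ranking d rk)
  (Hord : forall a b, (a < d)%nat -> (b < d)%nat -> (rk a < rk b)%nat -> r a <= l b).

(** The section is applied twice at each level: to the intervals with the ranks [pi0], and to their
    images with the ranks [pi1]. *)
Lemma tiling_order a b : (a < d)%nat -> (b < d)%nat -> l a < l b -> (rk a < rk b)%nat.
Proof.
intros Ha Hb H. destruct (Nat.lt_trichotomy (rk a) (rk b)) as [|[E|E]]; auto; exfalso.
- assert (a = b) by (apply (proj2 Hrk); auto). subst b. lra.
- specialize (Hord b a Hb Ha E). specialize (Hin b Hb). lra.
Qed.

Lemma tiling_left_inj a b : (a < d)%nat -> (b < d)%nat -> l a = l b -> a = b.
Proof.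
intros Ha Hb H. destruct (Nat.lt_trichotomy (rk a) (rk b)) as [E|[E|E]].
- specialize (Hord a b Ha Hb E). specialize (Hin a Ha). lra.
- apply (proj2 Hrk); auto.
- specialize (Hord b a Hb Ha E). specialize (Hin b Hb). lra.
Qed.

Lemma tiling_adjacent a b : (a < d)%nat -> (b < d)%nat -> rk b = (rk a + 1)%nat -> r a = l b.
Proof.
intros Ha Hb E. pose proof (Hord a b Ha Hb ltac:(lia)) as H.
destruct (Rle_lt_or_eq_dec _ _ H) as [H'|H']; auto. exfalso.
pose proof (Hin a Ha). pose proof (Hin b Hb).
destruct (Hcov (r a)) as [c [Hc I]]; [lra|]. pose proof (Hin c Hc).
destruct (Nat.lt_trichotomy (rk c) (rk a)) as [F|[F|F]].
- specialize (Hord c a Hc Ha F). lra.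
- assert (c = a) by (apply (proj2 Hrk); auto). subst c. lra.
- destruct (Nat.eq_dec (rk c) (rk b)) as [e|e].
  + assert (c = b) by (apply (proj2 Hrk); auto). subst c. lra.
  + specialize (Hord b c Hb Hc ltac:(lia)). lra.
Qed.

Lemma tiling_first a : (a < d)%nat -> rk a = 1%nat -> l a = i0.
Proof.
intros Ha E. pose proof (Hin a Ha) as [H _].
destruct (Rle_lt_or_eq_dec _ _ H) as [H'|H']; auto. exfalso.
pose proof (Hin a Ha). destruct (Hcov i0) as [c [Hc I]]; [lra|].
destruct (Nat.eq_dec (rk c) (rk a)) as [e|e].
- assert (c = a) by (apply (proj2 Hrk); auto). subst c. lra.
- pose proof (proj1 Hrk c Hc). specialize (Hord a c Ha Hc ltac:(lia)). lra.
Qed.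

Lemma tiling_last a : (a < d)%nat -> rk a = d -> r a = i1.
Proof.
intros Ha E. pose proof (Hin a Ha) as [_ [_ H]].
destruct (Rle_lt_or_eq_dec _ _ H) as [H'|H']; auto. exfalso.
pose proof (Hin a Ha). destruct (Hcov (r a)) as [c [Hc I]]; [lra|].
destruct (Nat.eq_dec (rk c) (rk a)) as [e|e].
- assert (c = a) by (apply (proj2 Hrk); auto). subst c. lra.
- pose proof (proj1 Hrk c Hc). specialize (Hord c a Hc Ha ltac:(lia)). pose proof (Hin c Hc). lra.
Qed.

Lemma tiling_disjoint a b x : (a < d)%nat -> (b < d)%nat ->
  l a <= x < r a -> l b <= x < r b -> a = b.
Proof.
intros Ha Hb H H'. destruct (Nat.lt_trichotomy (rk a) (rk b)) as [E|[E|E]].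
- specialize (Hord a b Ha Hb E). lra.
- apply (proj2 Hrk); auto.
- specialize (Hord b a Hb Ha E). lra.
Qed.

Lemma tiling_total : (1 <= d)%nat -> rsum (fun a => r a - l a) d = i1 - i0.
Proof.
intros Hd.
assert (A : forall j a, (a < d)%nat -> rk a = S j ->
  rsum (fun a => if Nat.leb (rk a) (S j) then r a - l a else 0) d = r a - i0).
{ induction j as [|j IH]; intros a Ha E.
  - rewrite <- (tiling_first a Ha E). rewrite <- (rsum_delta a (r a - l a) d Ha).
    apply rsum_ext. intros b Hb. pose proof (proj1 Hrk b Hb).
    destruct (Nat.eqb_spec b a) as [->|Hn].
    + rewrite E. auto.
    + destruct (Nat.leb_spec (rk b) 1); auto. exfalso. apply Hn, (proj2 Hrk); auto. lia.
  - pose proof (proj1 Hrk a Ha). destruct (ranking_surj d rk (S j) Hrk) as [c [Hc Ec]]; [lia|].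
    specialize (IH c Hc Ec). rewrite (tiling_adjacent c a Hc Ha ltac:(lia)) in IH.
    assert (D : rsum (fun b => (if Nat.leb (rk b) (S (S j)) then r b - l b else 0) -
       (if Nat.leb (rk b) (S j) then r b - l b else 0)) d = r a - l a).
    { rewrite <- (rsum_delta a (r a - l a) d Ha). apply rsum_ext. intros b Hb.
      destruct (Nat.eqb_spec b a) as [->|Hn].
      - destruct (Nat.leb_spec (rk a) (S (S j))); destruct (Nat.leb_spec (rk a) (S j)); try lia. ring.
      - assert (rk b <> S (S j)) by (intros e; apply Hn, (proj2 Hrk); auto; lia).
        destruct (Nat.leb_spec (rk b) (S (S j))); destruct (Nat.leb_spec (rk b) (S j)); try lia; ring. }
    rewrite rsum_minus, IH in D. lra. }
destruct (ranking_surj d rk d Hrk) as [a [Ha E]]; [lia|].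
rewrite <- (tiling_last a Ha E). rewrite <- (A (d - 1)%nat a Ha) by lia.
apply rsum_ext. intros b Hb. pose proof (proj1 Hrk b Hb).
destruct (Nat.leb_spec (rk b) (S (d - 1))); auto. lia.
Qed.

End Tiling.

Lemma half_open_eq l r l' r' : l < r -> l' < r' ->
  (forall x, l <= x < r <-> l' <= x < r') -> l = l' /\ r = r'.
Proof.
intros H H' E.
assert (A1 : l' <= l < r') by (apply E; lra). assert (A2 : l <= l' < r) by (apply E; lra).
split; [lra|]. destruct (Rtotal_order r r') as [F|[F|F]]; auto; exfalso.
- assert (l <= Rmax l r < r); [|pose proof (Rmax_r l r); lra].
  apply E. rewrite Rmax_right; lra.
- assert (l' <= Rmax l' r' < r'); [|pose proof (Rmax_r l' r'); lra].
  apply E. rewrite Rmax_right; lra.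
Qed.

(* [E a] extends the branch of [g] on the interval of [a] to its closure. *)
Definition branch_ext (d : nat) (g : giem) (E : nat -> R -> R) : Prop :=
  forall a, (a < d)%nat ->
    (forall x, lft g a <= x < rgt g a -> E a x = fmap g x) /\
    (forall x y, lft g a <= x -> x < y -> y <= rgt g a -> E a x < E a y) /\
    (forall x, lft g a <= x <= rgt g a -> continuity_pt (E a) x).

(** * Closed branches and the two tilings of a level *)

Section Level.
Context (d : nat) (g : giem) (E : nat -> R -> R)
  (Hg : is_giem d g) (HE : branch_ext d g E).

Lemma giem_in a : (a < d)%nat -> il g <= lft g a /\ lft g a < rgt g a /\ rgt g a <= ir g.
Proof. intros Ha. apply Hg; auto. Qed.

Lemma giem_cover x : il g <= x < ir g -> exists a, (a < d)%nat /\ lft g a <= x < rgt g a.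
Proof. intros Hx. apply Hg; auto. Qed.

Lemma giem_ranking0 : ranking d (pi0 g).
Proof.
destruct Hg as [_ [_ [_ [_ [_ [_ [_ [_ [H1 [H2 _]]]]]]]]]]. split; auto. intros a Ha. apply H1; auto.
Qed.

Lemma giem_ranking1 : ranking d (pi1 g).
Proof.
destruct Hg as [_ [_ [_ [_ [_ [_ [_ [_ [H1 [_ [H2 _]]]]]]]]]]]. split; auto. intros a Ha. apply H1; auto.
Qed.

Lemma giem_order0 a b : (a < d)%nat -> (b < d)%nat -> (pi0 g a < pi0 g b)%nat -> rgt g a <= lft g b.
Proof.
intros Ha Hb H.
destruct Hg as [_ [_ [_ [_ [_ [_ [_ [_ [_ [_ [_ [H1 _]]]]]]]]]]]].
destruct (H1 a b Ha Hb) as [[_ H2] _]. specialize (H2 H).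
pose proof (giem_in a Ha). pose proof (giem_in b Hb).
destruct (Rle_dec (rgt g a) (lft g b)) as [|Hn]; auto. exfalso.
(* If the intervals overlapped, the larger left end would belong to both and precede the left end of
   [b]. *)
assert (Rmax (lft g a) (lft g b) < lft g b); [|pose proof (Rmax_r (lft g a) (lft g b)); lra].
apply H2; unfold in_part; [|lra]. split; [apply Rmax_l|]. apply Rmax_lub_lt; lra.
Qed.

Lemma E_mono a x y : (a < d)%nat -> lft g a <= x -> x <= y -> y <= rgt g a -> E a x <= E a y.
Proof.
intros Ha Hx [H|H] Hy; [left; apply (HE a Ha); auto|subst; lra].
Qed.

Lemma image_iff a y : (a < d)%nat ->
  (image_part g a y <-> E a (lft g a) <= y < E a (rgt g a)).
Proof.
intros Ha. destruct (HE a Ha) as [H1 [H2 H3]]. pose proof (giem_in a Ha).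
split.
- intros [x [Hx <-]]. unfold in_part in Hx. rewrite <- H1 by auto.
  split; [apply E_mono; auto; lra|apply H2; lra].
- intros [Hy Hy']. destruct (Req_dec (E a (lft g a)) y) as [e|e].
  + exists (lft g a). split; [split; lra|]. rewrite <- H1; auto; lra.
  + destruct (IVT_interv (fun x => E a x - y) (lft g a) (rgt g a)) as [z [Hz Ez]]; try lra.
    * intros x Hx. apply (continuity_pt_minus (E a) (fct_cte y)); auto.
      apply continuity_pt_const. intros u v; auto.
    * assert (z <> rgt g a) by (intros e'; subst z; lra).
      exists z. split; [split; lra|]. rewrite <- H1 by lra. lra.
Qed.

Lemma image_lub a s : (a < d)%nat -> is_lub (image_part g a) s -> s = E a (rgt g a).
Proof.
intros Ha [H1 H2]. pose proof (giem_in a Ha).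
assert (I : E a (lft g a) < E a (rgt g a)) by (apply (HE a Ha); lra).
apply Rle_antisym.
- apply H2. intros y Hy. apply image_iff in Hy; auto. lra.
- destruct (Rle_dec (E a (rgt g a)) s) as [|Hn]; auto. exfalso.
  assert (E a (lft g a) <= s) by (apply H1; apply image_iff; auto; lra).
  assert ((s + E a (rgt g a)) / 2 <= s); [|lra].
  apply H1, image_iff; auto. lra.
Qed.

Lemma giem_image_in a : (a < d)%nat ->
  il g <= E a (lft g a) /\ E a (lft g a) < E a (rgt g a) /\ E a (rgt g a) <= ir g.
Proof.
intros Ha. pose proof (giem_in a Ha).
assert (I : E a (lft g a) < E a (rgt g a)) by (apply (HE a Ha); lra).
assert (A : forall y, E a (lft g a) <= y < E a (rgt g a) -> il g <= y < ir g).
{ intros y Hy. apply image_iff in Hy; auto. destruct Hy as [x [Hx <-]].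
  destruct Hg as [_ [_ [_ [_ [H1 _]]]]]. unfold in_part in Hx. apply H1. unfold in_I. lra. }
pose proof (A (E a (lft g a)) ltac:(lra)). repeat split; try lra.
destruct (Rle_dec (E a (rgt g a)) (ir g)) as [|Hn]; auto. exfalso.
specialize (A (ir g) ltac:(lra)). lra.
Qed.

Lemma giem_image_cover y : il g <= y < ir g ->
  exists a, (a < d)%nat /\ E a (lft g a) <= y < E a (rgt g a).
Proof.
intros Hy. destruct Hg as [_ [_ [_ [_ [_ [_ [H1 _]]]]]]].
destruct (H1 y Hy) as [x [Hx <-]]. destruct (giem_cover x Hx) as [a [Ha I]].
exists a. split; auto. apply image_iff; auto. exists x. split; auto.
Qed.

Lemma giem_order1 a b : (a < d)%nat -> (b < d)%nat -> (pi1 g a < pi1 g b)%nat ->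
  E a (rgt g a) <= E b (lft g b).
Proof.
intros Ha Hb H.
destruct Hg as [_ [_ [_ [_ [_ [_ [_ [_ [_ [_ [_ [H1 _]]]]]]]]]]]].
destruct (H1 a b Ha Hb) as [_ [_ H2]]. specialize (H2 H).
pose proof (giem_image_in a Ha). pose proof (giem_image_in b Hb).
set (u := E a (lft g a)) in *. set (v := E b (lft g b)) in *.
destruct (Rle_dec (E a (rgt g a)) v) as [|Hn]; auto. exfalso.
assert (Rmax u v < v); [|pose proof (Rmax_r u v); lra].
apply H2; apply image_iff; auto; fold u v; [|lra]. split; [apply Rmax_l|]. apply Rmax_lub_lt; lra.
Qed.

Definition order0 := tiling_order d (lft g) (rgt g) (pi0 g) (il g) (ir g) giem_in giem_ranking0 giem_order0.
Definition adjacent0 := tiling_adjacent d (lft g) (rgt g) (pi0 g) (il g) (ir g)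
  giem_in giem_cover giem_ranking0 giem_order0.
Definition last0 := tiling_last d (lft g) (rgt g) (pi0 g) (il g) (ir g)
  giem_in giem_cover giem_ranking0 giem_order0.
Definition order1 := tiling_order d (fun a => E a (lft g a)) (fun a => E a (rgt g a)) (pi1 g)
  (il g) (ir g) giem_image_in giem_ranking1 giem_order1.
Definition left_inj1 := tiling_left_inj d (fun a => E a (lft g a)) (fun a => E a (rgt g a)) (pi1 g)
  (il g) (ir g) giem_image_in giem_ranking1 giem_order1.
Definition adjacent1 := tiling_adjacent d (fun a => E a (lft g a)) (fun a => E a (rgt g a)) (pi1 g)
  (il g) (ir g) giem_image_in giem_image_cover giem_ranking1 giem_order1.
Definition last1 := tiling_last d (fun a => E a (lft g a)) (fun a => E a (rgt g a)) (pi1 g)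
  (il g) (ir g) giem_image_in giem_image_cover giem_ranking1 giem_order1.
Definition disjoint1 := tiling_disjoint d (fun a => E a (lft g a)) (fun a => E a (rgt g a)) (pi1 g)
  giem_ranking1 giem_order1.

Lemma giem_mass : (1 <= d)%nat ->
  rsum (fun b => (E b (rgt g b) - E b (lft g b)) - (rgt g b - lft g b)) d = 0.
Proof.
intros Hd. rewrite rsum_minus.
rewrite (tiling_total d (lft g) (rgt g) (pi0 g) (il g) (ir g) giem_in giem_cover giem_ranking0 giem_order0 Hd).
rewrite (tiling_total d (fun a => E a (lft g a)) (fun a => E a (rgt g a)) (pi1 g)
  (il g) (ir g) giem_image_in giem_image_cover giem_ranking1 giem_order1 Hd). ring.
Qed.

(** Continuity at the common end point glues the two images together, so they are neighbours in the
    bottom row. Each break of the bottom row thus costs a discontinuity. *)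
Lemma break_discontinuous a b : (a < d)%nat -> (b < d)%nat -> pi0 g b = (pi0 g a + 1)%nat ->
  cont_within (in_I g) (fmap g) (lft g b) -> pi1 g b = (pi1 g a + 1)%nat.
Proof.
intros Ha Hb Hab Hc. pose proof (adjacent0 a b Ha Hb Hab) as Hs.
pose proof (giem_in a Ha). pose proof (giem_in b Hb).
destruct (HE a Ha) as [A1 [A2 A3]]. destruct (HE b Hb) as [B1 _].
assert (Eq : E a (rgt g a) = E b (lft g b)).
{ destruct (Req_dec (E a (rgt g a)) (E b (lft g b))) as [|Hn]; auto. exfalso.
  set (e := Rabs (E a (rgt g a) - E b (lft g b)) / 3).
  assert (He : 0 < e) by (unfold e; pose proof (Rabs_pos_lt _ (Rminus_eq_contra _ _ Hn)); lra).
  destruct (Hc e He) as [d1 [Hd1 C1]].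
  destruct (A3 (rgt g a) ltac:(lra) e He) as [d2 [Hd2 C2]].
  set (m := Rmin (rgt g a - lft g a) (Rmin d1 d2)).
  assert (Hm : 0 < m) by (unfold m; repeat apply Rmin_glb_lt; lra).
  assert (M1 : m <= rgt g a - lft g a) by apply Rmin_l.
  assert (M2 : m <= d1) by (eapply Rle_trans; [apply Rmin_r|apply Rmin_l]).
  assert (M3 : m <= d2) by (eapply Rle_trans; [apply Rmin_r|apply Rmin_r]).
  set (y := rgt g a - m / 2).
  assert (D1 : Rabs (fmap g y - fmap g (lft g b)) < e).
  { apply C1; [unfold in_I, y; lra|]. rewrite <- Hs. unfold y.
    rewrite Rabs_left1; lra. }
  assert (D2 : Rabs (E a y - E a (rgt g a)) < e).
  { apply C2. split; [split; [exact I|unfold y; lra]|].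
    unfold R_dist, y. simpl. unfold R_dist. rewrite Rabs_left1; lra. }
  rewrite <- (A1 y) in D1 by (unfold y; lra). rewrite <- B1 in D1 by lra.
  assert (Rabs (E a (rgt g a) - E b (lft g b)) <= Rabs (E a y - E b (lft g b)) + Rabs (E a y - E a (rgt g a))).
  { replace (E a (rgt g a) - E b (lft g b)) with ((E a y - E b (lft g b)) - (E a y - E a (rgt g a))) by ring.
    eapply Rle_trans; [apply Rabs_triang|]. rewrite Rabs_Ropp. lra. }
  unfold e in *. lra. }
pose proof (giem_image_in a Ha) as Ia. pose proof (order1 a b Ha Hb ltac:(cbv beta; lra)) as O.
pose proof (proj1 giem_ranking1 b Hb).
destruct (ranking_surj d (pi1 g) (pi1 g a + 1) giem_ranking1) as [c [Hc' Ec]]; [lia|].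
pose proof (adjacent1 a c Ha Hc' Ec) as Ad. cbv beta in Ad.
assert (c = b) by (apply left_inj1; auto; cbv beta; lra). subst c. auto.
Qed.

End Level.

(** * End points, branches and ranks after one step *)

Section Step.
Context (d : nat) (g h : giem) (E : nat -> R -> R) (e : bool) (a0 a1 : nat)
  (Hg : is_giem d g) (Hh : is_giem d h) (HE : branch_ext d g E) (HS : RV_step d g h e)
  (Ha0 : (a0 < d)%nat) (Ha1 : (a1 < d)%nat) (Hne : a1 <> a0)
  (E0 : pi0 g a0 = d) (E1 : pi1 g a1 = d).

Lemma step_right_end : E a1 (rgt g a1) = ir g /\ rgt g a0 = ir g.
Proof.
split; [apply (last1 d g E Hg HE a1 Ha1 E1)|apply (last0 d g Hg a0 Ha0 E0)].
Qed.

Lemma step_unfold : exists L, L = E a1 (rgt g a1) - E a1 (lft g a1) /\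
  (forall x, in_I h x -> in_I h (fmap g x) -> fmap h x = fmap g x) /\
  (forall x, in_I h x -> ~ in_I h (fmap g x) -> in_I h (fmap g (fmap g x)) ->
     fmap h x = fmap g (fmap g x)) /\
  (if e then
     rgt g a0 - lft g a0 < L /\
     (forall x, in_I h x <-> (in_I g x /\ ~ in_part g a0 x)) /\
     (forall a x, (a < d)%nat -> a <> a0 -> a <> a1 -> (in_part h a x <-> in_part g a x)) /\
     (forall x, in_part h a1 x <->
        (in_I g x /\ image_part g a1 (fmap g x) /\ ~ in_part g a0 (fmap g x))) /\
     (forall x, in_part h a0 x <-> (in_part g a1 x /\ ~ in_part h a1 x))
   else
     rgt g a0 - lft g a0 > L /\
     (forall x, in_I h x <-> (in_I g x /\ ~ image_part g a1 x)) /\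
     (forall a x, (a < d)%nat -> a <> a0 -> (in_part h a x <-> in_part g a x)) /\
     (forall x, in_part h a0 x <-> (in_part g a0 x /\ ~ image_part g a1 x))).
Proof.
destruct HS as [b0 [b1 [L [Hb0 [Hb1 [F0 [F1 [[s [Hs HL]] [Hret Hrest]]]]]]]]].
assert (b0 = a0) by (apply (proj2 (giem_ranking0 d g Hg)); auto; lia).
assert (b1 = a1) by (apply (proj2 (giem_ranking1 d g Hg)); auto; lia). subst b0 b1.
exists L. split; [|split; [|split; [|exact Hrest]]].
- rewrite HL, (image_lub d g E Hg HE a1 s Ha1 Hs).
  pose proof (giem_in d g Hg a1 Ha1). rewrite (proj1 (HE a1 Ha1) (lft g a1)) by lra. auto.
- intros x Hx Hfx. destruct (Hret x Hx) as [m [Hm [_ [Hmin ->]]]].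
  destruct (Nat.eq_dec m 1) as [->|Hn]; [auto|].
  exfalso. apply (Hmin 1%nat); [lia|auto].
- intros x Hx Hfx Hffx. destruct (Hret x Hx) as [m [Hm [Hin [Hmin ->]]]].
  destruct (Nat.eq_dec m 1) as [->|Hn]; [contradiction|].
  destruct (Nat.eq_dec m 2) as [->|Hn']; [auto|].
  exfalso. apply (Hmin 2%nat); [lia|auto].
Qed.

Lemma fmap_image b x : (b < d)%nat -> lft g b <= x < rgt g b ->
  fmap g x = E b x /\ E b (lft g b) <= fmap g x < E b (rgt g b).
Proof.
intros Hb Hx. rewrite <- (proj1 (HE b Hb) x Hx). split; auto.
split; [apply (E_mono d g E HE); auto; lra|apply (HE b Hb); lra].
Qed.

(** The removed piece is the image of [a1] and lies in the interval of [a0]. Images of distinct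
    letters are disjoint, so other letters avoid it and return at once, while a point of [a1] enters
    it and is then sent by [a0] outside the image of [a1]: it returns at the second iterate. *)
Lemma step_type0 : e = false ->
  (forall b, (b < d)%nat -> lft h b = lft g b) /\
  (forall b, (b < d)%nat -> b <> a0 -> rgt h b = rgt g b) /\
  rgt h a0 = E a1 (lft g a1) /\
  (forall b x, (b < d)%nat -> b <> a1 -> lft h b <= x < rgt h b -> fmap h x = fmap g x) /\
  (forall x, lft h a1 <= x < rgt h a1 -> fmap h x = fmap g (fmap g x)).
Proof.
intros Ee. destruct step_unfold as [L [HL [R1 [R2 S]]]]. rewrite Ee in S.
destruct S as [S1 [S2 [S3 S4]]]. destruct step_right_end as [P1 P2].
pose proof (giem_in d g Hg a0 Ha0) as I0. pose proof (giem_image_in d g E Hg HE a1 Ha1) as I1.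
assert (Hlt : lft g a0 < E a1 (lft g a1)) by lra.
assert (Im : forall y, image_part g a1 y <-> E a1 (lft g a1) <= y < ir g).
{ intros y. rewrite (image_iff d g E Hg HE a1 y Ha1), P1. tauto. }
assert (Ih : forall x, in_I h x <-> il g <= x < E a1 (lft g a1)).
{ intros x. rewrite S2, Im. unfold in_I. lra. }
assert (Ea0 : lft g a0 = lft h a0 /\ E a1 (lft g a1) = rgt h a0).
{ apply half_open_eq; auto; [apply (giem_in d h Hh a0 Ha0)|].
  intros x. specialize (S4 x). rewrite Im in S4. unfold in_part in S4. rewrite S4. lra. }
assert (Eb : forall b, (b < d)%nat -> b <> a0 -> lft g b = lft h b /\ rgt g b = rgt h b).
{ intros b Hb Hn. apply half_open_eq; [apply (giem_in d g Hg b Hb)|apply (giem_in d h Hh b Hb)|].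
  intros x. symmetry. apply (S3 b x Hb Hn). }
assert (HinI : forall b x, (b < d)%nat -> lft h b <= x < rgt h b -> in_I h x).
{ intros b x Hb Hx. pose proof (giem_in d h Hh b Hb). unfold in_I. lra. }
assert (Hing : forall b x, (b < d)%nat -> lft h b <= x < rgt h b -> lft g b <= x < rgt g b).
{ intros b x Hb Hx. destruct (Nat.eq_dec b a0) as [->|Hn]; [lra|].
  destruct (Eb b Hb Hn) as [-> ->]. auto. }
assert (Hout : forall b y, (b < d)%nat -> b <> a1 -> E b (lft g b) <= y < E b (rgt g b) -> in_I h y).
{ intros b y Hb Hn Hy. pose proof (giem_image_in d g E Hg HE b Hb). apply Ih. split; [lra|].
  destruct (Rlt_dec y (E a1 (lft g a1))) as [|Hc]; auto. exfalso. apply Hn.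
  apply (disjoint1 d g E Hg HE b a1 y Hb Ha1); cbv beta; lra. }
repeat split.
- intros b Hb. destruct (Nat.eq_dec b a0) as [->|Hn]; [lra|]. destruct (Eb b Hb Hn); auto.
- intros b Hb Hn. destruct (Eb b Hb Hn); auto.
- symmetry. apply Ea0.
- intros b x Hb Hn Hx. apply R1; [apply (HinI b x Hb Hx)|].
  apply (Hout b); auto. apply (fmap_image b x Hb); auto.
- intros x Hx. destruct (fmap_image a1 x Ha1 (Hing a1 x Ha1 Hx)) as [_ Q].
  apply R2; [apply (HinI a1 x Ha1 Hx)|rewrite Ih; lra|].
  apply (Hout a0); auto. apply fmap_image; auto. lra.
Qed.

Lemma step_type1 : e = true ->
  (forall b, (b < d)%nat -> b <> a1 -> b <> a0 -> lft h b = lft g b /\ rgt h b = rgt g b) /\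
  lft h a1 = lft g a1 /\ rgt h a1 = lft h a0 /\ rgt h a0 = rgt g a1 /\
  E a1 (lft h a0) = lft g a0 /\
  (forall b x, (b < d)%nat -> b <> a0 -> lft h b <= x < rgt h b -> fmap h x = fmap g x) /\
  (forall x, lft h a0 <= x < rgt h a0 -> fmap h x = fmap g (fmap g x)).
Proof.
intros Ee. destruct step_unfold as [L [HL [R1 [R2 S]]]]. rewrite Ee in S.
destruct S as [S1 [S2 [S3 [S4 S5]]]]. destruct step_right_end as [P1 P2].
pose proof (giem_in d g Hg a0 Ha0) as I0. pose proof (giem_in d g Hg a1 Ha1) as I1.
pose proof (giem_image_in d g E Hg HE a1 Ha1) as J1.
destruct (HE a1 Ha1) as [X1 [X2 X3]].
(* [t] is the point of the winner's interval sent to the left end of the removed interval; the two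
   new intervals are cut there. *)
destruct (IVT_interv (fun x => E a1 x - lft g a0) (lft g a1) (rgt g a1)) as [t [Ht Et]]; try lra.
{ intros x Hx. apply (continuity_pt_minus (E a1) (fct_cte (lft g a0))); auto.
  apply continuity_pt_const. intros u v; auto. }
assert (Ht1 : lft g a1 < t < rgt g a1).
{ split.
  - destruct (Req_dec t (lft g a1)) as [Hq|]; [subst t|]; lra.
  - destruct (Req_dec t (rgt g a1)) as [Hq|]; [subst t|]; lra. }
assert (Ih : forall x, in_I h x <-> il g <= x < lft g a0).
{ intros x. rewrite S2. unfold in_I, in_part. lra. }
assert (K1 : lft h a1 = lft g a1 /\ rgt h a1 = t).
{ apply half_open_eq; [apply (giem_in d h Hh a1 Ha1)|lra|].
  intros x. specialize (S4 x). unfold in_part at 1 in S4. rewrite S4.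
  rewrite (image_iff d g E Hg HE a1 _ Ha1). unfold in_part, in_I. split.
  - intros [Hx [Hy Hz]].
    destruct (giem_cover d g Hg x Hx) as [b [Hb Ib]].
    destruct (fmap_image b x Hb Ib) as [Q1 Q2].
    assert (b = a1) by (apply (disjoint1 d g E Hg HE b a1 (fmap g x) Hb Ha1); cbv beta; lra). subst b.
    split; [lra|]. destruct (Rlt_dec x t) as [|Hc]; auto. exfalso.
    assert (E a1 t <= E a1 x) by (apply (E_mono d g E HE); auto; lra). lra.
  - intros Hx. destruct (fmap_image a1 x Ha1) as [Q1 Q2]; [lra|].
    split; [lra|split; [lra|]].
    assert (E a1 x < E a1 t) by (apply X2; lra). lra. }
destruct K1 as [K1 K2].
assert (K3 : lft h a0 = t /\ rgt h a0 = rgt g a1).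
{ apply half_open_eq; [apply (giem_in d h Hh a0 Ha0)|lra|].
  intros x. specialize (S5 x). unfold in_part in S5. rewrite S5, K1, K2. lra. }
destruct K3 as [K3 K4].
assert (Eb : forall b, (b < d)%nat -> b <> a1 -> b <> a0 -> lft h b = lft g b /\ rgt h b = rgt g b).
{ intros b Hb Hn1 Hn0. apply half_open_eq; [apply (giem_in d h Hh b Hb)|apply (giem_in d g Hg b Hb)|].
  intros x. apply (S3 b x Hb); auto. }
assert (HinI : forall b x, (b < d)%nat -> lft h b <= x < rgt h b -> in_I h x).
{ intros b x Hb Hx. pose proof (giem_in d h Hh b Hb). unfold in_I. lra. }
assert (Hout : forall b y, (b < d)%nat -> b <> a1 -> E b (lft g b) <= y < E b (rgt g b) -> in_I h y).
{ intros b y Hb Hn Hy. pose proof (giem_image_in d g E Hg HE b Hb). apply Ih. split; [lra|].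
  destruct (Rlt_dec y (lft g a0)) as [|Hc]; auto. exfalso. apply Hn.
  apply (disjoint1 d g E Hg HE b a1 y Hb Ha1); cbv beta; lra. }
split; [exact Eb|]. split; [exact K1|]. split; [lra|]. split; [exact K4|]. split; [rewrite K3; lra|].
split.
- intros b x Hb Hn Hx. apply R1; [apply (HinI b x Hb Hx)|].
  destruct (Nat.eq_dec b a1) as [->|Hn1].
  + destruct (fmap_image a1 x Ha1) as [Q1 Q2]; [lra|]. apply Ih. rewrite Q1 in *.
    assert (E a1 x < E a1 t) by (apply X2; lra). lra.
  + apply (Hout b); auto. apply fmap_image; auto. destruct (Eb b Hb Hn1 Hn) as [<- <-]. auto.
- intros x Hx. destruct (fmap_image a1 x Ha1) as [Q1 Q2]; [lra|].
  assert (E a1 t <= E a1 x) by (apply (E_mono d g E HE); auto; lra).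
  apply R2; [apply (HinI a0 x Ha0 Hx)|rewrite Ih; lra|].
  apply (Hout a0); auto. apply fmap_image; auto. lra.
Qed.

Lemma type_cases : e = true \/ e = false.
Proof. destruct e; auto. Qed.

(** The same recursion as for [G], with [a1] and [a0] as [fs n] and [sn n]. *)
Definition step_ext (b : nat) (x : R) : R :=
  if Nat.eqb b (if e then a0 else a1) then E a0 (E a1 x) else E b x.

Lemma step_loser x : let b := if e then a0 else a1 in lft h b <= x <= rgt h b ->
  lft g a1 <= x <= rgt g a1 /\ lft g a0 <= E a1 x <= rgt g a0.
Proof.
simpl. intros Hx. destruct step_right_end as [P1 P2].
pose proof (giem_in d g Hg a0 Ha0) as I0. pose proof (giem_in d g Hg a1 Ha1) as I1.
destruct type_cases as [Ee|Ee]; rewrite Ee in Hx.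
- destruct (step_type1 Ee) as [Eb [K1 [K2 [K3 [K4 _]]]]].
  pose proof (giem_in d h Hh a1 Ha1). split; [lra|]. split.
  + rewrite <- K4. apply (E_mono d g E HE); auto; lra.
  + rewrite P2, <- P1. apply (E_mono d g E HE); auto; lra.
- destruct (step_type0 Ee) as [Hl [Hr [K3 _]]].
  rewrite Hl, Hr in Hx by auto. pose proof (giem_in d h Hh a0 Ha0) as I0'. rewrite Hl in I0' by auto.
  split; [lra|]. split.
  + apply Rle_trans with (E a1 (lft g a1)); [lra|]. apply (E_mono d g E HE); auto; lra.
  + rewrite P2, <- P1. apply (E_mono d g E HE); auto; lra.
Qed.

Lemma step_keep b x : (b < d)%nat -> b <> (if e then a0 else a1) ->
  lft h b <= x <= rgt h b -> lft g b <= x <= rgt g b.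
Proof.
intros Hb Hn Hx. destruct step_right_end as [P1 P2]. destruct type_cases as [Ee|Ee]; rewrite Ee in Hn.
- destruct (step_type1 Ee) as [Eb [K1 [K2 [K3 [K4 _]]]]].
  destruct (Nat.eq_dec b a1) as [->|Hn1].
  + pose proof (giem_in d h Hh a0 Ha0). lra.
  + destruct (Eb b Hb Hn1 Hn). lra.
- destruct (step_type0 Ee) as [Hl [Hr [K3 _]]]. rewrite Hl in Hx by auto.
  destruct (Nat.eq_dec b a0) as [->|Hn1].
  + pose proof (giem_image_in d g E Hg HE a1 Ha1). lra.
  + rewrite Hr in Hx; auto.
Qed.

Lemma step_branch_ext : branch_ext d h step_ext.
Proof.
intros b Hb. unfold step_ext.
destruct (Nat.eqb_spec b (if e then a0 else a1)) as [Eq|Hn].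
- assert (Hl : forall x, lft h b <= x <= rgt h b ->
    lft g a1 <= x <= rgt g a1 /\ lft g a0 <= E a1 x <= rgt g a0).
  { intros x Hx. apply step_loser. rewrite <- Eq. auto. }
  pose proof (giem_in d h Hh b Hb).
  split; [|split].
  + intros x Hx. assert (F : fmap h x = fmap g (fmap g x)).
    { destruct type_cases as [Ee|Ee]; rewrite Ee in Eq; subst b.
      - apply (step_type1 Ee). auto.
      - apply (step_type0 Ee). auto. }
    destruct (Hl x ltac:(lra)) as [Q1 Q2]. destruct (Hl (rgt h b) ltac:(lra)) as [Q3 Q4].
    assert (E a1 x < E a1 (rgt h b)) by (apply (HE a1 Ha1); lra).
    rewrite F, <- (proj1 (HE a1 Ha1) x) by lra. apply (HE a0 Ha0). lra.
  + intros x y Hx Hxy Hy. destruct (Hl x ltac:(lra)) as [Q1 Q2]. destruct (Hl y ltac:(lra)) as [Q3 Q4].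
    assert (E a1 x < E a1 y) by (apply (HE a1 Ha1); lra). apply (HE a0 Ha0); lra.
  + intros x Hx. destruct (Hl x Hx) as [Q1 Q2].
    apply (continuity_pt_comp (E a1) (E a0)); [apply (HE a1 Ha1)|apply (HE a0 Ha0)]; auto.
- assert (Hk : forall x, lft h b <= x <= rgt h b -> lft g b <= x <= rgt g b).
  { intros x Hx. apply step_keep; auto. }
  pose proof (giem_in d h Hh b Hb).
  split; [|split].
  + intros x Hx. assert (F : fmap h x = fmap g x).
    { destruct type_cases as [Ee|Ee]; rewrite Ee in Hn.
      - apply (step_type1 Ee) with (b := b); auto.
      - apply (step_type0 Ee) with (b := b); auto. }
    pose proof (Hk x ltac:(lra)). pose proof (Hk (rgt h b) ltac:(lra)).
    rewrite F. apply (HE b Hb). lra.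
  + intros x y Hx Hxy Hy. pose proof (Hk x ltac:(lra)). pose proof (Hk y ltac:(lra)).
    apply (HE b Hb); lra.
  + intros x Hx. apply (HE b Hb). auto.
Qed.

Lemma lft_order a b : (a < d)%nat -> (b < d)%nat -> (pi0 g a < pi0 g b)%nat -> lft g a < lft g b.
Proof.
intros Ha Hb H. pose proof (giem_order0 d g Hg a b Ha Hb H). pose proof (giem_in d g Hg a Ha). lra.
Qed.

Lemma image_order a b : (a < d)%nat -> (b < d)%nat -> (pi1 g a < pi1 g b)%nat ->
  E a (lft g a) < E b (lft g b).
Proof.
intros Ha Hb H. pose proof (giem_order1 d g E Hg HE a b Ha Hb H).
pose proof (giem_image_in d g E Hg HE a Ha). lra.
Qed.

(** Left ends do not move, so the top order persists. The loser's left end now has its image inside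
    the old image of [a0]: behind the start of that image and before all images behind it. *)
Lemma step_ranks0 : e = false -> (forall a, (a < d)%nat -> pi0 h a = pi0 g a) /\
  (forall a, (a < d)%nat -> pi1 h a = reinsert (pi1 g) a1 a0 a).
Proof.
intros Ee. destruct (step_type0 Ee) as [Hl [Hr [K3 _]]]. destruct step_right_end as [P1 P2].
pose proof (giem_in d h Hh a0 Ha0) as I0. rewrite Hl, K3 in I0 by auto.
pose proof (giem_in d g Hg a0 Ha0) as I0'.
pose proof (giem_image_in d g E Hg HE a1 Ha1) as I1.
split.
- apply ranking_unique; auto using giem_ranking0. intros a b Ha Hb H.
  apply (order0 d h Hh); auto. rewrite !Hl by auto. apply lft_order; auto.
- apply (reinsert_order d (pi1 g) a1 a0 (fun a => E a (lft g a)) (fun a => step_ext a (lft h a)));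
    auto using giem_ranking1, image_order.
  + intros a b Ha Hb H. apply (order1 d h step_ext Hh step_branch_ext a b Ha Hb H).
  + intros a Ha Hn. unfold step_ext. rewrite Ee, Hl by auto. destruct (Nat.eqb_spec a a1); [lia|auto].
  + unfold step_ext. rewrite Ee, Nat.eqb_refl, Hl by auto. apply (HE a0 Ha0); lra.
  + intros b Hb Hn H. unfold step_ext. rewrite Ee, Nat.eqb_refl, Hl by auto.
    apply Rlt_le_trans with (E a0 (rgt g a0)); [apply (HE a0 Ha0); lra|].
    apply (giem_order1 d g E Hg HE); auto.
Qed.

(** The composed branch sends the loser's new left end to the image of its old one, so the bottom
    order persists; in the top row the loser now starts inside the old interval of [a1]. *)
Lemma step_ranks1 : e = true -> (forall a, (a < d)%nat -> pi1 h a = pi1 g a) /\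
  (forall a, (a < d)%nat -> pi0 h a = reinsert (pi0 g) a0 a1 a).
Proof.
intros Ee. destruct (step_type1 Ee) as [Eb [K1 [K2 [K3 [K4 _]]]]].
pose proof (giem_in d h Hh a0 Ha0) as I0. pose proof (giem_in d h Hh a1 Ha1) as I1.
assert (Hl : forall b, (b < d)%nat -> b <> a0 -> lft h b = lft g b).
{ intros b Hb Hn. destruct (Nat.eq_dec b a1) as [->|Hn1]; auto. apply Eb; auto. }
split.
- apply ranking_unique; auto using giem_ranking1. intros a b Ha Hb H.
  apply (order1 d h step_ext Hh step_branch_ext); auto.
  assert (S : forall c, (c < d)%nat -> step_ext c (lft h c) = E c (lft g c)).
  { intros c Hc. unfold step_ext. rewrite Ee. destruct (Nat.eqb_spec c a0) as [->|Hn].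
    - rewrite K4. auto.
    - rewrite Hl; auto. }
  rewrite !S by auto. apply image_order; auto.
- apply (reinsert_order d (pi0 g) a0 a1 (lft g) (lft h)); auto using giem_ranking0, lft_order.
  + intros a b Ha Hb H. apply (order0 d h Hh a b Ha Hb H).
  + lra.
  + intros b Hb Hn H. pose proof (giem_order0 d g Hg a1 b Ha1 Hb H). lra.
Qed.

Lemma step_blocks0 p q : e = false -> blocks d (pi0 g) (pi1 g) p q ->
  blocks d (pi0 h) (pi1 h) (if Nat.eqb p 1 then q else (p - 1)%nat) q.
Proof.
intros Ee B. destruct (step_ranks0 Ee) as [K1 K2].
destruct (blocks_type0 d _ _ p q _ _ _ (giem_ranking0 d g Hg) (giem_ranking1 d g Hg) B Ha0 Ha1 E0 E1 K2)
  as [B1 [B2 B3]].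
split; [auto|split; auto]. intros a Ha. rewrite K1 by auto. auto.
Qed.

Lemma step_blocks1 p q : e = true -> blocks d (pi0 g) (pi1 g) p q ->
  blocks d (pi0 h) (pi1 h) p (if Nat.eqb q (d - 1) then p else (q + 1)%nat).
Proof.
intros Ee B. destruct (step_ranks1 Ee) as [K1 K2].
destruct (blocks_type1 d _ _ p q _ _ _ (giem_ranking0 d g Hg) (giem_ranking1 d g Hg) B Ha0 Ha1 E0 E1 K2)
  as [B1 [B2 B3]].
split; [auto|split; auto]. intros a Ha. rewrite K1 by auto. auto.
Qed.

End Step.

(** * Smooth branches and their zooms *)

(** Tangent lines outside [[l, r]] turn the one-sided derivatives at the ends into two-sided ones,
    as [derivable_pt_lim] requires. *)
Definition lin_ext (l r : R) (f D : R -> R) (x : R) : R :=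
  if Rlt_dec x l then f l + D l * (x - l)
  else if Rlt_dec r x then f r + D r * (x - r) else f x.

Lemma lin_ext_eq l r f D x : l <= x <= r -> lin_ext l r f D x = f x.
Proof. intros H. unfold lin_ext. destruct (Rlt_dec x l); [lra|]. destruct (Rlt_dec r x); lra. Qed.

Lemma lin_ext_der l r f D : l < r ->
  (forall x, l <= x <= r -> deriv_within (closed_int l r) f x (D x)) ->
  forall x, l <= x <= r -> derivable_pt_lim (lin_ext l r f D) x (D x).
Proof.
intros Hlr H x Hx e He. destruct (H x Hx e He) as [d1 [Hd1 H1]].
set (ml := if Req_EM_T x l then d1 else x - l). set (mr := if Req_EM_T x r then d1 else r - x).
assert (Hml : 0 < ml) by (unfold ml; destruct (Req_EM_T x l); lra).
assert (Hmr : 0 < mr) by (unfold mr; destruct (Req_EM_T x r); lra).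
assert (Hd : 0 < Rmin d1 (Rmin ml mr)) by (repeat apply Rmin_glb_lt; auto).
exists (mkposreal _ Hd). simpl. intros h Hh0 Hh.
assert (B1 : Rabs h < d1) by (eapply Rlt_le_trans; [exact Hh|apply Rmin_l]).
assert (B2 : Rabs h < ml).
{ eapply Rlt_le_trans; [exact Hh|eapply Rle_trans; [apply Rmin_r|apply Rmin_l]]. }
assert (B3 : Rabs h < mr).
{ eapply Rlt_le_trans; [exact Hh|eapply Rle_trans; [apply Rmin_r|apply Rmin_r]]. }
apply Rabs_def2 in B2. apply Rabs_def2 in B3.
rewrite (lin_ext_eq l r f D x Hx). unfold lin_ext. unfold ml in B2. unfold mr in B3.
destruct (Rlt_dec (x + h) l) as [C|C].
- destruct (Req_EM_T x l) as [->|]; [|lra].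
  replace ((f l + D l * (l + h - l) - f l) / h - D l) with 0 by (field; auto).
  rewrite Rabs_R0. auto.
- destruct (Rlt_dec r (x + h)) as [C'|C'].
  + destruct (Req_EM_T x r) as [->|]; [|lra].
    replace ((f r + D r * (r + h - r) - f r) / h - D r) with 0 by (field; auto).
    rewrite Rabs_R0. auto.
  + replace h with (x + h - x) at 2 by ring.
    apply H1; [unfold closed_int; lra|lra|]. replace (x + h - x) with h by ring. auto.
Qed.

Lemma finite_uniform (d : nat) (P : nat -> R -> Prop) :
  (forall a c c', P a c -> c <= c' -> P a c') ->
  (forall a, (a < d)%nat -> exists c, P a c) ->
  exists c, 1 <= c /\ forall a, (a < d)%nat -> P a c.
Proof.
intros Hm H. induction d as [|d IH].
- exists 1. split; [lra|intros; lia].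
- destruct IH as [c [Hc Pc]]; [intros; apply H; lia|]. destruct (H d ltac:(lia)) as [c' Pc'].
  exists (Rmax c c'). split; [eapply Rle_trans; [exact Hc|apply Rmax_l]|].
  intros a Ha. destruct (Nat.eq_dec a d) as [->|Hn].
  + apply Hm with c'; auto. apply Rmax_r.
  + apply Hm with c; [apply Pc; lia|apply Rmax_l].
Qed.

Lemma Rpower_le_1 u nu : 0 < u <= 1 -> 0 < nu -> Rpower u nu <= 1.
Proof.
intros Hu Hn. unfold Rpower. rewrite <- exp_0. apply exp_le_compat.
assert (ln u <= 0).
{ destruct (proj2 Hu) as [H|H]; [|subst; rewrite ln_1; lra].
  left. rewrite <- ln_1. apply ln_increasing; lra. }
nra.
Qed.

Lemma Rpower_mono_base u v nu : 0 < u <= v -> 0 < nu -> Rpower u nu <= Rpower v nu.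
Proof.
intros [Hu [H|H]] Hn; [|subst; lra]. unfold Rpower. apply exp_le_compat.
assert (ln u < ln v) by (apply ln_increasing; auto). nra.
Qed.

Lemma Rpower_anti_exponent u nu nu' : 0 < u <= 1 -> nu' <= nu -> Rpower u nu <= Rpower u nu'.
Proof.
intros Hu H. unfold Rpower. apply exp_le_compat.
assert (ln u <= 0).
{ destruct (proj2 Hu) as [H'|H']; [|subst; rewrite ln_1; lra].
  left. rewrite <- ln_1. apply ln_increasing; lra. }
nra.
Qed.

Section Branch.
Context (l r nu : R) (f G D1 D2 : R -> R) (H01 : 0 <= l /\ l < r /\ r <= 1) (Hnu : 0 < nu)
  (HC : C2nu_ext l r f nu G D1 D2).

Lemma holder_constant : exists H, 0 <= H /\ forall x y, l <= x <= r -> l <= y <= r ->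
  Rabs (D2 x - D2 y) <= H * Rpower (Rabs (x - y)) nu.
Proof.
destruct HC as [_ [_ [H HH]]]. exists H. split; auto.
(* [Rpower] is positive even for base 0, so the pair [(l, l)] shows that [H] is nonnegative. *)
specialize (HH l l ltac:(lra) ltac:(lra)). rewrite Rminus_diag, Rabs_R0 in HH.
assert (0 < Rpower (Rabs (l - l)) nu) by apply exp_pos. nra.
Qed.

Definition ext_map := lin_ext l r G D1.
Definition ext_der := lin_ext l r D1 D2.

Lemma ext_map_derivable x : l <= x <= r -> derivable_pt_lim ext_map x (ext_der x).
Proof.
intros Hx. unfold ext_der. rewrite lin_ext_eq by auto. apply lin_ext_der; try lra.
intros y Hy. apply HC; auto.
Qed.

Lemma ext_der_derivable x : l <= x <= r -> derivable_pt_lim ext_der x (D2 x).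
Proof. intros Hx. apply lin_ext_der; try lra. intros y Hy. apply HC; auto. Qed.

Lemma ext_der_pos x : l <= x <= r -> 0 < ext_der x.
Proof. intros Hx. unfold ext_der. rewrite lin_ext_eq by auto. apply HC; auto. Qed.

(** A Hölder numerator is divided by a Lipschitz denominator bounded away from 0; on an interval of
    length at most 1 the exponent [Rmin nu 1] suits both. *)
Lemma nonlinearity_bounds : exists C, 1 <= C /\
  (forall x, l <= x <= r -> Rabs (D2 x / ext_der x) <= C) /\
  (forall x y t, l <= x <= r -> l <= y <= r -> Rabs (x - y) <= t -> 0 < t ->
     D2 y / ext_der y - D2 x / ext_der x <= C * Rpower t (Rmin nu 1)).
Proof.
destruct holder_constant as [H [H0 HH]].
destruct (continuity_ab_min ext_der l r) as [z [Hz Iz]]; [lra| |].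
{ intros c Hc. apply derivable_continuous_pt. exists (D2 c). apply ext_der_derivable; auto. }
set (m := ext_der z) in *. assert (Hm : 0 < m) by (apply ext_der_pos; auto).
set (B := Rabs (D2 l) + H).
assert (HB0 : 0 <= B) by (unfold B; pose proof (Rabs_pos (D2 l)); lra).
assert (HB : forall x, l <= x <= r -> Rabs (D2 x) <= B).
{ intros x Hx. unfold B. destruct (Req_dec x l) as [->|Hn]; [lra|].
  specialize (HH x l Hx ltac:(lra)).
  assert (Rpower (Rabs (x - l)) nu <= 1).
  { apply Rpower_le_1; auto. rewrite Rabs_right by lra. lra. }
  assert (H * Rpower (Rabs (x - l)) nu <= H * 1) by (apply Rmult_le_compat_l; auto).
  replace (D2 x) with (D2 l + (D2 x - D2 l)) by ring.
  eapply Rle_trans; [apply Rabs_triang|]. lra. }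
assert (Hinv : forall x, l <= x <= r -> 0 < / ext_der x <= / m).
{ intros x Hx. split; [apply Rinv_0_lt_compat, ext_der_pos; auto|]. apply Rinv_le_contravar; auto. }
assert (Him : 0 < / m) by (apply Rinv_0_lt_compat; auto).
assert (Lip : forall x y, l <= x <= r -> l <= y <= r -> Rabs (ext_der x - ext_der y) <= B * Rabs (x - y)).
{ assert (A : forall x y, l <= x -> x <= y -> y <= r -> Rabs (ext_der x - ext_der y) <= B * Rabs (x - y)).
  { intros x y Hx Hxy Hy. destruct (mean_value ext_der D2 x y Hxy) as [c [Hc E]].
    - intros c Hc. apply ext_der_derivable. lra.
    - rewrite Rabs_minus_sym, E, Rabs_mult, (Rabs_minus_sym x y).
      apply Rmult_le_compat_r; [apply Rabs_pos|apply HB; lra]. }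
  intros x y Hx Hy. destruct (Rle_dec x y); [apply A; lra|].
  rewrite Rabs_minus_sym, (Rabs_minus_sym x y). apply A; lra. }
set (Q := H * / m + B * B * (/ m * / m)).
assert (HQ : 0 <= Q).
{ unfold Q. apply Rplus_le_le_0_compat; repeat apply Rmult_le_pos; lra. }
exists (1 + B * / m + Q).
assert (HBm : 0 <= B * / m) by (apply Rmult_le_pos; lra).
split; [lra|split].
- intros x Hx. unfold Rdiv. rewrite Rabs_mult. specialize (Hinv x Hx).
  rewrite (Rabs_right (/ ext_der x)) by lra.
  assert (Rabs (D2 x) * / ext_der x <= B * / m); [|lra].
  apply Rmult_le_compat; auto; try lra. apply Rabs_pos.
- intros x y t Hx Hy Ht Ht0.
  assert (HR : 0 < Rpower t (Rmin nu 1)) by apply exp_pos.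
  destruct (Req_dec x y) as [->|Hxy].
  { rewrite Rminus_diag. apply Rmult_le_pos; lra. }
  set (u := Rabs (x - y)) in *.
  assert (Hu : 0 < u <= 1).
  { unfold u. split; [apply Rabs_pos_lt; lra|]. apply Rabs_le. lra. }
  assert (Hmin : 0 < Rmin nu 1) by (apply Rmin_glb_lt; lra).
  assert (U1 : Rpower u nu <= Rpower t (Rmin nu 1)).
  { apply Rle_trans with (Rpower u (Rmin nu 1)).
    - apply Rpower_anti_exponent; auto. apply Rmin_l.
    - apply Rpower_mono_base; auto. lra. }
  assert (U2 : u <= Rpower t (Rmin nu 1)).
  { rewrite <- (Rpower_1 u) at 1 by lra. apply Rle_trans with (Rpower u (Rmin nu 1)).
    - apply Rpower_anti_exponent; auto. apply Rmin_r.
    - apply Rpower_mono_base; auto. lra. }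
  pose proof (ext_der_pos x Hx) as Px. pose proof (ext_der_pos y Hy) as Py.
  pose proof (Hinv x Hx) as Ix. pose proof (Hinv y Hy) as Iy.
  replace (D2 y / ext_der y - D2 x / ext_der x) with
    ((D2 y - D2 x) * / ext_der y + D2 x * (ext_der x - ext_der y) * (/ ext_der x * / ext_der y)) by (field; lra).
  specialize (HH y x Hy Hx). rewrite (Rabs_minus_sym y x) in HH. fold u in HH.
  set (w := Rpower t (Rmin nu 1)) in *.
  assert (T1 : (D2 y - D2 x) * / ext_der y <= H * w * / m).
  { apply Rle_trans with (Rabs (D2 y - D2 x) * / ext_der y).
    - apply Rmult_le_compat_r; [lra|apply Rle_abs].
    - apply Rmult_le_compat; try lra; [apply Rabs_pos|].
      eapply Rle_trans; [exact HH|]. apply Rmult_le_compat_l; auto. }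
  assert (T2 : D2 x * (ext_der x - ext_der y) * (/ ext_der x * / ext_der y) <= (B * (B * w)) * (/ m * / m)).
  { apply Rle_trans with (Rabs (D2 x * (ext_der x - ext_der y)) * (/ ext_der x * / ext_der y)).
    - apply Rmult_le_compat_r; [apply Rmult_le_pos; lra|apply Rle_abs].
    - rewrite Rabs_mult. apply Rmult_le_compat.
      + apply Rmult_le_pos; apply Rabs_pos.
      + apply Rmult_le_pos; lra.
      + apply Rmult_le_compat; try apply Rabs_pos; auto.
        eapply Rle_trans; [apply Lip; auto|]. apply Rmult_le_compat_l; auto.
      + apply Rmult_le_compat; lra. }
  assert (T3 : 0 <= (1 + B * / m) * w) by (apply Rmult_le_pos; lra).
  unfold Q. lra.
Qed.

(** The fundamental theorem of calculus is applied with two-sided continuity at the end points;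
    clamping the argument provides it, whatever [D2] is outside [[l, r]]. *)
Lemma D2_clamp_continuous x : l <= x <= r ->
  continuous (fun y => D2 (Rmax l (Rmin y r))) x.
Proof.
intros Hx. apply continuity_pt_filterlim. destruct holder_constant as [H [H0 HH]].
intros eps Heps.
(* [dl] solves [(H + 1) * dl ^ nu = eps]; the added 1 covers [H = 0]. *)
set (dl := Rpower (eps / (H + 1)) (/ nu)).
assert (Hq : 0 < eps / (H + 1)) by (apply Rdiv_lt_0_compat; lra).
exists dl. split; [apply exp_pos|]. intros y [_ Hy]. simpl in *. unfold R_dist in *.
set (c := Rmax l (Rmin y r)).
assert (Hcx : Rmax l (Rmin x r) = x) by (rewrite Rmin_left, Rmax_right; lra).
rewrite Hcx.
assert (Hc : l <= c <= r).
{ unfold c. split; [apply Rmax_l|]. apply Rmax_lub; [lra|apply Rmin_r]. }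
destruct (Req_dec c x) as [->|Hn]; [rewrite Rminus_diag, Rabs_R0; auto|].
assert (Hle : Rabs (c - x) <= Rabs (y - x)).
{ unfold c, Rmax, Rmin in *. destruct (Rle_dec y r); destruct (Rle_dec l _);
  repeat (unfold Rabs; destruct (Rcase_abs _)); lra. }
assert (Hp : 0 < Rabs (c - x)) by (apply Rabs_pos_lt; lra).
eapply Rle_lt_trans; [apply HH; auto|].
assert (Rpower (Rabs (c - x)) nu <= eps / (H + 1)).
{ apply Rle_trans with (Rpower dl nu); [apply Rpower_mono_base; lra|].
  unfold dl. rewrite Rpower_mult, Rinv_l, Rpower_1 by lra. lra. }
apply Rle_lt_trans with (H * (eps / (H + 1))); [apply Rmult_le_compat_l; auto|].
assert ((H + 1) * (eps / (H + 1)) = eps) by (field; lra). lra.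
Qed.

Lemma integral_nonlinearity (pr : Riemann_integrable (fun x => D2 x / D1 x) l r) :
  RiemannInt pr = ln (ext_der r) - ln (ext_der l).
Proof.
rewrite <- RInt_Reals.
rewrite (RInt_ext _ (fun x => D2 (Rmax l (Rmin x r)) / ext_der x)).
- apply is_RInt_unique.
  apply (is_RInt_derive (fun x => ln (ext_der x))); rewrite Rmin_left, Rmax_right by lra; intros x Hx.
  + rewrite (Rmin_left x r), Rmax_right by lra.
    apply is_derive_Reals. pose proof (ext_der_pos x Hx).
    replace (D2 x / ext_der x) with (/ ext_der x * D2 x) by (field; lra).
    apply (derivable_pt_lim_comp ext_der ln); [apply ext_der_derivable; auto|apply derivable_pt_lim_ln; auto].
  + apply continuity_pt_filterlim.
    apply (continuity_pt_div (fun y => D2 (Rmax l (Rmin y r))) ext_der).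
    * apply continuity_pt_filterlim, D2_clamp_continuous; auto.
    * apply derivable_continuous_pt. exists (D2 x). apply ext_der_derivable; auto.
    * pose proof (ext_der_pos x Hx). lra.
- rewrite Rmin_left, Rmax_right by lra. intros x Hx.
  rewrite (Rmin_left x r), Rmax_right by lra. unfold ext_der. rewrite lin_ext_eq by lra. auto.
Qed.

End Branch.

(** * Zooms close to the identity *)

Lemma derivable_within l r f x D : derivable_pt_lim f x D -> deriv_within (closed_int l r) f x D.
Proof.
intros H eps He. destruct (H eps He) as [dl Hd]. exists dl. split; [apply cond_pos|].
intros y _ Hn Hy. specialize (Hd (y - x) ltac:(lra) Hy).
replace (x + (y - x)) with y in Hd by ring. auto.
Qed.

Lemma sup_abs_exists f B : (forall x, 0 <= x <= 1 -> Rabs (f x) <= B) ->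
  exists s, is_lub (fun y => exists x, 0 <= x <= 1 /\ y = Rabs (f x)) s /\ s <= B.
Proof.
intros H. destruct (completeness (fun y => exists x, 0 <= x <= 1 /\ y = Rabs (f x))) as [s Hs].
- exists B. intros y [x [Hx ->]]. auto.
- exists (Rabs (f 0)), 0. split; [lra|auto].
- exists s. split; auto. apply Hs. intros y [x [Hx ->]]. auto.
Qed.

Lemma affine_derivable u v x : derivable_pt_lim (fun x => u + x * v) x v.
Proof.
assert (H : derivable_pt_lim (fun x => u + x * v) x (0 + (1 * v + x * 0))).
{ apply (derivable_pt_lim_plus (fct_cte u) (fun x => x * v)); [apply derivable_pt_lim_const|].
  apply (derivable_pt_lim_mult id (fct_cte v)); [apply derivable_pt_lim_id|apply derivable_pt_lim_const]. }
replace (0 + (1 * v + x * 0)) with v in H by ring. exact H.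
Qed.

(** If [c] is a mean value point of [F], the zoom has slope [F1 (l + x * w) / F1 c], a ratio of two
    slopes. As [N] is the derivative of [ln F1], its logarithm is at most [k] in absolute value.
    Each of the three sup norms is then at most [exp B * k]; for the first one, the zoom fixes 0. *)
Lemma zoom_close l r F F1 N k B : l < r ->
  (forall x, l <= x <= r -> derivable_pt_lim F x (F1 x)) ->
  (forall x, l <= x <= r -> derivable_pt_lim F1 x (N x * F1 x)) ->
  (forall x, l <= x <= r -> 0 < F1 x) ->
  (forall x, l <= x <= r -> Rabs (N x) * (r - l) <= k) -> k <= B ->
  exists Z1 Z2,
    (forall x, 0 <= x <= 1 ->
       deriv_within (closed_int 0 1) (zoom l r F) x (Z1 x) /\
       deriv_within (closed_int 0 1) Z1 x (Z2 x)) /\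
    dC2_id_le (zoom l r F) Z1 Z2 (3 * exp B * k).
Proof.
intros Hlr DF DF1 P HN HkB. set (w := r - l). assert (Hw : 0 < w) by (unfold w; lra).
destruct (mean_value F F1 l r) as [c [Hc Ec]]; [lra|auto|]. fold w in Ec.
pose proof (P c Hc) as Pc.
assert (HD : 0 < F r - F l) by (rewrite Ec; apply Rmult_lt_0_compat; auto).
assert (Hk : 0 <= k).
{ specialize (HN l ltac:(lra)). pose proof (Rabs_pos (N l)). fold w in HN.
  assert (0 <= Rabs (N l) * w) by (apply Rmult_le_pos; lra). lra. }
assert (Hy : forall x, 0 <= x <= 1 -> l <= l + x * w <= r).
{ intros x Hx. unfold w in *. nra. }
pose proof (affine_derivable l w) as Aff.
set (Z1 := fun x => F1 (l + x * w) / F1 c).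
set (Z2 := fun x => N (l + x * w) * w * Z1 x).
assert (DZ : forall x, 0 <= x <= 1 -> derivable_pt_lim (zoom l r F) x (Z1 x)).
{ intros x Hx. replace (Z1 x) with ((F1 (l + x * w) * w) * / (F r - F l)).
  2:{ unfold Z1. rewrite Ec. field. lra. }
  apply derivable_lim_ext with (fun x => (/ (F r - F l)) * (F (l + x * w) - F l)).
  { intros y. unfold zoom, w, Rdiv. ring. }
  rewrite Rmult_comm.
  apply (derivable_pt_lim_scal (fun x => F (l + x * w) - F l)).
  rewrite <- (Rminus_0_r (F1 (l + x * w) * w)).
  apply (derivable_pt_lim_minus (fun x => F (l + x * w)) (fct_cte (F l)));
    [|apply derivable_pt_lim_const].
  apply (derivable_pt_lim_comp (fun x => l + x * w) F); auto. }
assert (DZ1 : forall x, 0 <= x <= 1 -> derivable_pt_lim Z1 x (Z2 x)).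
{ intros x Hx. replace (Z2 x) with (/ F1 c * ((N (l + x * w) * F1 (l + x * w)) * w)).
  2:{ unfold Z2, Z1. field. lra. }
  apply derivable_lim_ext with (fun x => / F1 c * F1 (l + x * w)).
  { intros y. unfold Z1, Rdiv. ring. }
  apply (derivable_pt_lim_scal (fun x => F1 (l + x * w))).
  apply (derivable_pt_lim_comp (fun x => l + x * w) F1); auto. }
assert (Hln : forall y, l <= y <= r -> Rabs (ln (F1 y) - ln (F1 c)) <= k).
{ assert (A : forall u v, l <= u -> u <= v -> v <= r -> Rabs (ln (F1 v) - ln (F1 u)) <= k).
  { intros u v Hu Huv Hv. destruct (mean_value (fun y => ln (F1 y)) N u v Huv) as [s [Hs Es]].
    - intros s Hs. pose proof (P s ltac:(lra)).
      replace (N s) with (/ F1 s * (N s * F1 s)) by (field; lra).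
      apply (derivable_pt_lim_comp F1 ln); [apply DF1; lra|apply derivable_pt_lim_ln; auto].
    - rewrite Es, Rabs_mult, (Rabs_right (v - u)) by lra.
      eapply Rle_trans; [|apply (HN s); lra]. apply Rmult_le_compat_l; [apply Rabs_pos|lra]. }
  intros y Hy'. destruct (Rle_dec c y); [apply A; lra|].
  rewrite Rabs_minus_sym. apply A; lra. }
assert (BZ1 : forall x, 0 <= x <= 1 -> 0 < Z1 x <= exp B /\ Rabs (Z1 x - 1) <= exp B * k).
{ intros x Hx. specialize (Hln _ (Hy x Hx)). unabs Hln.
  pose proof (P _ (Hy x Hx)) as Px.
  assert (E : Z1 x = exp (ln (F1 (l + x * w)) - ln (F1 c))).
  { unfold Z1, Rminus. rewrite exp_plus, exp_Ropp, !exp_ln; auto. }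
  set (s := ln (F1 (l + x * w)) - ln (F1 c)) in *.
  assert (exp s <= exp B) by (apply exp_le_compat; lra).
  pose proof (exp_pos s). pose proof (exp_ineq1_le s). pose proof (exp_ineq1_le (- s)) as I2.
  assert (E2 : exp s * exp (- s) = 1) by (rewrite <- exp_plus, Rplus_opp_r; apply exp_0).
  assert (1 <= exp B) by (apply exp_ge_1; lra).
  rewrite E. split; [lra|]. apply Rabs_le. split.
  - assert (k <= exp B * k) by nra. lra.
  - assert (exp s - 1 <= s * exp s) by nra.
    assert (s * exp s <= k * exp s) by (apply Rmult_le_compat_r; lra).
    assert (k * exp s <= k * exp B) by (apply Rmult_le_compat_l; lra). lra. }
exists Z1, Z2. split.
{ intros x Hx. split; apply derivable_within; auto. }
destruct (sup_abs_exists (fun x => zoom l r F x - x) (exp B * k)) as [s0 [S0 B0]].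
{ intros x Hx.
  destruct (mean_value (fun x => zoom l r F x - x) (fun x => Z1 x - 1) 0 x) as [s [Hs Es]]; [lra| |].
  - intros s Hs. apply (derivable_pt_lim_minus (zoom l r F) id); [apply DZ; lra|apply derivable_pt_lim_id].
  - assert (Z0 : zoom l r F 0 = 0).
    { unfold zoom. rewrite Rmult_0_l, Rplus_0_r, Rminus_diag. unfold Rdiv. ring. }
    cbv beta in Es. rewrite Z0, !Rminus_0_r in Es. rewrite Es, Rabs_mult, (Rabs_right x) by lra.
    destruct (BZ1 s ltac:(lra)) as [_ Q]. pose proof (Rabs_pos (Z1 s - 1)).
    apply Rle_trans with (Rabs (Z1 s - 1) * 1); [|lra]. apply Rmult_le_compat_l; lra. }
destruct (sup_abs_exists (fun x => Z1 x - 1) (exp B * k)) as [s1 [S1 B1]].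
{ intros x Hx. apply BZ1; auto. }
destruct (sup_abs_exists (fun x => Z2 x - 0) (exp B * k)) as [s2 [S2 B2]].
{ intros x Hx. rewrite Rminus_0_r. unfold Z2. rewrite !Rabs_mult.
  destruct (BZ1 x Hx) as [Q _]. rewrite (Rabs_right w), (Rabs_right (Z1 x)) by lra.
  rewrite (Rmult_comm (exp B)). specialize (HN _ (Hy x Hx)). fold w in HN.
  apply Rmult_le_compat; try lra. apply Rmult_le_pos; [apply Rabs_pos|lra]. }
exists s0, s1, s2. repeat split; try apply S0; try apply S1; try apply S2. lra.
Qed.

(** * From interval exchanges to the abstract renormalization *)

Lemma Rsum_list_rsum v d : Rsum_list v d = rsum v d.
Proof.
unfold Rsum_list. induction d as [|d IH]; [reflexivity|].
rewrite seq_S, map_app, fold_right_app. simpl. rewrite <- IH. simpl.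
assert (A : forall l c, fold_right Rplus c l = fold_right Rplus 0 l + c).
{ induction l as [|x l IHl]; intros c; simpl; [ring|]. rewrite IHl. ring. }
rewrite A. ring.
Qed.

(** Each discontinuity is the left end of at most one letter, so the two allowed discontinuities
    give at most two breaks of the bottom row. *)
Lemma genus_one_blocks d g E : (2 <= d)%nat -> is_giem d g -> branch_ext d g E -> genus_one g ->
  exists p q, blocks d (pi0 g) (pi1 g) p q.
Proof.
intros Hd Hg HE [x1 [x2 Hx]].
assert (Hb : forall x, exists b1, forall b, (b < d)%nat -> lft g b = x -> pi0 g b = S b1).
{ intros x. destruct (classic (exists b, (b < d)%nat /\ lft g b = x)) as [[b [Hb Eb]]|Hn].
  - exists (pi0 g b - 1)%nat. intros c Hc Ec.
    assert (c = b).
    { apply (tiling_left_inj d (lft g) (rgt g) (pi0 g) (il g) (ir g) (giem_in d g Hg)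
        (giem_ranking0 d g Hg) (giem_order0 d g Hg)); auto. congruence. }
    subst c. pose proof (proj1 (giem_ranking0 d g Hg) b Hb). lia.
  (* This discontinuity is not a left end; no letter has rank 0, so the break is void. *)
  - exists 0%nat. intros b Hb Eb. exfalso. apply Hn. eauto. }
destruct (Hb x1) as [b1 H1]. destruct (Hb x2) as [b2 H2].
apply (blocks_exist d (pi0 g) (pi1 g) b1 b2); auto using giem_ranking0, giem_ranking1.
- destruct Hg as [_ [_ [_ [_ [_ [_ [_ [_ [_ [_ [_ [_ H]]]]]]]]]]]]. exact H.
- intros a b Ha Hb' Eab N1 N2. apply (break_discontinuous d g E Hg HE); auto.
  apply NNPP. intros Hc. pose proof (giem_in d g Hg b Hb').
  destruct (Hx (lft g b)) as [e|e]; auto; [unfold in_I; lra| |].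
  + specialize (H1 b Hb' e). lia.
  + specialize (H2 b Hb' e). lia.
Qed.

Theorem theorem3 (d k : nat) (nu : R) (Sq : nat -> giem) (eps : nat -> bool)
  (G0 D1 D2 : nat -> R -> R) :
  (2 <= d)%nat -> 0 < nu ->
  il (Sq 0%nat) = 0 -> ir (Sq 0%nat) = 1 ->
  (forall n, is_giem d (Sq n)) ->
  (forall n, RV_step d (Sq n) (Sq (S n)) (eps n)) ->
  k_bounded d k Sq eps ->
  genus_one (Sq 0%nat) -> no_connection d (Sq 0%nat) ->
  (forall a, (a < d)%nat ->
     C2nu_ext (lft (Sq 0%nat) a) (rgt (Sq 0%nat) a) (fmap (Sq 0%nat)) nu
              (G0 a) (D1 a) (D2 a)) ->
  (exists v : nat -> R,
     (forall a, (a < d)%nat ->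
        exists pr : Riemann_integrable (fun x => D2 a x / D1 a x)
                      (lft (Sq 0%nat) a) (rgt (Sq 0%nat) a),
          RiemannInt pr = v a) /\
     Rsum_list v d = 0) ->
  exists C lam, 0 < C /\ 0 < lam < 1 /\
    forall n a, (a < d)%nat ->
      exists G Z1 Z2 : R -> R,
        (forall x, lft (Sq n) a <= x < rgt (Sq n) a -> G x = fmap (Sq n) x) /\
        (forall x, lft (Sq n) a <= x <= rgt (Sq n) a ->
           cont_within (closed_int (lft (Sq n) a) (rgt (Sq n) a)) G x) /\
        (forall x, 0 <= x <= 1 ->
           deriv_within (closed_int 0 1) (zoom (lft (Sq n) a) (rgt (Sq n) a) G) x (Z1 x) /\
           deriv_within (closed_int 0 1) Z1 x (Z2 x)) /\
        dC2_id_le (zoom (lft (Sq n) a) (rgt (Sq n) a) G) Z1 Z2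
                  (C * Rpower lam (sqrt (INR n))).
Proof.
intros Hd Hnu Hil Hir Hg HS Hk Hgen _ HC [v [Hv Hv0]].
set (L := fun n => lft (Sq n)). set (U := fun n => rgt (Sq n)).
set (sn := fun n => letter_at d (pi0 (Sq n)) d).
set (fs := fun n => letter_at d (pi1 (Sq n)) d).
set (pp := fun n => pi0 (Sq n) (fs n)).
(* Block C starts with the letter that opens the bottom row, so B ends one rank earlier. *)
set (qq := fun n => (pi0 (Sq n) (letter_at d (pi1 (Sq n)) 1) - 1)%nat).
set (g0 := fun a => ext_map (L 0%nat a) (U 0%nat a) (G0 a) (D1 a)).
set (g1 := fun a => ext_der (L 0%nat a) (U 0%nat a) (D1 a) (D2 a)).
assert (R0 : forall n, ranking d (pi0 (Sq n))) by (intros; apply giem_ranking0; auto).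
assert (R1 : forall n, ranking d (pi1 (Sq n))) by (intros; apply giem_ranking1; auto).
assert (Hsn : forall n, (sn n < d)%nat /\ pi0 (Sq n) (sn n) = d) by (intros; apply letter_at_spec; auto; lia).
assert (Hfs : forall n, (fs n < d)%nat /\ pi1 (Sq n) (fs n) = d) by (intros; apply letter_at_spec; auto; lia).
assert (HLU : forall n b, (b < d)%nat -> L n b < U n b) by (intros n b Hb; apply (giem_in d _ (Hg n) b Hb)).
assert (H01 : forall a, (a < d)%nat -> 0 <= L 0%nat a /\ L 0%nat a < U 0%nat a /\ U 0%nat a <= 1).
{ intros a Ha. pose proof (giem_in d _ (Hg 0%nat) a Ha) as H. rewrite Hil, Hir in H. exact H. }
assert (Hg0 : forall b x, (b < d)%nat -> dom L U 0 b x -> derivable_pt_lim (g0 b) x (g1 b x)).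
{ intros b x Hb Hx. apply (ext_map_derivable _ _ _ _ _ _ _ (H01 b Hb) (HC b Hb)); auto. }
assert (Hg1 : forall b x, (b < d)%nat -> dom L U 0 b x -> derivable_pt_lim (g1 b) x (D2 b x)).
{ intros b x Hb Hx. apply (ext_der_derivable _ _ _ _ _ _ _ (H01 b Hb) (HC b Hb)); auto. }
assert (Hpos : forall b x, (b < d)%nat -> dom L U 0 b x -> 0 < g1 b x).
{ intros b x Hb Hx. apply (ext_der_pos _ _ _ _ _ _ _ (HC b Hb)); auto. }
assert (HqB : forall n p q, blocks d (pi0 (Sq n)) (pi1 (Sq n)) p q -> p = pp n /\ q = qq n).
{ intros n p q B. destruct (Hfs n) as [F1 F2].
  destruct (letter_at_spec d (pi1 (Sq n)) 1 (R1 n) ltac:(lia)) as [F3 F4].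
  split; [symmetry; apply (blocks_top _ _ _ _ _ _ (R0 n) B); auto|].
  unfold qq. rewrite (blocks_bottom _ _ _ _ _ _ (R0 n) B F3 F4). lia. }
assert (Hne' : forall n p q, blocks d (pi0 (Sq n)) (pi1 (Sq n)) p q -> fs n <> sn n).
{ intros n p q B e. destruct (Hfs n) as [F1 F2]. pose proof (blocks_top _ _ _ _ _ _ (R0 n) B F1 F2) as P.
  rewrite e, (proj2 (Hsn n)) in P. destruct B as [B1 [B2 _]]. lia. }
assert (Inv : forall n, branch_ext d (Sq n) (G fs sn eps g0 n) /\
   exists p q, blocks d (pi0 (Sq n)) (pi1 (Sq n)) p q).
{ induction n as [|n [IHE [p [q IHB]]]].
  - assert (BE : branch_ext d (Sq 0%nat) g0).
    { intros a Ha.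
      assert (Der : forall x, lft (Sq 0%nat) a <= x <= rgt (Sq 0%nat) a -> derivable_pt_lim (g0 a) x (g1 a x))
        by (intros x Hx; apply Hg0; auto).
      split; [|split].
      - intros x Hx. unfold g0, ext_map. rewrite lin_ext_eq by (unfold L, U; lra). apply (HC a Ha). auto.
      - intros x y Hx Hxy Hy.
        destruct (mean_value (g0 a) (g1 a) x y) as [c [Hc Ec]]; [lra|intros; apply Der; lra|].
        assert (0 < g1 a c) by (apply Hpos; auto; unfold dom, L, U; lra).
        assert (0 < g1 a c * (y - x)) by (apply Rmult_lt_0_compat; lra). lra.
      - intros x Hx. apply derivable_continuous_pt. exists (g1 a x). apply Der; auto. }
    split; [exact BE|]. apply (genus_one_blocks d _ _ Hd (Hg 0%nat) BE Hgen).
  - destruct (Hsn n) as [S1 S2]. destruct (Hfs n) as [F1 F2]. pose proof (Hne' n p q IHB) as Hne.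
    split.
    (* [G] at level [n + 1] unfolds to [step_ext], so the statement applies by conversion. *)
    + exact (step_branch_ext d (Sq n) (Sq (S n)) _ (eps n) (sn n) (fs n) (Hg n) (Hg (S n)) IHE (HS n)
        S1 F1 Hne S2 F2).
    + assert (Te : eps n = true \/ eps n = false) by (destruct (eps n); auto).
      destruct Te as [Ee|Ee].
      * eexists _, _. apply (step_blocks1 d (Sq n) _ _ _ _ _ (Hg n) (Hg (S n)) IHE (HS n) S1 F1 Hne S2 F2 _ _ Ee IHB).
      * eexists _, _. apply (step_blocks0 d (Sq n) _ _ _ _ _ (Hg n) (Hg (S n)) IHE (HS n) S1 F1 Hne S2 F2 _ _ Ee IHB). }
assert (HE : forall n, branch_ext d (Sq n) (G fs sn eps g0 n)) by (intros n; apply Inv).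
assert (HB : forall n, blocks d (pi0 (Sq n)) (pi1 (Sq n)) (pp n) (qq n)).
{ intros n. destruct (proj2 (Inv n)) as [p [q B]]. destruct (HqB n p q B) as [<- <-]. auto. }
assert (Hne : forall n, fs n <> sn n) by (intros n; eapply Hne', HB).
assert (Hfs' : forall n, (fs n < d)%nat) by apply Hfs.
assert (Hsn' : forall n, (sn n < d)%nat) by apply Hsn.
assert (Hst0 : forall n, eps n = false ->
     (forall b, (b < d)%nat -> L (S n) b = L n b) /\
     (forall b, (b < d)%nat -> b <> sn n -> U (S n) b = U n b) /\
     U (S n) (sn n) = G fs sn eps g0 n (fs n) (L n (fs n))).
{ intros n Ee.
  destruct (step_type0 d (Sq n) (Sq (S n)) _ (eps n) (sn n) (fs n) (Hg n) (Hg (S n)) (HE n) (HS n)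
    (Hsn' n) (Hfs' n) (Hne n) (proj2 (Hsn n)) (proj2 (Hfs n)) Ee) as [K1 [K2 [K3 _]]]. auto. }
assert (Hst1 : forall n, eps n = true ->
     (forall b, (b < d)%nat -> b <> fs n -> b <> sn n ->
        L (S n) b = L n b /\ U (S n) b = U n b) /\
     L (S n) (fs n) = L n (fs n) /\ U (S n) (fs n) = L (S n) (sn n) /\
     U (S n) (sn n) = U n (fs n) /\ G fs sn eps g0 n (fs n) (L (S n) (sn n)) = L n (sn n)).
{ intros n Ee.
  destruct (step_type1 d (Sq n) (Sq (S n)) _ (eps n) (sn n) (fs n) (Hg n) (Hg (S n)) (HE n) (HS n)
    (Hsn' n) (Hfs' n) (Hne n) (proj2 (Hsn n)) (proj2 (Hfs n)) Ee)
    as [K1 [K2 [K3 [K4 [K5 _]]]]]. auto. }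
assert (HGU : forall n, G fs sn eps g0 n (fs n) (U n (fs n)) = U n (sn n)).
{ intros n. destruct (step_right_end d (Sq n) _ (sn n) (fs n) (Hg n) (HE n)
    (Hsn' n) (Hfs' n) (proj2 (Hsn n)) (proj2 (Hfs n))) as [K1 K2]. unfold U. congruence. }
(* One constant [M >= 1] serves all letters, both as the bound of the nonlinearity and as its Hölder
   constant. *)
destruct (finite_uniform d (fun a C => 0 <= C /\
   (forall x, dom L U 0 a x -> Rabs (D2 a x / g1 a x) <= C) /\
   (forall x y t, dom L U 0 a x -> dom L U 0 a y -> Rabs (x - y) <= t -> 0 < t ->
     D2 a y / g1 a y - D2 a x / g1 a x <= C * Rpower t (Rmin nu 1)))) as [M [HM1 HM]].
{ intros a c c' [A1 [A2 A3]] Hc. split; [lra|split].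
  - intros x Hx. specialize (A2 x Hx). lra.
  - intros x y t Hx Hy Ht Ht0. specialize (A3 x y t Hx Hy Ht Ht0).
    assert (0 < Rpower t (Rmin nu 1)) by apply exp_pos. nra. }
{ intros a Ha. destruct (nonlinearity_bounds _ _ _ _ _ _ _ (H01 a Ha) Hnu (HC a Ha)) as [C [C1 [C2 C3]]].
  exists C. split; [lra|]. split; auto. }
assert (Hk1 : (1 <= k)%nat).
{ destruct (Hk 0%nat 0%nat 0%nat) as [n1 [p [A1 [A2 _]]]]; lia. }
assert (Hws : forall n b, winner d (Sq n) (eps n) b -> ws fs sn eps n = b).
{ intros n b [Hb W]. unfold ws. destruct (eps n); apply letter_at_unique; auto. }
assert (Hls : forall n b, loser d (Sq n) (eps n) b -> ls fs sn eps n = b).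
{ intros n b [Hb W]. unfold ls. destruct (eps n); apply letter_at_unique; auto. }
assert (Hchain : forall n b c, (b < d)%nat -> (c < d)%nat -> exists n1 p,
     (n <= n1)%nat /\ (n1 + p < n + 2 * k)%nat /\ ws fs sn eps n1 = b /\ ls fs sn eps (n1 + p) = c /\
     forall i, (i < p)%nat -> ls fs sn eps (n1 + i) = ws fs sn eps (n1 + i + 1)).
(* Centring at [n + k] turns the two-sided window of [k_bounded] into one that starts at [n] and has
   length [2 * k]. *)
{ intros n b c Hb Hc. destruct (Hk (n + k)%nat b c Hb Hc) as [n1 [p [A1 [A2 [A3 [A4 [A5 [A6 A7]]]]]]]].
  exists n1, p. split; [lia|]. split; [lia|]. split; [auto|]. split; [auto|].
  intros i Hi. destruct (A7 i Hi) as [a [B1 B2]]. rewrite (Hls _ _ B1), (Hws _ _ B2). auto. }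
assert (Hmass : forall n, rsum (fun b => (G fs sn eps g0 n b (U n b) - G fs sn eps g0 n b (L n b))
   - (U n b - L n b)) d = 0).
{ intros n. apply (giem_mass d (Sq n) _ (Hg n) (HE n)). lia. }
assert (Hzero : rsum (fun b => ln (g1 b (U 0%nat b)) - ln (g1 b (L 0%nat b))) d = 0).
{ rewrite <- Hv0, Rsum_list_rsum. apply rsum_ext. intros a Ha. destruct (Hv a Ha) as [pr <-].
  symmetry. apply (integral_nonlinearity _ _ _ _ _ _ _ (H01 a Ha) Hnu (HC a Ha)). }
assert (Hpq : forall n, (1 <= pp n <= qq n)%nat /\ (qq n < d)%nat)
  by (intros n; split; apply (HB n)).
assert (Hp0 : forall n, eps n = false ->
     (forall b, (b < d)%nat -> pi0 (Sq (S n)) b = pi0 (Sq n) b) /\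
     qq (S n) = qq n /\ pp (S n) = if Nat.eqb (pp n) 1 then qq n else (pp n - 1)%nat).
{ intros n Ee.
  destruct (step_ranks0 d (Sq n) (Sq (S n)) _ (eps n) (sn n) (fs n) (Hg n) (Hg (S n)) (HE n) (HS n)
     (Hsn' n) (Hfs' n) (Hne n) (proj2 (Hsn n)) (proj2 (Hfs n)) Ee) as [K1 K2].
  split; auto.
  destruct (HqB (S n) _ _ (step_blocks0 d (Sq n) _ _ _ _ _ (Hg n) (Hg (S n)) (HE n) (HS n)
     (Hsn' n) (Hfs' n) (Hne n) (proj2 (Hsn n)) (proj2 (Hfs n)) _ _ Ee (HB n))) as [<- <-]. auto. }
assert (Hp1 : forall n, eps n = true ->
     (forall b, (b < d)%nat -> pi0 (Sq (S n)) b =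
        if Nat.eqb b (sn n) then (pp n + 1)%nat
        else if Nat.leb (pi0 (Sq n) b) (pp n) then pi0 (Sq n) b else (pi0 (Sq n) b + 1)%nat) /\
     pp (S n) = pp n /\ qq (S n) = if Nat.eqb (qq n) (d - 1) then pp n else (qq n + 1)%nat).
{ intros n Ee.
  destruct (step_ranks1 d (Sq n) (Sq (S n)) _ (eps n) (sn n) (fs n) (Hg n) (Hg (S n)) (HE n) (HS n)
     (Hsn' n) (Hfs' n) (Hne n) (proj2 (Hsn n)) (proj2 (Hfs n)) Ee) as [K1 K2].
  split; [exact K2|].
  destruct (HqB (S n) _ _ (step_blocks1 d (Sq n) _ _ _ _ _ (Hg n) (Hg (S n)) (HE n) (HS n)
     (Hsn' n) (Hfs' n) (Hne n) (proj2 (Hsn n)) (proj2 (Hfs n)) _ _ Ee (HB n))) as [<- <-]. auto. }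
assert (Hkw : (1 <= 2 * k)%nat) by lia.
destruct (slopes_bounded d L U fs sn eps g0 g1 D2 Hd Hfs' Hsn' Hne HLU Hst0 Hst1 HGU Hg0 Hg1 Hpos
  M HM1 (fun b x Hb => proj1 (proj2 (HM b Hb)) x) (fun n => pi0 (Sq n)) pp qq R0 Hpq
  (fun n => eq_refl) (fun n => proj2 (Hsn n)) Hp0 Hp1 (2 * k)%nat Hkw Hchain Hmass) as [Om [HOm0 HOm]].
assert (Hnu' : 0 < Rmin nu 1) by (apply Rmin_glb_lt; lra).
destruct (nonlinearity_decay d L U fs sn eps g0 g1 D2 Hd Hfs' Hsn' Hne HLU Hst0 Hst1 HGU Hg0 Hg1 Hpos
  M HM1 (fun b x Hb => proj1 (proj2 (HM b Hb)) x) M (Rmin nu 1) ltac:(lra) Hnu'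
  (fun b x y t Hb => proj2 (proj2 (HM b Hb)) x y t) Om HOm0 HOm (2 * k)%nat Hkw
  (every_visit d fs sn eps g0 g1 Hd Hfs' Hsn' (2 * k)%nat Hkw Hchain) Hzero)
  as [C [lam [HC0 [Hlam Hdec]]]].
exists (3 * exp C * C), lam. pose proof (exp_pos C).
split; [apply Rmult_lt_0_compat; lra|]. split; [exact Hlam|]. intros n a Ha.
set (kap := C * Rpower lam (sqrt (INR n))) in *.
(* This crude bound makes the factor [exp C] from [zoom_close] independent of [n]. *)
assert (Hkap : kap <= C).
{ unfold kap. rewrite <- (Rmult_1_r C) at 2. apply Rmult_le_compat_l; [lra|].
  unfold Rpower. rewrite <- exp_0. apply exp_le_compat.
  assert (ln lam < 0) by (rewrite <- ln_1; apply ln_increasing; lra).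
  pose proof (sqrt_pos (INR n)). nra. }
destruct (zoom_close (L n a) (U n a) (G fs sn eps g0 n a) (G1 fs sn eps g0 g1 n a)
  (nonlin fs sn eps g0 g1 D2 n a) kap C) as [Z1 [Z2 [HZ HZd]]]; auto.
- intros x Hx. apply (G_der d L U fs sn eps g0 g1 Hd Hfs' Hsn' Hne HLU Hst0 Hst1 HGU Hg0 Hpos); auto.
- intros x Hx. apply (G1_der d L U fs sn eps g0 g1 D2 Hd Hfs' Hsn' Hne HLU Hst0 Hst1 HGU Hg0 Hg1 Hpos); auto.
- intros x Hx. apply (G1_pos d L U fs sn eps g0 g1 Hd Hfs' Hsn' Hne HLU Hst0 Hst1 HGU Hg0 Hpos); auto.
- exists (G fs sn eps g0 n a), Z1, Z2. split; [|split; [|split; [exact HZ|]]].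
  + intros x Hx. apply (HE n a Ha). auto.
  + intros x Hx e He. destruct (proj2 (proj2 (HE n a Ha)) x Hx e He) as [dl [Hdl Hc]].
    exists dl. split; auto. intros y _ Hy. destruct (Req_dec y x) as [->|Hn].
    * rewrite Rminus_diag, Rabs_R0. auto.
    * apply Hc. split; [split; [exact I|auto]|exact Hy].
  + replace (3 * exp C * C * Rpower lam (sqrt (INR n))) with (3 * exp C * kap) by (unfold kap; ring).
    exact HZd.
Qed.
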